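(* Consider a family in prenormal form $(x^2-\epsilon)y'=B(\epsilon,x)y$, with $r$ and then $\rho$ sufficiently small. Suppose that both unfolded Stokes matrices admit, after conjugation (if necessary) by the same permutation matrix $P_0$ preserving their triangular form, the same decomposition in diagonal blocks for all $\hat\epsilon\in S$; that is, $P_0^{-1}\hat C_lP_0=\hat c^{\,l}_{n_1}\oplus\hat c^{\,l}_{n_2}\oplus\dots\oplus\hat c^{\,l}_{n_m}$ for $l=L,R$ and all $\hat\epsilon\in S$, with blocks of sizes $n_1,\dots,n_m$, $n_1+\dots+n_m=n$, and with $P_0^{-1}\hat C_RP_0$ upper triangular and $P_0^{-1}\hat C_LP_0$ lower triangular. Then this family of systems is analytically equivalent (with the permutation $P_0$) to the direct product of families of systems: there is an invertible matrix $\mathcal Q(\epsilon,x)$ of germs of analytic functions of $(\epsilon,x)$ at the origin such that $y=P_0\mathcal Q(\epsilon,x)v$ transforms the family into $(x^2-\epsilon)v'=\big(B_{n_1}(\epsilon,x)\oplus B_{n_2}(\epsilon,x)\oplus\dots\oplus B_{n_m}(\epsilon,x)\big)v$, where $B_{n_i}$ is an $n_i\times n_i$ matrix of germs of analytic functions of $(\epsilon,x)$ at the origin.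
   Context: Systems. A family in prenormal form is a family $(x^2-\epsilon)y'=B(\epsilon,x)y$, $y\in\mathbb{C}^n$, $n\ge2$, $'=d/dx$, with $B=\Lambda(\epsilon,x)+(x^2-\epsilon)R(\epsilon,x)$, $\Lambda(\epsilon,x)=\mathrm{diag}\{\lambda_1(\epsilon,x),\dots,\lambda_n(\epsilon,x)\}=\Lambda_0(\epsilon)+\Lambda_1(\epsilon)x$, $\Lambda_0,\Lambda_1$ diagonal and analytic in $\epsilon$ near $0$, $R$ a matrix of germs of analytic functions of $(\epsilon,x)$ at the origin, and $\Re(\lambda_q(0,0)-\lambda_j(0,0))>0$ for $q<j$. Model system: $(x^2-\epsilon)z'=\Lambda(\epsilon,x)z$. Parameter sector. Let $\theta_0$ be the largest angle (supremum) in $(0,\frac\pi2)$ with $\Re(e^{\pm i\theta_0}(\lambda_q(0,0)-\lambda_j(0,0)))\ge0$ for $q<j$. Fix $\gamma>0$ with $\gamma(1+\frac{2\gamma}{\pi})<\theta_0$ and let $S=\{\hat\epsilon:0<|\hat\epsilon|<\rho,\ \arg\hat\epsilon\in(\pi-2\gamma,3\pi+2\gamma)\}$ (on the universal covering of $\mathbb{C}^*$; $\epsilon$ is the projection of $\hat\epsilon$). Put $\arg\sqrt{\hat\epsilon}=\frac12\arg\hat\epsilon$, $\hat x_L=\sqrt{\hat\epsilon}$, $\hat x_R=-\sqrt{\hat\epsilon}$. The radius $\rho>0$ is small, in particular so that for some $C>0$, $\Re(e^{\pm i\gamma(1+2\gamma/\pi)}(\lambda_q(\epsilon,\hat x_l)-\lambda_j(\epsilon,\hat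 x_l)))>C$ for $q<j$, $l=L,R$, $\hat\epsilon\in S$. $S_\cap$ is the auto-intersection of $S$: it consists of the pairs $\bar\epsilon$, $\tilde\epsilon=\bar\epsilon e^{2\pi i}$ both in $S$. Sectorial domains. Fix $r>0$ small, $\mathbb{D}_r=\{|x|<r\}$, $\delta>0$ small, $\Omega_D=\{|x|<r,\,-(\pi+\delta)<\arg x<\delta\}$, $\Omega_U=\{|x|<r,\,-\delta<\arg x<\pi+\delta\}$, such that the closure of $\Omega_D$ (resp. $\Omega_U$) contains no ray $\Re((\lambda_q(0,0)-\lambda_j(0,0))/x)=0$, $q\ne j$, of the upper (resp. lower) half-plane. Use the time $t$ of $\dot x=x^2-\epsilon$: $x(t)=-\sqrt{\hat\epsilon}\coth(\sqrt{\hat\epsilon}\,t)$ if $\epsilon\neq0$ (period $\pi i/\sqrt{\hat\epsilon}$), $x(t)=-1/t$ if $\epsilon=0$. Fix small constants $c_0>0$, $h\in(0,1/r)$, $\kappa\in(0,\frac12)$ independent of $\hat\epsilon$. Let $N_{\hat\epsilon}$ be the connected component containing $t=0$ of $\{t:|x(t)|\ge r\}$, $P=-\pi i/\sqrt{\hat\epsilon}$, $\hat\theta=\frac{2\gamma}{\pi}(\pi-\arg\sqrt{\hat\epsilon})$, and $\sigma(u)=0$ if $|u|\le c_0/\sqrt{|\epsilon|}$, $\sigma(u)=(u-\mathrm{sgn}(u)c_0/\sqrt{|\epsilon|})\tan\hat\theta$ otherwise. $\Gamma_D^{\hat\epsilon}$ is the set of $t\notin N_{\hat\epsilon}$ with $\Im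 t<h+\sigma(\Re t)$ lying above the line $-(\frac12+\kappa)P+\mathbb{R}e^{i\hat\theta}$; $\Gamma_U^{\hat\epsilon}$ is the set of $t\notin N_{\hat\epsilon}$ with $\Im t>-h+\sigma(\Re t)$ lying below the line $(\frac12+\kappa)P+\mathbb{R}e^{i\hat\theta}$. $\Omega_s^{\hat\epsilon}=x(\Gamma_s^{\hat\epsilon})$, $s=D,U$. $\Omega_D^{\hat\epsilon}\cap\Omega_U^{\hat\epsilon}$ has three connected components $\Omega_L^{\hat\epsilon},\Omega_R^{\hat\epsilon},\Omega_C^{\hat\epsilon}$, images of the right and left components of $\Gamma_D^{\hat\epsilon}\cap\Gamma_U^{\hat\epsilon}$ and of $\Gamma_D^{\hat\epsilon}\cap(\Gamma_U^{\hat\epsilon}-P)$; their closures contain respectively $\hat x_L$, $\hat x_R$, and both; $0\in\Omega_C^{\hat\epsilon}$. Model solutions. For $l=L,R$, $\mathcal U_l=\frac1{2\hat x_l}\Lambda(\epsilon,\hat x_l)$. $F(\epsilon,x)=(x-\hat x_R)^{\mathcal U_R}(x-\hat x_L)^{\mathcal U_L}$ is a fundamental matrix of the model. $F_D(\hat\epsilon,\cdot)$ is its branch on $\Omega_D^{\hat\epsilon}$ (namely $e^{t\Lambda_0}(x^2-\epsilon)^{\Lambda_1/2}$ with $x=x(t)$, $t\in\Gamma_D^{\hat\epsilon}$, converging as $\hat\epsilon\to0$ to $x^{\Lambda_1(0)}e^{-\Lambda_0(0)/x}$ with $-(\pi+\delta)<\arg x<\delta$), and $F_U(\hat\epsilon,\cdot)$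 is the analytic continuation of $F_D$ to $\Omega_U^{\hat\epsilon}$ through $\Omega_R^{\hat\epsilon}$. Unfolded Stokes matrices. $H_s(\hat\epsilon,x)$, $s=D,U$, are matrices, analytic for $\hat\epsilon\in S$, $x\in\Omega_s^{\hat\epsilon}$, such that $W_s=H_sF_s$ is a fundamental matrix of solutions of the family on $\Omega_s^{\hat\epsilon}$; $\lim_{x\to\hat x_l,x\in\Omega_s^{\hat\epsilon}}H_s(\hat\epsilon,x)$ ($l=L,R$) is an invertible diagonal matrix independent of $s$, analytic in $\hat\epsilon\in S$ with nonsingular limit at $\epsilon=0$; $|H_s(\bar\epsilon,0)-H_s(\tilde\epsilon,0)|\le c|\bar\epsilon|$ on $S_\cap$ for some $c\ge0$; and $|H_s(\hat\epsilon,0)|$, $|H_s(\hat\epsilon,0)^{-1}|$ are bounded on $S_\cap$. The unfolded Stokes matrices $\hat C_R$ (upper triangular unipotent) and $\hat C_L$ (lower triangular unipotent) are defined by $H_D^{-1}H_U=F_D\hat C_RF_D^{-1}$ on $\Omega_R^{\hat\epsilon}$, $H_D^{-1}H_U=F_D\hat C_LF_D^{-1}$ on $\Omega_L^{\hat\epsilon}$ (and $H_D^{-1}H_U=I$ on $\Omega_C^{\hat\epsilon}$). They are unique up to simultaneous conjugation by an invertible diagonal matrix. Two families are (locally) analytically equivalent if an invertible matrix $P_1(\epsilon,x)$ of germs of analytic functions of $(\epsilon,x)$ at the origin exists such that $y=P_1(\epsilon,x)z$ transforms one into the other. *)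

(* Defs.v *)
From HB Require Import structures.
From mathcomp Require Import all_boot all_order all_algebra.
From mathcomp Require Import all_fingroup.
From mathcomp Require Import all_classical all_reals all_analysis.
From mathcomp Require Import complex.

Set Implicit Arguments.
Unset Strict Implicit.
Unset Printing Implicit Defensive.

Import Order.TTheory GRing.Theory Num.Theory.
Import numFieldNormedType.Exports.
Local Open Scope classical_set_scope.
Local Open Scope ring_scope.
Local Open Scope complex_scope.

(* The complex numbers [R[i]] as a normed module over themselves, so that
   [differentiable], [derivable] and [derive1] mean complex differentiation. *)
HB.instance Definition _ (R : realType) :=
  GRing.ComAlgebra.copy R[i] (R[i] : numFieldType)^o.
HB.instance Definition _ (R : realType) :=
  Vector.copy R[i] (R[i] : numFieldType)^o.
HB.instance Definition _ (R : realType) :=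
  NormedModule.copy R[i] (R[i] : numFieldType)^o.

Section Unfolding.
Context {R : realType}.
Local Notation C := R[i].
Local Notation Re := (@complex.Re R).
Local Notation Im := (@complex.Im R).

Definition cmod (z : C) : R := Re `|z|.
Definition cexp (z : C) : C := (expR (Re z))%:C * (cos (Im z) +i* sin (Im z)).
Definition ccosh (z : C) : C := (cexp z + cexp (- z)) / 2.
Definition csinh (z : C) : C := (cexp z - cexp (- z)) / 2.
Definition cis (th : R) : C := cexp (0 +i* th).

Definition mx_derivable m n (y : C -> 'M[C]_(m, n)) (x : C) : Prop :=
  forall i j, derivable (fun u => y u i j) x 1.
Definition mx_derive m n (y : C -> 'M[C]_(m, n)) (x : C) : 'M[C]_(m, n) :=
  \matrix_(i, j) derive1 (fun u => y u i j) x.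

(* "Analytic" is rendered as holomorphic, i.e. complex (Frechet)
   differentiable at every point of an open set. A germ at the origin is given
   by a total function, constrained only near the origin. *)
Definition analytic_germ1 m n (f : C -> 'M[C]_(m, n)) : Prop :=
  \forall e \near (0 : C), mx_derivable f e.

Definition analytic_germ2 m n (f : C -> C -> 'M[C]_(m, n)) : Prop :=
  forall i j, \forall p \near ((0, 0) : C * C),
    differentiable (fun q : C * C => f q.1 q.2 i j) p.

Definition Lam n (L0 L1 : C -> 'rV[C]_n) (e x : C) : 'rV[C]_n :=
  L0 e + x *: L1 e.

Definition prenormal n (L0 L1 : C -> 'rV[C]_n) (Rm : C -> C -> 'M[C]_n) : Prop :=
  [/\ analytic_germ1 L0, analytic_germ1 L1, analytic_germ2 Rm &
      forall q j : 'I_n, (q < j)%N ->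
        0 < Re (Lam L0 L1 0 0 ord0 q - Lam L0 L1 0 0 ord0 j)].

Definition family_mx n (L0 L1 : C -> 'rV[C]_n) (Rm : C -> C -> 'M[C]_n)
    (e x : C) : 'M[C]_n :=
  diag_mx (Lam L0 L1 e x) + (x ^+ 2 - e) *: Rm e x.

(* (x^2 - e) y' = B(e, x) y at the point x; for k = 1 a vector solution, for
   k = n a matrix whose columns are solutions. *)
Definition solves_at n k (B : C -> C -> 'M[C]_n) (e : C)
    (y : C -> 'M[C]_(n, k)) (x : C) : Prop :=
  mx_derivable y x /\ (x ^+ 2 - e) *: mx_derive y x = B e x *m y x.

Definition fundamental n (B : C -> C -> 'M[C]_n) (e : C) (Om : set C)
    (W : C -> 'M[C]_n) : Prop :=
  forall x, Om x -> W x \in unitmx /\ solves_at B e W x.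

(* y = T(e, x) v transforms the family of matrix B into that of matrix B'. *)
Definition transforms n (B B' T : C -> C -> 'M[C]_n) : Prop :=
  \forall p \near ((0, 0) : C * C), forall v : C -> 'cV[C]_n,
    solves_at B p.1 (fun x => T p.1 x *m v x) p.2 <-> solves_at B' p.1 v p.2.

Definition theta0 n (L0 L1 : C -> 'rV[C]_n) : R :=
  sup [set th : R | 0 < th < pi / 2 /\
    forall q j : 'I_n, (q < j)%N ->
      0 <= Re (cis th * (Lam L0 L1 0 0 ord0 q - Lam L0 L1 0 0 ord0 j)) /\
      0 <= Re (cis (- th) * (Lam L0 L1 0 0 ord0 q - Lam L0 L1 0 0 ord0 j))].

(* The universal covering of C^* is exp : C -> C^*. A point of the covering is
   represented by w = log|eps| + i arg(eps), so that eps = exp w,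
   sqrt(eps) = exp (w/2), the deck transformation eps |-> eps e^(2 pi i) is
   w |-> w + 2 pi i, and analyticity in the covering is analyticity in w. *)
Definition eps (w : C) : C := cexp w.
Definition sqrt_eps (w : C) : C := cexp (w / 2).
Definition arg_eps (w : C) : R := Im w.
Definition arg_sqrt_eps (w : C) : R := arg_eps w / 2.
Definition xL (w : C) : C := sqrt_eps w.
Definition xR (w : C) : C := - sqrt_eps w.
Definition next_sheet (w : C) : C := w + (0 +i* (2 * pi)).

Record consts := Consts {
  gam : R; rho : R; rdisc : R; del : R; c0 : R; hgt : R; kap : R }.

Implicit Type K : consts.

Definition Sdom K : set C :=
  [set w | cmod (eps w) < rho K /\
           pi - 2 * gam K < arg_eps w < 3 * pi + 2 * gam K].

Definition Sdom_cap K : set C := [set w | Sdom K w /\ Sdom K (next_sheet w)].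

Definition Sdom_to0 K : set_system C :=
  filter_from [set d : R | 0 < d]
    (fun d => [set w | Sdom K w /\ cmod (eps w) < d]).

Definition spectral_gap n (L0 L1 : C -> 'rV[C]_n) K : Prop :=
  exists2 Cst : R, 0 < Cst & forall w, Sdom K w ->
    forall a, a = gam K * (1 + 2 * gam K / pi) \/
              a = - (gam K * (1 + 2 * gam K / pi)) ->
    forall x, x = xL w \/ x = xR w ->
    forall q j : 'I_n, (q < j)%N ->
      Cst < Re (cis a * (Lam L0 L1 (eps w) x ord0 q - Lam L0 L1 (eps w) x ord0 j)).

Definition sector (r a b : R) : set C :=
  [set x | exists m phi : R, [/\ 0 < m < r, a < phi < b & x = m%:C * cis phi]].
Definition OmD0 K : set C := sector (rdisc K) (- (pi + del K)) (del K).
Definition OmU0 K : set C := sector (rdisc K) (- del K) (pi + del K).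

Definition no_ray n (L0 L1 : C -> 'rV[C]_n) K : Prop :=
  forall q j : 'I_n, q != j -> forall x : C,
    (closure (OmD0 K) x /\ 0 < Im x) \/ (closure (OmU0 K) x /\ Im x < 0) ->
    Re ((Lam L0 L1 0 0 ord0 q - Lam L0 L1 0 0 ord0 j) / x) != 0.

Definition xt (w t : C) : C :=
  - sqrt_eps w * ccosh (sqrt_eps w * t) / csinh (sqrt_eps w * t).

(* |x(t)| >= r without a quotient: the poles of x(t), where x(t) is infinite
   (but [xt w t] is 0 by convention), belong to this set. *)
Definition outside K (w : C) : set C :=
  [set t | rdisc K * cmod (csinh (sqrt_eps w * t))
           <= cmod (sqrt_eps w * ccosh (sqrt_eps w * t))].

Definition Nhat K (w : C) : set C := connected_component (outside K w) 0.

Definition period (w : C) : C := - (0 +i* pi) / sqrt_eps w.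

Definition thhat K (w : C) : R := 2 * gam K / pi * (pi - arg_sqrt_eps w).

Definition sigma_hat K (w : C) (u : R) : R :=
  let a := c0 K / Num.sqrt (cmod (eps w)) in
  if `|u| <= a then 0 else (u - Num.sg u * a) * tan (thhat K w).

(* The line p + R e^(i th), with |th| < pi/2. *)
Definition above (p : C) (th : R) : set C :=
  [set t | 0 < Im ((t - p) * cis (- th))].
Definition below (p : C) (th : R) : set C :=
  [set t | Im ((t - p) * cis (- th)) < 0].

Definition GamD K (w : C) : set C :=
  [set t | [/\ ~ Nhat K w t, Im t < hgt K + sigma_hat K w (Re t) &
      above (- ((2^-1 + kap K)%:C * period w)) (thhat K w) t]].

Definition GamU K (w : C) : set C :=
  [set t | [/\ ~ Nhat K w t, - hgt K + sigma_hat K w (Re t) < Im t &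
      below ((2^-1 + kap K)%:C * period w) (thhat K w) t]].

Definition OmD K (w : C) : set C := xt w @` GamD K w.
Definition OmU K (w : C) : set C := xt w @` GamU K w.

(* N_eps separates the strip GamD `&` GamU around the imaginary axis, hence the
   right and left components are the parts in Re t > 0 and Re t < 0. As
   x(t) tends to sqrt(eps) on the right, the right one gives Omega_L. *)
Definition OmL K (w : C) : set C :=
  xt w @` [set t | [/\ GamD K w t, GamU K w t & 0 < Re t]].
Definition OmR K (w : C) : set C :=
  xt w @` [set t | [/\ GamD K w t, GamU K w t & Re t < 0]].
Definition OmC K (w : C) : set C :=
  xt w @` [set t | GamD K w t /\ GamU K w (t + period w)].

Definition analytic_on (Om : C -> set C) K m n (f : C -> C -> 'M[C]_(m, n)) :=
  forall w x, Sdom K w -> Om w x -> forall i j,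
    differentiable (fun q : C * C => f q.1 q.2 i j) (w, x).

(* The branch e^(t Lam0) (x^2 - eps)^(Lam1/2), x = x(t), of the solution of the
   model on Omega_D; [l] is the branch of log (x^2 - eps) on Omega_D, analytic
   in (w, x), which tends to 2 log x, -(pi + del) < arg x < del, as eps -> 0
   (at a fixed time t = -1/x of the limit of GamD). *)
Definition is_FD n (L0 L1 : C -> 'rV[C]_n) K (FD : C -> C -> 'M[C]_n) : Prop :=
  exists l : C -> C -> C,
    [/\ forall w x, Sdom K w -> OmD K w x -> cexp (l w x) = x ^+ 2 - eps w,
        forall w x, Sdom K w -> OmD K w x ->
          differentiable (fun q : C * C => l q.1 q.2) (w, x),
        forall m phi : R, 0 < m < rdisc K -> - (pi + del K) < phi < del K ->
          let t := - (m%:C * cis phi)^-1 in Im t < hgt K ->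
          l w (xt w t) @[w --> Sdom_to0 K] --> 2 * (ln m +i* phi) &
        forall w t, Sdom K w -> GamD K w t ->
          FD w (xt w t) = diag_mx (\row_j
            cexp (t * L0 (eps w) ord0 j
                  + l w (xt w t) * (L1 (eps w) ord0 j / 2)))].

(* Analytic continuation of F_D to Omega_U through Omega_R. *)
Definition is_FU n K (FD FU : C -> C -> 'M[C]_n) : Prop :=
  forall w, Sdom K w ->
    (forall x, OmU K w x -> mx_derivable (FU w) x) /\
    (forall x, OmR K w x -> FU w x = FD w x).

Definition endpoint_limit n K (HD HU : C -> C -> 'M[C]_n) (xl : C -> C) : Prop :=
  exists d : C -> 'rV[C]_n,
    [/\ forall w, Sdom K w ->
          (HD w x @[x --> within (OmD K w) (nbhs (xl w))] --> diag_mx (d w)) /\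
          (HU w x @[x --> within (OmU K w) (nbhs (xl w))] --> diag_mx (d w)),
        forall w, Sdom K w -> diag_mx (d w) \in unitmx,
        forall w, Sdom K w -> mx_derivable d w &
        exists2 d0 : 'rV[C]_n, diag_mx d0 \in unitmx & d w @[w --> Sdom_to0 K] --> d0].

(* The normalized pairs (H_D, H_U). [`|A|] is the max norm of a matrix. *)
Definition is_H n (B : C -> C -> 'M[C]_n) K (FD FU HD HU : C -> C -> 'M[C]_n) :
    Prop :=
  [/\ analytic_on (OmD K) K HD /\ analytic_on (OmU K) K HU,
      forall w, Sdom K w ->
        fundamental B (eps w) (OmD K w) (fun x => HD w x *m FD w x) /\
        fundamental B (eps w) (OmU K w) (fun x => HU w x *m FU w x),
      endpoint_limit K HD HU xL /\ endpoint_limit K HD HU xR,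
      exists2 c : R, 0 <= c & forall w, Sdom_cap K w ->
        `|HD w 0 - HD (next_sheet w) 0| <= c%:C * `|eps w| /\
        `|HU w 0 - HU (next_sheet w) 0| <= c%:C * `|eps w| &
      exists M : R, forall w u, Sdom_cap K w -> u = w \/ u = next_sheet w ->
        [/\ `|HD u 0| <= M%:C, `|invmx (HD u 0)| <= M%:C,
            `|HU u 0| <= M%:C & `|invmx (HU u 0)| <= M%:C]].

Definition upper_unipotent n (A : 'M[C]_n) : Prop :=
  forall i j : 'I_n, (j <= i)%N -> A i j = (i == j)%:R.
Definition lower_unipotent n (A : 'M[C]_n) : Prop :=
  forall i j : 'I_n, (i <= j)%N -> A i j = (i == j)%:R.

Definition unfolded_stokes n K (FD HD HU : C -> C -> 'M[C]_n)
    (CR CL : C -> 'M[C]_n) : Prop :=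
  forall w, Sdom K w ->
    [/\ upper_unipotent (CR w) /\ lower_unipotent (CL w),
        forall x, OmR K w x ->
          invmx (HD w x) *m HU w x = FD w x *m CR w *m invmx (FD w x),
        forall x, OmL K w x ->
          invmx (HD w x) *m HU w x = FD w x *m CL w *m invmx (FD w x) &
        forall x, OmC K w x -> invmx (HD w x) *m HU w x = 1%:M].

Definition blockdiag n m (ns : 'I_m -> nat) (e : (\sum_k ns k)%N = n)
    (A : forall k, 'M[C]_(ns k)) : 'M[C]_n :=
  castmx (e, e) (\mxdiag_k A k).

End Unfolding.

Arguments consts : clear implicits.

(* Main.v *)
(* Let E be one of the conjugated block projections; it is diagonal and commutes
   with both Stokes matrices. Hence H_D E H_D^-1 and H_U E H_U^-1 agree on the
   intersections of the sectorial domains and define a matrix Pi(x) on the disc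
   punctured at the two singular points, with limit E at both of them. So Pi is
   holomorphic on the whole disc, is idempotent, and satisfies
   (x^2 - eps) Pi' = [B, Pi]; in particular Pi_jj' = [R, Pi]_jj.

   Holomorphic solutions of this equation near the origin are bounded, uniformly
   in eps, by their diagonal at x = sqrt(eps). Applied to Pi, whose value there
   is E, this gives a uniform bound; applied to the difference of the matrices
   Pi built on two sheets over the same eps, it gives 0. Therefore Pi is a bounded
   function of eps <> 0 and extends analytically across eps = 0, with
   value E at (0, 0).

   For the resulting projectors Pi_k, the matrix Q = \sum_k Pi_k E_k is invertible
   near the origin and satisfies Pi_k Q = Q E_k, so the substitution y = Q v leads
   to a system that commutes with every E_k, that is, a block diagonal one. *)

Require Import Defs.
From HB Require Import structures.
From mathcomp Require Import all_boot all_order all_algebra.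
From mathcomp Require Import all_fingroup.
From mathcomp Require Import all_classical all_reals all_analysis.
From mathcomp Require Import complex.
From mathcomp Require Import ring lra.

Set Implicit Arguments.
Unset Strict Implicit.
Unset Printing Implicit Defensive.

Import Order.TTheory GRing.Theory Num.Theory.
Import numFieldNormedType.Exports.
Local Open Scope classical_set_scope.
Local Open Scope ring_scope.
Local Open Scope complex_scope.

(** * Averages over the unit interval *)

Section Cmod.
Context {R : realType}.
Local Notation C := R[i].
Local Notation Re := (@complex.Re R).
Local Notation Im := (@complex.Im R).
Implicit Types z u v : C.

(** The obstacle is uniformity while the two singular points merge at the origin: there x^2 - eps
    degenerates and the equation no longer controls Pi'. What survives is the gap between the
    eigenvalues. It expresses an off-diagonal entry as x^2 - eps times a derivative, up to [R, Pi],
    and Cauchy's estimate on a disc of radius comparable to |x| loses only one of the two powers of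
    |x|. Iteration gives bounds of any order in |x|, hence smallness relative to the maximum on a
    tiny circle, which is carried outwards and absorbed.

    A second difficulty is that H_D and H_U only have limits at the points x^2 = eps, so nothing is
    known there about differentiability in eps. The singularity eps = 0 is therefore removed for x
    on a fixed circle, which these points avoid for small eps, and Cauchy's integral in x recovers
    the disc.

    Cauchy's theory itself rests on a finitely additive mean: linearity, a bound and the halving of
    intervals are all that Goursat's subdivision uses. *)

Lemma cmodE z : cmod z = Num.sqrt (Re z ^+ 2 + Im z ^+ 2).
Proof. by rewrite /cmod normc_def. Qed.

Lemma norm_cmod z : `|z| = (cmod z)%:C.
Proof. by rewrite cmodE normc_def. Qed.

Lemma cmod_ge0 z : 0 <= cmod z.
Proof. by rewrite cmodE sqrtr_ge0. Qed.

Lemma cmod0 : cmod (0 : C) = 0.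
Proof. by rewrite /cmod normr0. Qed.

Lemma cmod1 : cmod (1 : C) = 1.
Proof. by rewrite /cmod normr1. Qed.

Lemma cmodM u v : cmod (u * v) = cmod u * cmod v.
Proof. by apply: complexI; rewrite rmorphM /= -!norm_cmod normrM. Qed.

Lemma cmodD u v : cmod (u + v) <= cmod u + cmod v.
Proof. by rewrite -lecR rmorphD /= -!norm_cmod ler_normD. Qed.

Lemma cmodN u : cmod (- u) = cmod u.
Proof. by rewrite /cmod normrN. Qed.

Lemma cmodBC u v : cmod (u - v) = cmod (v - u).
Proof. by rewrite -cmodN opprB. Qed.

Lemma cmodB u v : cmod (u - v) <= cmod u + cmod v.
Proof. by rewrite -[cmod v]cmodN cmodD. Qed.

Lemma lerB_cmod u v : cmod u - cmod v <= cmod (u - v).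
Proof. by rewrite lerBlDr (le_trans _ (cmodD _ _)) // subrK. Qed.

Lemma cmod_near (x y : C) (r : R) : cmod (y - x) < r - cmod x -> cmod y < r.
Proof. by move=> h; have := cmodD (y - x) x; rewrite subrK; lra. Qed.


Lemma cmodV u : cmod u^-1 = (cmod u)^-1.
Proof. by apply: complexI; rewrite fmorphV /= -!norm_cmod normfV. Qed.

Lemma cmodX u n : cmod (u ^+ n) = cmod u ^+ n.
Proof. by elim: n => [|n IH]; rewrite ?expr0 ?cmod1 // !exprS cmodM IH. Qed.

Lemma cmod_eq0 u : (cmod u == 0) = (u == 0).
Proof. by rewrite -[in RHS]normr_eq0 norm_cmod -[0 in RHS]/(0%:C) (inj_eq (@complexI R)). Qed.

Lemma cmod_gt0 u : (0 < cmod u) = (u != 0).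
Proof. by rewrite lt0r cmod_eq0 cmod_ge0 andbT. Qed.

Lemma cmodR (a : R) : cmod a%:C = `|a|.
Proof. by rewrite cmodE /= expr0n addr0 sqrtr_sqr. Qed.

Lemma cmod_Re z : `|Re z| <= cmod z.
Proof. by rewrite cmodE -sqrtr_sqr ler_wsqrtr // lerDl sqr_ge0. Qed.

Lemma cmod_Im z : `|Im z| <= cmod z.
Proof. by rewrite cmodE -sqrtr_sqr ler_wsqrtr // lerDr sqr_ge0. Qed.

Lemma cmod_i : cmod ('i : C) = 1.
Proof. by rewrite cmodE /= expr0n add0r expr1n sqrtr1. Qed.

Lemma cmod_ReIm z : cmod z <= `|Re z| + `|Im z|.
Proof.
rewrite {1}[z]complexE (le_trans (cmodD _ _)) // cmodM !cmodR.
by rewrite -/(cmod ('i : C)) cmod_i mul1r.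
Qed.

Lemma Re_add u v : Re (u + v) = Re u + Re v. Proof. by case: u v => [? ?] []. Qed.
Lemma Im_add u v : Im (u + v) = Im u + Im v. Proof. by case: u v => [? ?] []. Qed.
Lemma Re_opp u : Re (- u) = - Re u. Proof. by case: u. Qed.
Lemma Im_opp u : Im (- u) = - Im u. Proof. by case: u. Qed.
Lemma Re_mul u v : Re (u * v) = Re u * Re v - Im u * Im v. Proof. by case: u v => [? ?] []. Qed.
Lemma Im_mul u v : Im (u * v) = Re u * Im v + Im u * Re v. Proof. by case: u v => [? ?] []. Qed.
Lemma Re_rM (a : R) v : Re (a%:C * v) = a * Re v.
Proof. by rewrite Re_mul /= mul0r subr0. Qed.
Lemma Im_rM (a : R) v : Im (a%:C * v) = a * Im v.
Proof. by rewrite Im_mul /= mul0r addr0. Qed.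
Definition ReImE := (Re_add, Im_add, Re_opp, Im_opp, Re_rM, Im_rM, Re_mul, Im_mul).

Lemma complex_ext u v : Re u = Re v -> Im u = Im v -> u = v.
Proof. by case: u v => [? ?] [? ?] /= -> ->. Qed.
End Cmod.

(** * Limits along an ultrafilter *)

Section LimU.
Context {R : realType}.

(** The inclusion makes the ultrafilter free, so that limits along it extend ordinary limits of
    sequences. *)
Lemma ultra_nat : exists2 U : set_system nat, UltraFilter U & \oo `<=` U.
Proof. by have [U [? ?]] := @ultraFilterLemma nat \oo _; exists U. Qed.

Lemma ultra_bounded (U : set_system nat) (u : nat -> R) M :
  UltraFilter U -> (forall n, `|u n| <= M) -> cvg (u @ U).
Proof.
move=> UU uM; have := @segment_compact R (- M) M; rewrite compact_ultra => cM.
have UP := @ultra_proper _ _ UU.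
have UM : (u @ U) `[- M, M]%classic.
  by apply: (@filterE _ U) => n /=; rewrite in_itv /= -ler_norml.
(* The image filter is maximal: if a finer proper filter contained A while the preimage of A were
   not in [U], it would also contain the complement of A. *)
have Uu : UltraFilter (u @ U).
  split; first exact: fmap_proper_filter.
  move=> G PG uG; apply/seteqP; split=> A; last exact: uG.
  move=> GA; have [//|UnA] := in_ultra_setVsetC (u @^-1` A) UU.
  have FG : Filter G by exact: filter_filter.
  have := filterI GA (uG (~` A) UnA); rewrite setICr.
  by move/(_ FG) => G0; case: PG => nG _; case: (nG G0).
have [l [_ ul]] := cM _ Uu UM.
by apply/cvg_ex; exists l.
Qed.
End LimU.

Section Mean.
Context {R : realType}.
Local Notation C := R[i].
Local Notation Re := (@complex.Re R).
Local Notation Im := (@complex.Im R).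

Definition in01 (t : R) := 0 <= t <= 1.

(** The left Riemann sum over the 2^N dyadic intervals of [0, 1]; the recursion on the two halves
    makes the halving identity exact. *)
Fixpoint dyadic_sum (N : nat) (g : R -> R) : R :=
  if N is N'.+1 then
    (dyadic_sum N' (fun t => g (t / 2)) + dyadic_sum N' (fun t => g ((1 + t) / 2))) / 2
  else g 0.

Lemma in01_half t : in01 t -> in01 (t / 2) /\ in01 ((1 + t) / 2).
Proof. by rewrite /in01 => /andP[? ?]; split; apply/andP; split; lra. Qed.

Lemma dyadic_sumD N f g : dyadic_sum N (fun t => f t + g t) = dyadic_sum N f + dyadic_sum N g.
Proof. by elim: N f g => [|N IH] f g //=; rewrite !IH; field. Qed.

Lemma dyadic_sumZ N c g : dyadic_sum N (fun t => c * g t) = c * dyadic_sum N g.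
Proof. by elim: N g => [|N IH] g //=; rewrite !IH; field. Qed.

Lemma dyadic_sum_bound N g (M : R) : (forall t, in01 t -> `|g t| <= M) -> `|dyadic_sum N g| <= M.
Proof.
elim: N g => [|N IH] g gM /=; first by apply: gM; rewrite /in01 lexx ler01.
have := IH _ (fun t h => gM _ (in01_half h).1); have := IH _ (fun t h => gM _ (in01_half h).2).
by rewrite !ler_norml => /andP[? ?] /andP[? ?]; apply/andP; split; lra.
Qed.

Lemma dyadic_sum_cst N c : dyadic_sum N (fun=> c) = c.
Proof. by elim: N => //= N ->; field. Qed.

(** Halving the interval shifts the level of the dyadic sums by one. A limit along an ultrafilter is
    not invariant under a shift, but that of the Cesaro means of a bounded sequence is. *)
Definition cesaro (u : nat -> R) (N : nat) : R := (\sum_(i < N.+1) u i) / N.+1%:R.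

Lemma cesaroD u v N : cesaro (fun i => u i + v i) N = cesaro u N + cesaro v N.
Proof. by rewrite /cesaro big_split mulrDl. Qed.

Lemma cesaroZ c u N : cesaro (fun i => c * u i) N = c * cesaro u N.
Proof. by rewrite /cesaro -mulr_sumr mulrA. Qed.

Lemma cesaro_bound u M N : (forall i, `|u i| <= M) -> `|cesaro u N| <= M.
Proof.
move=> uM; rewrite /cesaro normrM normfV [`|N.+1%:R|]ger0_norm // ler_pdivrMr ?ltr0Sn //.
apply: (le_trans (ler_norm_sum _ _ _)).
by rewrite (le_trans (ler_sum _ (fun (i : 'I_N.+1) _ => uM i))) // sumr_const card_ord mulr_natr.
Qed.

Lemma cesaro_cst c N : cesaro (fun=> c) N = c.
Proof. by rewrite /cesaro sumr_const card_ord -[c *+ _]mulr_natr mulfK ?pnatr_eq0. Qed.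

Lemma cesaro_shift u M N : (forall i, `|u i| <= M) ->
  `|cesaro (fun i => u i.+1) N - cesaro u N| <= 2 * M / N.+1%:R.
Proof.
move=> uM; rewrite /cesaro -mulrBl normrM normfV [`|N.+1%:R|]ger0_norm //.
rewrite ler_pM2r ?invr_gt0 ?ltr0Sn //.
rewrite -(big_mkord xpredT u) -(big_mkord xpredT (fun i => u i.+1)).
rewrite -sumrB telescope_sumr // (le_trans (ler_normB _ _)) //.
by have := uM N.+1; have := uM 0%N; lra.
Qed.

Definition bounded01 (g : R -> C) := exists M : R, forall t, in01 t -> cmod (g t) <= M.

(* A finitely additive substitute for the integral over [0, 1]: an ultrafilter
   limit of the averaged dyadic Riemann sums. Only boundedness is required of
   the integrands. *)
Lemma real_mean_exists : exists mu : (R -> R) -> R,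
  [/\ forall f g, (exists M : R, forall t, in01 t -> `|f t| <= M) ->
                (exists M : R, forall t, in01 t -> `|g t| <= M) ->
        mu (fun t => f t + g t) = mu f + mu g,
      forall c f, (exists M : R, forall t, in01 t -> `|f t| <= M) ->
        mu (fun t => c * f t) = c * mu f,
      forall f M, (forall t, in01 t -> `|f t| <= M) -> `|mu f| <= M,
      forall c, mu (fun=> c) = c &
      forall f, (exists M : R, forall t, in01 t -> `|f t| <= M) ->
        mu f = (mu (fun t => f (t / 2)) + mu (fun t => f ((1 + t) / 2))) / 2].
Proof.
have [U UU ooU] := ultra_nat; have UP := @ultra_proper _ _ UU.
pose T f N := cesaro (fun i => dyadic_sum i f) N.
pose mu f := lim (T f @ U).
have Tb f (M : R) N : (forall t, in01 t -> `|f t| <= M) -> `|T f N| <= M.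
  by move=> fM; apply: cesaro_bound => i; exact: dyadic_sum_bound.
have cT f : (exists M : R, forall t, in01 t -> `|f t| <= M) -> T f N @[N --> U] --> mu f.
  by move=> [M fM]; apply: (@ultra_bounded _ _ _ M UU) => N; exact: Tb.
have muE f l : T f N @[N --> U] --> l -> mu f = l by move/cvg_lim; apply.
have TD f g N : T (fun t => f t + g t) N = T f N + T g N.
  by rewrite /T -cesaroD; congr cesaro; apply/funext => i; rewrite dyadic_sumD.
have TZ c f N : T (fun t => c * f t) N = c * T f N.
  by rewrite /T -cesaroZ; congr cesaro; apply/funext => i; rewrite dyadic_sumZ.
exists mu; split.
- move=> f g /cT cf /cT cg; apply: muE.
  by rewrite (_ : T _ = fun N => T f N + T g N); [exact: cvgD | apply/funext => N].
- move=> c f /cT cf; apply: muE.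
  by rewrite (_ : T _ = fun N => c * T f N); [apply: cvgM => //; exact: cvg_cst | apply/funext => N].
- move=> f M fM; have cf := cT f (ex_intro _ M fM).
  rewrite ler_norml; apply/andP; split.
    by apply: (limr_ge cf); apply: filterE => N; have := Tb f (M : R) N fM; rewrite ler_norml => /andP[].
  by apply: (limr_le cf); apply: filterE => N; have := Tb f (M : R) N fM; rewrite ler_norml => /andP[].
- move=> c; apply: muE; rewrite (_ : T _ = fun=> c); first exact: cvg_cst.
  apply/funext => N; rewrite /T (_ : (fun i => _) = fun=> c) ?cesaro_cst //.
  by apply/funext => i; rewrite dyadic_sum_cst.
- move=> f [M fM].
  have c0 : T (fun t => f (t / 2)) N @[N --> U] --> mu (fun t => f (t / 2)).
    by apply: cT; exists M => t /in01_half[h _]; exact: fM.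
  have c1 : T (fun t => f ((1 + t) / 2)) N @[N --> U] --> mu (fun t => f ((1 + t) / 2)).
    by apply: cT; exists M => t /in01_half[_ h]; exact: fM.
  (* The second summand, due to the shift of the level, is O(1 / N). *)
  have c2 : (T f N + (cesaro (fun i => dyadic_sum i.+1 f) N - T f N)) @[N --> U] -->
      mu f + 0.
    apply: cvgD; first by apply: cT; exists M.
    apply: (@cvg_trans _ (_ @ \oo)); first by apply: cvg_app.
    apply/cvgr0Pnorm_le => e e0.
    near=> N; apply: (le_trans (cesaro_shift (M := M) _ _)).
      by move=> i; exact: dyadic_sum_bound.
    have : 2 * M / e <= N%:R by near: N; exact: nbhs_infty_ger.
    rewrite ler_pdivrMr // => h; rewrite ler_pdivrMr ?ltr0Sn // [leRHS]mulrC.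
    by rewrite (le_trans h) // ler_pM2r // ler_nat.
  apply/esym; rewrite -[RHS]addr0; apply: (cvg_unique _ _ c2) => //.
  rewrite (_ : (fun N => _) = fun N => (T (fun t => f (t / 2)) N + T (fun t => f ((1 + t) / 2)) N) * 2^-1).
    by apply: cvgM; [exact: cvgD | exact: cvg_cst].
  apply/funext => N; rewrite subrKC /T -cesaroD mulrC -cesaroZ; congr cesaro.
  by apply/funext => i; rewrite mulrC.
Unshelve. all: by end_near. Qed.

Definition real_mean : (R -> R) -> R := projT1 (cid real_mean_exists).

Definition mean (g : R -> C) : C :=
  real_mean (fun t => Re (g t)) +i* real_mean (fun t => Im (g t)).

Lemma bRe g M : (forall t, in01 t -> cmod (g t) <= M) -> forall t, in01 t -> `|Re (g t)| <= M.
Proof. by move=> gM t /gM; apply: le_trans; exact: cmod_Re. Qed.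

Lemma bIm g M : (forall t, in01 t -> cmod (g t) <= M) -> forall t, in01 t -> `|Im (g t)| <= M.
Proof. by move=> gM t /gM; apply: le_trans; exact: cmod_Im. Qed.

Lemma bounded01_ReIm g : bounded01 g ->
  (exists M : R, forall t, in01 t -> `|Re (g t)| <= M) /\
  (exists M : R, forall t, in01 t -> `|Im (g t)| <= M).
Proof. by move=> [M gM]; split; exists M; [exact: bRe | exact: bIm]. Qed.

Lemma bounded01M f g : bounded01 f -> bounded01 g -> bounded01 (fun t => f t * g t).
Proof.
move=> [M fM] [N gN]; exists (M * N) => t h.
by rewrite cmodM ler_pM ?cmod_ge0 ?fM ?gN.
Qed.

Lemma bounded01_cst c : bounded01 (fun=> c).
Proof. by exists (cmod c). Qed.

Lemma meanD f g : bounded01 f -> bounded01 g ->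
  mean (fun t => f t + g t) = mean f + mean g.
Proof.
move=> /bounded01_ReIm[fR fI] /bounded01_ReIm[gR gI].
rewrite /mean /real_mean; case: cid => mu /= [muD _ _ _ _].
apply: complex_ext; rewrite !ReImE /= -muD //;
by congr mu; apply/funext => t; rewrite !ReImE.
Qed.

Lemma meanZ c f : bounded01 f -> mean (fun t => c * f t) = c * mean f.
Proof.
move=> /bounded01_ReIm[[M fR] [N fI]].
rewrite /mean /real_mean; case: cid => mu /= [muD muZ _ _ _].
have bZ (k L : R) (g : R -> R) : (forall t, in01 t -> `|g t| <= L) ->
    exists M : R, forall t, in01 t -> `|k * g t| <= M.
  by move=> gL; exists (`|k| * L) => t h; rewrite normrM ler_wpM2l ?gL.
apply: complex_ext; rewrite !ReImE /=.
  transitivity (mu (fun t => Re c * Re (f t) + - Im c * Im (f t))).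
    by congr mu; apply/funext => t; rewrite ReImE mulNr.
  by rewrite muD ?muZ ?mulNr //; [exists N|exists M|apply: (bZ _ M)|apply: (bZ _ N)].
transitivity (mu (fun t => Re c * Im (f t) + Im c * Re (f t))).
  by congr mu; apply/funext => t; rewrite ReImE.
by rewrite muD ?muZ //; [exists M|exists N|apply: (bZ _ N)|apply: (bZ _ M)].
Qed.

Lemma mean_cst c : mean (fun=> c) = c.
Proof.
rewrite /mean /real_mean; case: cid => mu /= [_ _ _ muc _].
by rewrite !muc; case: c.
Qed.

(** The factor 2 is the price of bounding real and imaginary parts separately; it recurs in the
    constants of all Cauchy estimates below. *)
Lemma mean_bound f M : (forall t, in01 t -> cmod (f t) <= M) -> cmod (mean f) <= 2 * M.
Proof.
move=> fM; rewrite (le_trans (cmod_ReIm _)) //= mulr_natl mulr2n lerD //.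
  by rewrite /real_mean; case: cid => mu /= [_ _ mub _ _]; apply: mub; exact: bRe.
by rewrite /real_mean; case: cid => mu /= [_ _ mub _ _]; apply: mub; exact: bIm.
Qed.

Lemma mean_half f : bounded01 f ->
  mean f = (mean (fun t => f (t / 2)) + mean (fun t => f ((1 + t) / 2))) / 2.
Proof.
move=> /bounded01_ReIm[fR fI]; rewrite /mean /real_mean; case: cid => mu /= [_ _ _ _ muh].
have -> : (2 : C)^-1 = (2^-1 : R)%:C by rewrite fmorphV rmorph_nat.
by rewrite mulrC; apply: complex_ext; rewrite !ReImE /= (muh _ fR, muh _ fI) mulrC.
Qed.

Lemma meanN f : bounded01 f -> mean (fun t => - f t) = - mean f.
Proof.
by move=> bf; rewrite -mulN1r -meanZ //; congr mean; apply/funext => t; rewrite mulN1r.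
Qed.

Lemma meanB f g : bounded01 f -> bounded01 g ->
  mean (fun t => f t - g t) = mean f - mean g.
Proof.
move=> bf bg; by rewrite meanD ?meanN //; case: bg => M gM; exists M => t h; rewrite cmodN gM.
Qed.

(** The halving identity reads m = (m / 2 + (1 / 2 + m / 2)) / 2, which determines m. *)
Lemma mean_id : mean (fun t => t%:C) = (2^-1 : R)%:C.
Proof.
have bt : bounded01 (fun t => t%:C).
  by exists 1 => t /andP[t0 t1]; rewrite cmodR ger0_norm.
have := mean_half bt.
rewrite (_ : (fun t => (t / 2)%:C) = fun t => (2^-1 : R)%:C * t%:C); last first.
  by apply/funext => t; rewrite mulrC rmorphM.
rewrite (_ : (fun t => ((1 + t) / 2)%:C) = fun t => (2^-1 : R)%:C + (2^-1 : R)%:C * t%:C); last first.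
  by apply/funext => t; rewrite -rmorphM -rmorphD /=; congr (_%:C); field.
have b2 : bounded01 (fun t => (2^-1 : R)%:C * t%:C) by apply: bounded01M => //; exact: bounded01_cst.
rewrite meanD ?meanZ ?mean_cst //; last exact: bounded01_cst.
have -> : (2^-1 : R)%:C = (2 : C)^-1 by rewrite fmorphV rmorph_nat.
move: (mean _) => m h.
apply: (@mulfI _ (2^-1 : C)); first by rewrite invr_eq0 pnatr_eq0.
transitivity (m - 2^-1 * m); first by field.
by rewrite {1}h; field.
Qed.
End Mean.

(** * Complex derivatives *)

Section Deriv.
Context {R : realType}.
Local Notation C := R[i].
Local Notation Re := (@complex.Re R).
Local Notation Im := (@complex.Im R).
Implicit Types (x y d : C).

Lemma near0C (P : C -> Prop) x : (\forall y \near x, P y) <->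
  exists2 e : R, 0 < e & forall y, cmod (y - x) < e -> P y.
Proof.
split.
  move/nbhs_normP => [e /= e0 H]; exists (Re e).
    by move: e0; rewrite ltcE => /andP[].
  move=> y yx; apply: H; rewrite /= distrC norm_cmod; move: e0 yx; rewrite !ltcE /=.
  by move=> /andP[/eqP -> _] ->; rewrite eqxx.
move=> [e e0 H]; apply/nbhs_normP; exists e%:C; first by rewrite /= ltcR.
by move=> y /=; rewrite distrC norm_cmod ltcR => /H.
Qed.

(** Real radii keep the estimates in a totally ordered field; [near0C] identifies these sets with
    the usual neighbourhoods. *)
Definition cnbhs x : set_system C :=
  [set P | exists2 e : R, 0 < e & forall y, cmod (y - x) < e -> P y].

Global Instance cnbhs_filter x : Filter (cnbhs x).
Proof.
split; first by exists 1.
- move=> P Q [e e0 eP] [r r0 rQ]; exists (Num.min e r); first by rewrite lt_min e0.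
  by move=> y; rewrite lt_min => /andP[ye yr]; split; [exact: eP | exact: rQ].
- by move=> P Q PQ [e e0 eP]; exists e => // y /eP /PQ.
Qed.

Lemma cnbhs_self x (P : C -> Prop) : cnbhs x P -> P x.
Proof. by move=> [e e0]; apply; rewrite subrr cmod0. Qed.

Lemma cnbhs_ball x (e : R) : 0 < e -> cnbhs x [set y | cmod (y - x) < e].
Proof. by move=> e0; exists e. Qed.

Definition ccvg T (F : set_system T) (f : T -> C) (l : C) :=
  forall e : R, 0 < e -> F [set t | cmod (f t - l) < e].

Section Ccvg.
Context {T : Type} {F : set_system T} {FF : Filter F}.
Implicit Types (f g : T -> C) (a b : C).

Lemma ccvg_cst a : ccvg F (fun=> a) a.
Proof. by move=> e e0; apply: filterE => t /=; rewrite subrr cmod0. Qed.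

Lemma ccvgD f g a b : ccvg F f a -> ccvg F g b -> ccvg F (fun t => f t + g t) (a + b).
Proof.
move=> fa gb e e0; have e2 : 0 < e / 2 by rewrite divr_gt0.
apply: filterS2 (fa _ e2) (gb _ e2) => t /= h1 h2.
have -> : f t + g t - (a + b) = (f t - a) + (g t - b) by ring.
by rewrite (le_lt_trans (cmodD _ _)) //; lra.
Qed.

Lemma ccvg_bounded f a : ccvg F f a -> F [set t | cmod (f t) < cmod a + 1].
Proof.
move=> /(_ 1 ltr01); apply: filterS => t /= h.
by have := cmodD (f t - a) a; rewrite subrK; lra.
Qed.

Lemma ccvg0M f g (M : R) : ccvg F f 0 -> F [set t | cmod (g t) < M] ->
  ccvg F (fun t => f t * g t) 0.
Proof.
move=> f0 gM e e0; have M0 : 0 < `|M| + 1 by rewrite ltr_wpDl.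
apply: filterS2 (f0 (e / (`|M| + 1)) _) gM => [t /=|]; last by rewrite divr_gt0.
rewrite !subr0 cmodM ltr_pdivlMr // => h1 h2; rewrite (le_lt_trans _ h1) //.
by rewrite ler_wpM2l ?cmod_ge0 //; have := ler_norm M; lra.
Qed.

Lemma ccvg_sub0 f a : ccvg F f a <-> ccvg F (fun t => f t - a) 0.
Proof. by split=> h e /h; apply: filterS => t /=; rewrite subr0. Qed.

Lemma ccvgM f g a b : ccvg F f a -> ccvg F g b -> ccvg F (fun t => f t * g t) (a * b).
Proof.
move=> fa gb; have gM := ccvg_bounded gb.
rewrite (_ : (fun t => _) = fun t => ((f t - a) * g t + (g t - b) * a) + a * b).
  rewrite -[a * b in X in ccvg _ _ X]add0r; apply: ccvgD; last exact: ccvg_cst.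
  rewrite -[0]addr0; apply: ccvgD.
    by apply: (ccvg0M _ gM); exact: (ccvg_sub0 _ _).1.
  apply: (@ccvg0M _ _ (cmod a + 1)); first exact: (ccvg_sub0 _ _).1.
  by apply: filterE => t /=; lra.
by apply/funext => t; ring.
Qed.

Lemma ccvgN f a : ccvg F f a -> ccvg F (fun t => - f t) (- a).
Proof. by move=> fa e /fa; apply: filterS => t /=; rewrite -opprD cmodN. Qed.

Lemma ccvgB f g a b : ccvg F f a -> ccvg F g b -> ccvg F (fun t => f t - g t) (a - b).
Proof. by move=> fa gb; apply: ccvgD => //; exact: ccvgN. Qed.

Lemma ccvg_neq0 f a : a != 0 -> ccvg F f a -> F [set t | cmod a / 2 < cmod (f t)].
Proof.
move=> a0 fa; have ca : 0 < cmod a by rewrite cmod_gt0.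
apply: filterS (fa (cmod a / 2) _) => [t /= h|]; last by rewrite divr_gt0.
by have := cmodB (f t) (f t - a); rewrite subKr; lra.
Qed.

Lemma ccvgV f a : a != 0 -> ccvg F f a -> ccvg F (fun t => (f t)^-1) a^-1.
Proof.
move=> a0 fa; have fn := ccvg_neq0 a0 fa; have ca : 0 < cmod a by rewrite cmod_gt0.
apply/ccvg_sub0.
have : ccvg F (fun t => (f t - a) * - (f t * a)^-1) 0.
  apply: (@ccvg0M _ _ ((cmod a / 2 * cmod a)^-1 + 1)); first exact: (ccvg_sub0 _ _).1.
  apply: filterS fn => t /= h; rewrite cmodN cmodV cmodM.
  have h2 : (cmod (f t) * cmod a)^-1 <= (cmod a / 2 * cmod a)^-1.
    rewrite lef_pV2 ?posrE ?mulr_gt0 // ?divr_gt0 //; last by lra.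
    by rewrite ler_pM2r //; exact: ltW.
  by lra.
move=> h e /h; apply: filterS2 fn => t /= ft.
have ft0 : f t != 0 by rewrite -cmod_gt0; lra.
by have -> : (f t)^-1 - a^-1 - 0 = (f t - a) * - (f t * a)^-1 - 0 by field; rewrite a0 ft0.
Qed.

Lemma ccvg_eq f g a : F [set t | f t = g t] -> ccvg F f a -> ccvg F g a.
Proof. by move=> fg fa e /fa; apply: filterS2 fg => t /= ->. Qed.

End Ccvg.
Implicit Types (f g : C -> C).

Lemma ccvg_id x : ccvg (cnbhs x) id x.
Proof. by move=> e e0; exists e. Qed.

Definition ccont f x := ccvg (cnbhs x) f (f x).

Lemma ccvg_comp T (F : set_system T) {FF : Filter F} (u : T -> C) f x :
  ccvg F u x -> ccont f x -> ccvg F (fun t => f (u t)) (f x).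
Proof. by move=> ux cf e /cf [r r0 rP]; apply: filterS (ux r r0) => t /rP. Qed.

(** Caratheodory's form of the derivative: a slope function continuous at [x] replaces the
    difference quotient, and the product and chain rules become identities between slopes. *)
Definition cder f x d := exists phi : C -> C,
  [/\ ccont phi x, phi x = d & forall y, f y = f x + phi y * (y - x)].

Lemma cderP f x d : cder f x d <-> forall e : R, 0 < e ->
  cnbhs x [set y | cmod (f y - f x - d * (y - x)) <= e * cmod (y - x)].
Proof.
split.
  move=> [phi [cphi <- fE]] e e0; apply: filterS (cphi e e0) => y /= /ltW h.
  rewrite (_ : f y - f x = phi y * (y - x)); last by rewrite fE addrC addKr.
  by rewrite -mulrBl cmodM ler_wpM2r ?cmod_ge0.
move=> H; exists (fun y => if y == x then d else (f y - f x) / (y - x)); split; last first.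
- move=> y; case: eqP => [->|/eqP yx]; first by rewrite subrr mulr0 addr0.
  by rewrite divfK ?subr_eq0 // subrKC.
- by rewrite eqxx.
move=> e e0; have e2 : 0 < e / 2 by rewrite divr_gt0.
apply: filterS (H _ e2) => y /= h; rewrite eqxx.
case: eqP => [_|/eqP yx]; first by rewrite subrr cmod0.
have yx0 : y - x != 0 by rewrite subr_eq0.
rewrite -[d](mulfK yx0) -mulrBl cmodM cmodV ltr_pdivrMr ?cmod_gt0 //.
by rewrite (le_lt_trans h) // ltr_pM2r ?cmod_gt0 //; lra.
Qed.

(** Cauchy integrals are differentiated in this form, the remainder of the kernel being quadratic
    uniformly on the circle. *)
Lemma cder_sq f x d (M r : R) : 0 < r ->
  (forall y, cmod (y - x) < r -> cmod (f y - f x - d * (y - x)) <= M * cmod (y - x) ^+ 2) ->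
  cder f x d.
Proof.
move=> r0 H; apply/cderP => e e0.
have M0 : 0 < `|M| + 1 by rewrite ltr_wpDl.
exists (Num.min r (e / (`|M| + 1))); first by rewrite lt_min r0 divr_gt0.
move=> y; rewrite lt_min => /andP[yr ye] /=; rewrite (le_trans (H y yr)) // expr2 mulrA.
rewrite ler_wpM2r ?cmod_ge0 //; move: ye; rewrite ltr_pdivlMr // => /ltW; apply: le_trans.
by rewrite mulrC ler_wpM2l ?cmod_ge0 //; have := ler_norm M; lra.
Qed.

Lemma cder_cont f x d : cder f x d -> ccont f x.
Proof.
move=> [phi [cphi _ fE]].
have : ccvg (cnbhs x) (fun y => f x + phi y * (y - x)) (f x + phi x * (x - x)).
  apply: ccvgD; first exact: ccvg_cst.
  by apply: ccvgM => //; apply: ccvgB; [exact: ccvg_id | exact: ccvg_cst].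
by rewrite -fE; apply: ccvg_eq; apply: filterE => y /=; rewrite -fE.
Qed.

Lemma cder_cst c x : cder (fun=> c) x 0.
Proof. by exists (fun=> 0); split=> [||y]; [exact: ccvg_cst| |rewrite mul0r addr0]. Qed.

Lemma cder_id x : cder id x 1.
Proof. by exists (fun=> 1); split=> [||y]; [exact: ccvg_cst| |rewrite mul1r subrKC]. Qed.

Lemma cderD f g x d d' : cder f x d -> cder g x d' -> cder (fun y => f y + g y) x (d + d').
Proof.
move=> [p [cp <- fE]] [q [cq <- gE]]; exists (fun y => p y + q y); split=> [||y].
- exact: ccvgD.
- by [].
- by rewrite fE gE; ring.
Qed.

Lemma cderM f g x d d' : cder f x d -> cder g x d' ->
  cder (fun y => f y * g y) x (d * g x + f x * d').
Proof.
move=> Hf [q [cq <- gE]]; have cf := cder_cont Hf; move: Hf => [p [cp <- fE]].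
exists (fun y => p y * g x + f y * q y); split=> [||y].
- by apply: ccvgD; [apply: ccvgM => //; exact: ccvg_cst | exact: ccvgM].
- by [].
- have h : p y * (y - x) = f y - f x by rewrite [f y]fE; ring.
  have h' : q y * (y - x) = g y - g x by rewrite [g y]gE; ring.
  transitivity (f x * g x + (p y * (y - x)) * g x + f y * (q y * (y - x))); last by ring.
  by rewrite h h'; ring.
Qed.

Lemma cderZ c f x d : cder f x d -> cder (fun y => c * f y) x (c * d).
Proof. by move=> H; have := cderM (cder_cst c x) H; rewrite mul0r add0r. Qed.

Lemma cderN f x d : cder f x d -> cder (fun y => - f y) x (- d).
Proof.
move=> H; rewrite -mulN1r (_ : (fun y => - f y) = fun y => -1 * f y); first exact: cderZ.
by apply/funext => y; rewrite mulN1r.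
Qed.

Lemma cderB f g x d d' : cder f x d -> cder g x d' -> cder (fun y => f y - g y) x (d - d').
Proof. by move=> Hf Hg; apply: cderD => //; exact: cderN. Qed.

Lemma cder_near f g x d : cnbhs x [set y | f y = g y] -> cder f x d -> cder g x d.
Proof.
move=> fg /cderP H; have fgx : f x = g x := cnbhs_self fg.
apply/cderP => e /H; apply: filterS2 fg => y /= <-.
by rewrite fgx.
Qed.

Lemma cderV f x d : f x != 0 -> cder f x d -> cder (fun y => (f y)^-1) x (- d / f x ^+ 2).
Proof.
move=> fx0 Hf; have cf := cder_cont Hf; move: Hf => [p [cp <- fE]].
have nz : cnbhs x [set y | f y != 0].
  apply: filterS (ccvg_neq0 fx0 cf) => y /=; rewrite -cmod_gt0; apply: le_lt_trans.
  by rewrite divr_ge0 // cmod_ge0.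
apply/cderP => e e0.
have : ccvg (cnbhs x) (fun y => - p y / (f x * f y)) (- p x / (f x * f x)).
  apply: ccvgM; first exact: ccvgN.
  by apply: ccvgV; [rewrite mulf_neq0 | apply: ccvgM => //; exact: ccvg_cst].
move/(_ e e0); apply: filterS2 nz => y /= fy0 /ltW h.
have -> : (f y)^-1 - (f x)^-1 = - p y / (f x * f y) * (y - x).
  have -> : - p y / (f x * f y) * (y - x) = - (p y * (y - x)) / (f x * f y) by ring.
  have -> : p y * (y - x) = f y - f x by rewrite [f y]fE; ring.
  by field; rewrite fx0 fy0.
by rewrite -mulrBl cmodM expr2 ler_wpM2r ?cmod_ge0.
Qed.

Lemma cder_comp f g x d d' : cder f x d -> cder g (f x) d' -> cder (fun y => g (f y)) x (d' * d).
Proof.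
move=> Hf [q [cq <- gE]]; have cf := cder_cont Hf; move: Hf => [p [cp <- fE]].
exists (fun y => q (f y) * p y); split=> [||y].
- by apply: ccvgM => //; exact: ccvg_comp cf cq.
- by [].
- rewrite [in LHS]gE -mulrA; congr (_ + _ * _).
  by rewrite [f y]fE; ring.
Qed.

Lemma cpunct_ex x (P : C -> Prop) : cnbhs x P -> exists2 y, y != x & P y.
Proof.
move=> [r r0 rP]; exists (x + (r / 2)%:C).
  rewrite -subr_eq0 addrC addKr -cmod_gt0 cmodR gtr0_norm; lra.
by apply: rP; rewrite addrC addKr cmodR gtr0_norm; lra.
Qed.

Lemma cder_uniq f x d d' : cder f x d -> cder f x d' -> d = d'.
Proof.
move=> /cderP H /cderP H'; apply/eqP; rewrite -subr_eq0; apply/negPn/negP => dd.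
have e0 : 0 < cmod (d - d') / 4 by rewrite divr_gt0 // cmod_gt0.
have [y yx [h1 h2]] := cpunct_ex (filterI (H _ e0) (H' _ e0)).
have m0 : 0 < cmod (y - x) by rewrite cmod_gt0 subr_eq0.
have := cmodB (f y - f x - d' * (y - x)) (f y - f x - d * (y - x)).
have -> : (f y - f x - d' * (y - x)) - (f y - f x - d * (y - x)) = (d - d') * (y - x) by ring.
rewrite cmodM; move: h1 h2 => /= h1 h2 h3.
have : cmod (d - d') * cmod (y - x) <= cmod (d - d') / 2 * cmod (y - x) by lra.
rewrite ler_pM2r //; have : 0 < cmod (d - d') by rewrite cmod_gt0.
by lra.
Qed.
End Deriv.

(** * The complex exponential *)

Section Cexp.
Context {R : realType}.
Local Notation C := R[i].
Local Notation Re := (@complex.Re R).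
Local Notation Im := (@complex.Im R).
Implicit Types (z u v : C).

Lemma real_cont_near (f : R -> R) (x e : R) : {for x, continuous f} -> 0 < e ->
  exists2 r : R, 0 < r & forall y, `|y - x| < r -> `|f y - f x| < e.
Proof.
move=> /cvgrPdist_lt /(_ e) H /H /nbhs_normP [r /= r0 rP]; exists r => // y yx.
by rewrite distrC; apply: rP; rewrite /= distrC.
Qed.

Lemma real_der_near (f : R -> R) (x d e : R) : is_derive x 1 f d -> 0 < e ->
  exists2 r : R, 0 < r & forall h, `|h| < r -> `|f (x + h) - f x - d * h| <= e * `|h|.
Proof.
move=> [df <-] e0; have := derivableP df; rewrite /derivable in df.
move=> _; move: df => /cvgrPdist_lt /(_ e e0); rewrite near_withinE => /nbhs_normP [r /= r0 rP].
exists r => // h hr; have [->|h0] := eqVneq h 0.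
  by rewrite addr0 subrr mulr0 subrr normr0 mulr0.
have := rP h; rewrite /= sub0r normrN => /(_ hr h0).
rewrite -/(derive f x 1) /= /GRing.scale /= mulr1 (addrC h) => /ltW hh.
have -> : f (x + h) - f x - 'D_1 f x * h = - ('D_1 f x - h^-1 * (f (x + h) - f x)) * h.
  by field.
by rewrite normrM normrN ler_wpM2r.
Qed.

Lemma cexpE z : cexp z = (expR (Re z) * cos (Im z)) +i* (expR (Re z) * sin (Im z)).
Proof. by apply: complex_ext; rewrite /cexp !ReImE. Qed.

Lemma Re_cexp z : Re (cexp z) = expR (Re z) * cos (Im z). Proof. by rewrite cexpE. Qed.
Lemma Im_cexp z : Im (cexp z) = expR (Re z) * sin (Im z). Proof. by rewrite cexpE. Qed.

Lemma cexpD u v : cexp (u + v) = cexp u * cexp v.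
Proof.
apply: complex_ext.
  by rewrite Re_cexp Re_mul !Re_cexp !Im_cexp Re_add Im_add expRD cosD; ring.
by rewrite Im_cexp Im_mul !Re_cexp !Im_cexp Re_add Im_add expRD sinD; ring.
Qed.

Lemma cexp0 : cexp (0 : C) = 1.
Proof. by apply: complex_ext; rewrite ?Re_cexp ?Im_cexp /= expR0 ?cos0 ?sin0 ?mulr1 ?mulr0. Qed.

Lemma cmod_cexp z : cmod (cexp z) = expR (Re z).
Proof.
rewrite cmodE Re_cexp Im_cexp !exprMn -mulrDr cos2Dsin2 mulr1 sqrtr_sqr ger0_norm // expR_ge0.
Qed.

Lemma cexp_neq0 z : cexp z != 0.
Proof. by rewrite -cmod_gt0 cmod_cexp expR_gt0. Qed.

Lemma cexpN z : cexp (- z) = (cexp z)^-1.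
Proof.
apply: (mulIf (cexp_neq0 z)); rewrite -cexpD addNr cexp0 mulVf ?cexp_neq0 //.
Qed.

Lemma cexpB u v : cexp (u - v) = cexp u / cexp v.
Proof. by rewrite cexpD cexpN. Qed.

Lemma cexp_int z (k : int) : cexp (z *~ k) = cexp z ^ k.
Proof.
have cn (n : nat) : cexp (z *+ n) = cexp z ^+ n.
  by elim: n => [|n IH]; rewrite ?mulr0n ?cexp0 ?expr0 // mulrS cexpD IH exprS.
case: k => n; first by rewrite -pmulrn -exprnP cn.
by rewrite NegzE mulrNz -pmulrn cexpN cn.
Qed.

Definition twopii : C := 0 +i* (2 * pi).

Lemma cexp_2pii : cexp twopii = 1.
Proof.
have e : 2 * pi = pi *+ 2 :> R by rewrite mulr_natl.
apply: complex_ext; rewrite ?Re_cexp ?Im_cexp /= expR0 mul1r e ?cos2pi ?sin2pi //.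
Qed.

Lemma cexp_per z (k : int) : cexp (z + twopii *~ k) = cexp z.
Proof. by rewrite cexpD cexp_int cexp_2pii exp1rz mulr1. Qed.

Lemma Im_mulz z (k : int) : Im (z *~ k) = Im z * k%:~R.
Proof. by rewrite -[z *~ k]mulrzr -[k%:~R](rmorph_int (real_complex R)) mulrC Im_rM mulrC. Qed.

Lemma Re_mulz z (k : int) : Re (z *~ k) = Re z * k%:~R.
Proof. by rewrite -[z *~ k]mulrzr -[k%:~R](rmorph_int (real_complex R)) mulrC Re_rM mulrC. Qed.

Lemma window (a p : R) : 0 < p -> exists k : int, - (p / 2) <= a + p * k%:~R <= p / 2.
Proof.
(* Adding 1/2 before taking the floor rounds [a / p] to a nearest integer. *)
move=> p0; exists (- Num.floor (a / p + 2^-1)).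
have := Num.Theory.floor_itv (a / p + 2^-1) => /andP[h1 h2].
move: h1 h2; move: (Num.floor _) => k h1 h2; rewrite rmorphN mulrN.
have h3 : k%:~R * p <= a + p / 2.
  have -> : a + p / 2 = (a / p + 2^-1) * p by field; rewrite gt_eqF.
  by rewrite ler_pM2r.
have h4 : a + p / 2 <= (k + 1)%:~R * p.
  have -> : a + p / 2 = (a / p + 2^-1) * p by field; rewrite gt_eqF.
  by rewrite ler_pM2r // ltW.
by move: h4; rewrite rmorphD /= => h4; apply/andP; split; lra.
Qed.

(** The real part vanishes by the modulus. Once the imaginary part is shifted into [-pi, pi], its
    cosine is 1, and [cos] is injective on [0, pi]. *)
Lemma cexp_eq1 z : cexp z = 1 -> exists k : int, z = twopii *~ k.
Proof.
move=> z1; have Rz : Re z = 0.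
  by have := cmod_cexp z; rewrite z1 cmod1 -expR0 => /expR_inj.
have p0 : 0 < 2 * pi :> R by rewrite mulr_gt0 // pi_gt0.
have [k /andP[k1 k2]] := window (Im z) p0.
have := cexp_per z k; rewrite z1 => /(congr1 Re); rewrite Re_cexp !ReImE Re_mulz Im_mulz /= Rz.
rewrite mul0r addr0 expR0 mul1r -cos_norm => c1.
have : `|Im z + 2 * pi * k%:~R| = 0.
  apply: cos_inj; rewrite ?cos0 // in_itv /= ?lexx ?pi_ge0 ?normr_ge0 //=.
  by rewrite ler_norml; apply/andP; split; lra.
move/normr0_eq0 => h; exists (- k); apply: complex_ext; rewrite ?Re_mulz ?Im_mulz /= ?mul0r //.
by rewrite rmorphN /=; lra.
Qed.

Lemma cexp_eq u v : cexp u = cexp v -> exists k : int, u = v + twopii *~ k.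
Proof.
move=> uv; have [|k kE] := @cexp_eq1 (u - v).
  by rewrite cexpB uv divff ?cexp_neq0.
by exists k; rewrite -kE subrKC.
Qed.

Lemma cexp_surj z : z != 0 -> exists u, cexp u = z.
Proof.
move=> z0; have r0 : 0 < cmod z by rewrite cmod_gt0.
have rE : cmod z ^+ 2 = Re z ^+ 2 + Im z ^+ 2 by rewrite cmodE sqr_sqrtr // addr_ge0 // sqr_ge0.
pose c := Re z / cmod z; pose s := Im z / cmod z.
have cs : c ^+ 2 + s ^+ 2 = 1.
  by rewrite /c /s !exprMn exprVn -mulrDl -rE divff // expf_neq0 // gt_eqF.
have c1 : -1 <= c <= 1.
  by rewrite -ler_norml /c normrM normfV (gtr0_norm r0) ler_pdivrMr // mul1r cmod_Re.
have [th [cth sth]] : exists th, cos th = c /\ sin th = s.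
  have sE : Num.sqrt (1 - c ^+ 2) = `|s|.
    by rewrite -sqrtr_sqr; congr Num.sqrt; rewrite -cs; ring.
  case: (lerP 0 s) => s0.
    exists (acos c); rewrite acosK ?in_itv //= sin_acos // sE ger0_norm //.
  exists (- acos c); rewrite cosN sinN acosK ?in_itv //= sin_acos // sE ltr0_norm // opprK //.
exists (ln (cmod z) +i* th); apply: complex_ext; rewrite ?Re_cexp ?Im_cexp /= lnK ?posrE //.
  by rewrite cth /c mulrC divfK // gt_eqF.
by rewrite sth /s mulrC divfK // gt_eqF.
Qed.

Lemma cexp_der0 : cder (@cexp R) 0 1.
Proof.
(* With a and b the real and imaginary parts of z, the errors below add up to e' (|a| + 7 |b|),
   whence e / 8. *)
apply/cderP => e e0; pose e' := Num.min (e / 8) 1.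
have e'0 : 0 < e' by rewrite lt_min ltr01 divr_gt0.
have e'1 : e' <= 1 by rewrite ge_min lexx orbT.
have e'8 : 8 * e' <= e by rewrite mulrC -ler_pdivlMr // ge_min lexx.
have [r1 r10 H1] := real_der_near (is_derive_expR 0) e'0.
have [r2 r20 H2] := real_der_near (is_derive_cos 0) e'0.
have [r3 r30 H3] := real_der_near (is_derive_sin 0) e'0.
exists (Num.min (Num.min r1 r2) (Num.min r3 e')); first by rewrite 3!lt_min r10 r20 r30.
move=> z; rewrite subr0 3!lt_min => /andP[/andP[z1 z2] /andP[z3 ze]] /=.
have hR := cmod_Re z; have hI := cmod_Im z.
have := H1 (Re z) (le_lt_trans hR z1); have := H2 (Im z) (le_lt_trans hI z2).
have := H3 (Im z) (le_lt_trans hI z3).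
rewrite !add0r expR0 cos0 sin0 !mul1r oppr0 mul0r !subr0 ?addr0.
set a := Re z; set b := Im z => h3 h2 h1.
have aS : `|a| <= e' by rewrite (le_trans hR) // ltW.
rewrite cexp0 (le_trans (cmod_ReIm _)) // !(Re_add, Re_opp, Im_add, Im_opp) Re_cexp Im_cexp /= -/a -/b subr0.
have -> : expR a * cos b - 1 - a = (expR a - 1 - a) * cos b + (1 + a) * (cos b - 1) by ring.
have -> : expR a * sin b - b = (expR a - 1) * sin b + (sin b - b) by ring.
have b1 : `|(expR a - 1 - a) * cos b| <= e' * `|a|.
  by rewrite normrM -[leRHS]mulr1 ler_pM // cos_max.
have b2 : `|(1 + a) * (cos b - 1)| <= 2 * (e' * `|b|).
  rewrite normrM ler_pM // (le_trans (ler_normD _ _)) // normr1; lra.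
have b3 : `|(expR a - 1) * sin b| <= (2 * e') * (2 * `|b|).
  rewrite normrM ler_pM //.
    have := ler_normD (expR a - 1 - a) a; rewrite subrK.
    have : e' * `|a| <= e' by rewrite -[leRHS]mulr1 ler_pM2l //; lra.
    lra.
  have := ler_normD (sin b - b) b; rewrite subrK.
  have : e' * `|b| <= `|b| by rewrite ler_piMl.
  lra.
have bR : e' * `|a| <= e' * cmod z by rewrite ler_pM2l.
have bI : e' * `|b| <= e' * cmod z by rewrite ler_pM2l.
have b4 : 8 * e' * cmod z <= e * cmod z by rewrite ler_wpM2r ?cmod_ge0.
have := ler_normD ((expR a - 1 - a) * cos b) ((1 + a) * (cos b - 1)).
have := ler_normD ((expR a - 1) * sin b) (sin b - b).
lra.
Qed.

Lemma cexp_der z : cder (@cexp R) z (cexp z).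
Proof.
have h : cder (fun y : C => y - z) z (1 - 0) by apply: cderB; [exact: cder_id | exact: cder_cst].
have h2 : cder (@cexp R) (z - z) 1 by rewrite subrr; exact: cexp_der0.
have := cderZ (cexp z) (cder_comp h h2); rewrite subr0 !mulr1.
by apply: cder_near; apply: filterE => y /=; rewrite -cexpD subrKC.
Qed.

Lemma asin0 : asin (0 : R) = 0.
Proof.
rewrite -{1}(@sin0 R) sinK // in_itv /=; have := @pi_gt0 R => h.
by apply/andP; split; lra.
Qed.

(** The principal logarithm on the half-plane Re z > 0, where [asin] recovers the argument; it is
    used near 1 only. *)
Definition clog1 z : C := ln (cmod z) +i* asin (Im z / cmod z).

Lemma ccvg_cmod T (F : set_system T) {FF : Filter F} (f : T -> C) (a : C) (e : R) :
  ccvg F f a -> 0 < e -> F [set t | `|cmod (f t) - cmod a| < e].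
Proof.
move=> fa e0; apply: filterS (fa e e0) => t /= h; rewrite ltr_norml; apply/andP; split.
  by have := lerB_cmod a (f t); rewrite cmodBC; lra.
by have := lerB_cmod (f t) a; lra.
Qed.

Lemma clog1_cvg : ccvg (cnbhs (1 : C)) clog1 0.
Proof.
move=> e e0; have e2 : 0 < e / 2 by rewrite divr_gt0.
have [r1 r10 H1] := @real_cont_near (@ln R) 1 _ (continuous_ln ltr01) e2.
have i0 : -1 < (0 : R) < 1 by rewrite ltrN10 ltr01.
have [r2 r20 H2] := @real_cont_near (@asin R) 0 _ (continuous_asin i0) e2.
have c1 : cnbhs (1 : C) [set t | `|cmod t - cmod 1| < r1].
  by apply: ccvg_cmod => //; exact: ccvg_id.
have c2 : cnbhs (1 : C) [set t | `|cmod t - cmod 1| < 2^-1].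
  by apply: ccvg_cmod; [exact: ccvg_id | rewrite invr_gt0].
have c3 : cnbhs (1 : C) [set z | cmod (z - 1) < r2 / 2] by apply: cnbhs_ball; rewrite divr_gt0.
apply: filterS3 c1 c2 c3 => z /=; rewrite cmod1 => /H1 h1 h2 h3.
rewrite subr0 (le_lt_trans (cmod_ReIm _)) //=; move: h1; rewrite ln1 subr0 => h1.
have z2 : 2^-1 < cmod z by move: h2; rewrite ltr_norml => /andP[]; lra.
have z0 : 0 < cmod z by rewrite (lt_trans _ z2) // invr_gt0.
have := H2 (Im z / cmod z); rewrite subr0 asin0 subr0 => h4.
suff : `|Im z / cmod z| < r2 by move/h4; lra.
rewrite normrM normfV (gtr0_norm z0) ltr_pdivrMr //.
have := cmod_Im (z - 1); rewrite !ReImE /= oppr0 addr0 => h5.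
have : r2 * 2^-1 < r2 * cmod z by rewrite ltr_pM2l.
lra.
Qed.

Lemma clog1K : cnbhs (1 : C) [set z | cexp (clog1 z) = z].
Proof.
exists 1 => // z z1; have Rz : 0 < Re z.
  by have := le_lt_trans (cmod_Re _) z1; rewrite !ReImE /= ltr_norml => /andP[]; lra.
have z0 : 0 < cmod z by rewrite (lt_le_trans Rz) // (le_trans (ler_norm _)) // cmod_Re.
have i1 : -1 <= Im z / cmod z <= 1.
  by rewrite -ler_norml normrM normfV (gtr0_norm z0) ler_pdivrMr // mul1r cmod_Im.
apply: complex_ext; rewrite ?Re_cexp ?Im_cexp /= lnK ?posrE //; last first.
  by rewrite asinK ?in_itv //= mulrC divfK // gt_eqF.
rewrite cos_asin //.
have rE : cmod z ^+ 2 = Re z ^+ 2 + Im z ^+ 2 by rewrite cmodE sqr_sqrtr // addr_ge0 // sqr_ge0.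
have -> : 1 - (Im z / cmod z) ^+ 2 = (Re z / cmod z) ^+ 2.
  by rewrite !exprMn exprVn; apply: (@mulIf _ (cmod z ^+ 2)); rewrite ?expf_neq0 ?gt_eqF // mulrBl mul1r !divfK ?expf_neq0 ?gt_eqF // rE; ring.
by rewrite sqrtr_sqr ger0_norm ?divr_ge0 ?ltW // mulrC divfK // gt_eqF.
Qed.

Lemma clog1_1 : clog1 1 = 0.
Proof. by rewrite /clog1 cmod1 /= mul0r asin0 ln1. Qed.

Lemma clog1_der : cder clog1 1 1.
Proof.
(* The bound 1/2 gives |clog1 z| <= 2 |z - 1|, and e / 2 compensates for this factor. *)
apply/cderP => e e0; pose e' := Num.min (e / 2) 2^-1.
have e'0 : 0 < e' by rewrite lt_min invr_gt0 ltr0n andbT divr_gt0.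
have [r r0 rP] := (cderP _ _ _).1 cexp_der0 e' e'0.
apply: filterS2 (clog1_cvg r0) clog1K => z /= h1 h2.
move: (rP (clog1 z) h1); rewrite /= h2 cexp0 mul1r !subr0 clog1_1 subr0 mul1r => h3.
have h4 : cmod (clog1 z) <= 2 * cmod (z - 1).
  have := lerB_cmod (clog1 z) (clog1 z - (z - 1)); rewrite subKr => h5.
  have : e' * cmod (clog1 z) <= 2^-1 * cmod (clog1 z).
    by rewrite ler_wpM2r ?cmod_ge0 // ge_min lexx orbT.
  move: h3; rewrite cmodBC; lra.
rewrite (cmodBC (clog1 z)) (le_trans h3) // (le_trans (ler_wpM2l (ltW e'0) h4)) // mulrA ler_wpM2r ?cmod_ge0 //.
by rewrite -ler_pdivlMr // ge_min lexx.
Qed.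
End Cexp.

(** * Cauchy's theorem and its consequences *)

Section Goursat.
Context {R : realType}.
Local Notation C := R[i].
Local Notation Re := (@complex.Re R).
Local Notation Im := (@complex.Im R).
Implicit Types (z w u v : C) (f g : C -> C).

Definition rcont (g : R -> C) (t : R) := ccvg (nbhs t) g (g t).

Lemma nbhsR_norm (t : R) (P : R -> Prop) :
  nbhs t P <-> exists2 r : R, 0 < r & forall s, `|s - t| < r -> P s.
Proof.
split.
  by move=> /nbhs_normP [r /= r0 rP]; exists r => // s st; apply: rP; rewrite /= distrC.
by move=> [r r0 rP]; apply/nbhs_normP; exists r => // s /=; rewrite distrC => /rP.
Qed.

Lemma rcont_real t : rcont (fun s : R => s%:C) t.
Proof. by move=> e e0; apply/nbhsR_norm; exists e => // s; rewrite /= -rmorphB cmodR. Qed.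

Lemma rcont_affine z w t : rcont (fun s : R => z + w * s%:C) t.
Proof.
apply: ccvgD; first exact: ccvg_cst.
by apply: ccvgM; [exact: ccvg_cst | exact: rcont_real].
Qed.

Lemma rcont_bounded01 (g : R -> C) : (forall t, in01 t -> rcont g t) -> bounded01 g.
Proof.
move=> cg; have := @segment_compact R 0 1; rewrite compact_near_coveringP.
move=> /(_ R (+oo%R : set_system R) (fun M t => cmod (g t) < M) _) H.
have [|M [Mr]] := H _.
  move=> t t01; have /(_ 1 ltr01) h := cg t t01.
  exists ([set t' | cmod (g t' - g t) < 1], [set M | cmod (g t) + 1 < M]) => /=.
    by split=> //; apply: nbhs_pinfty_gt; exact: num_real.
  move=> [t' M] /= [h1 h2]; rewrite (lt_trans _ h2) //.
  by have := cmodD (g t' - g t) (g t); rewrite subrK; lra.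
move=> /(_ (M + 1)) HM; exists (M + 1) => t t01.
by apply: ltW; apply: HM; rewrite ?ltrDl.
Qed.

(** The integral of [f] along the segment from [z] to [z + w]. *)
Definition edge f z w := w * mean (fun t => f (z + w * t%:C)).

(** The integral along the boundary of a parallelogram. This shape divides into four halves of
    itself, and a rectangle is what the exponential maps onto an annulus. *)
Definition para f z w1 w2 :=
  edge f z w1 + edge f (z + w1) w2 - edge f (z + w2) w1 - edge f z w2.

Definition in_para z w1 w2 u :=
  exists s t : R, [/\ in01 s, in01 t & u = z + w1 * s%:C + w2 * t%:C].

Lemma edge_half f z w : bounded01 (fun t => f (z + w * t%:C)) ->
  edge f z w = edge f z (w / 2) + edge f (z + w / 2) (w / 2).
Proof.
move=> bf; rewrite /edge mean_half //.
have -> : (fun t : R => f (z + w * (t / 2)%:C)) = fun t => f (z + w / 2 * t%:C).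
  apply/funext => t; congr (f (_ + _)); rewrite rmorphM /= fmorphV rmorph_nat; ring.
have -> : (fun t : R => f (z + w * ((1 + t) / 2)%:C)) = fun t => f (z + w / 2 + w / 2 * t%:C).
  apply/funext => t; congr (f _).
  by rewrite rmorphM rmorphD /= fmorphV rmorph_nat rmorph1; field.
by field.
Qed.

Lemma edge_affine (a b : C) z w : edge (fun u => a + b * u) z w = w * (a + b * z + b * w / 2).
Proof.
rewrite /edge; congr (_ * _).
rewrite (_ : (fun t => _) = fun t => (a + b * z) + b * w * t%:C); last first.
  by apply/funext => t; ring.
have bt : bounded01 (fun t : R => t%:C) by apply: rcont_bounded01 => t _; exact: rcont_real.
rewrite meanD ?mean_cst ?meanZ ?mean_id //; last 2 first.
- exact: bounded01_cst.
- by apply: bounded01M => //; exact: bounded01_cst.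
by rewrite fmorphV rmorph_nat.
Qed.

Lemma para_affine (a b : C) z w1 w2 : para (fun u => a + b * u) z w1 w2 = 0.
Proof. by rewrite /para !edge_affine; field. Qed.

Lemma edgeD f g z w : bounded01 (fun t => f (z + w * t%:C)) ->
  bounded01 (fun t => g (z + w * t%:C)) ->
  edge (fun u => f u + g u) z w = edge f z w + edge g z w.
Proof. by move=> bf bg; rewrite /edge meanD // mulrDr. Qed.

Lemma edge_bound f z w (M : R) : (forall t, in01 t -> cmod (f (z + w * t%:C)) <= M) ->
  cmod (edge f z w) <= cmod w * (2 * M).
Proof. by move=> fM; rewrite /edge cmodM ler_wpM2l ?cmod_ge0 // mean_bound. Qed.

Lemma in01_0 : in01 (0 : R). Proof. by rewrite /in01 lexx ler01. Qed.
Lemma in01_1 : in01 (1 : R). Proof. by rewrite /in01 lexx ler01. Qed.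

Definition bedges f z w1 w2 :=
  [/\ bounded01 (fun t => f (z + w1 * t%:C)), bounded01 (fun t => f (z + w1 + w2 * t%:C)),
      bounded01 (fun t => f (z + w2 + w1 * t%:C)) & bounded01 (fun t => f (z + w2 * t%:C))].

Lemma para_cont_bedges f z w1 w2 : (forall u, in_para z w1 w2 u -> ccont f u) ->
  bedges f z w1 w2.
Proof.
move=> cf; split; apply: rcont_bounded01 => t t01; rewrite /rcont;
  apply: (@ccvg_comp _ _ _ _ (fun s : R => _) f); try exact: rcont_affine; apply: cf.
- by exists t, 0; split; rewrite ?in01_0 // rmorph0 mulr0 addr0.
- by exists 1, t; split; rewrite ?in01_1 // rmorph1 mulr1.
- by exists t, 1; split; rewrite ?in01_1 // rmorph1 mulr1 addrAC.
- by exists 0, t; split; rewrite ?in01_0 // rmorph0 mulr0 addr0.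
Qed.

Lemma para_le f z w1 w2 (M : R) : (forall u, in_para z w1 w2 u -> cmod (f u) <= M) ->
  cmod (para f z w1 w2) <= 4 * M * (cmod w1 + cmod w2).
Proof.
move=> fM.
have h1 : cmod (edge f z w1) <= cmod w1 * (2 * M).
  apply: edge_bound => t t01; apply: fM.
  by exists t, 0; split; rewrite ?in01_0 // rmorph0 mulr0 addr0.
have h2 : cmod (edge f (z + w1) w2) <= cmod w2 * (2 * M).
  apply: edge_bound => t t01; apply: fM.
  by exists 1, t; split; rewrite ?in01_1 // rmorph1 mulr1.
have h3 : cmod (edge f (z + w2) w1) <= cmod w1 * (2 * M).
  apply: edge_bound => t t01; apply: fM.
  by exists t, 1; split; rewrite ?in01_1 // rmorph1 mulr1 addrAC.
have h4 : cmod (edge f z w2) <= cmod w2 * (2 * M).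
  apply: edge_bound => t t01; apply: fM.
  by exists 0, t; split; rewrite ?in01_0 // rmorph0 mulr0 addr0.
rewrite /para.
have := cmodB (edge f z w1 + edge f (z + w1) w2 - edge f (z + w2) w1) (edge f z w2).
have := cmodB (edge f z w1 + edge f (z + w1) w2) (edge f (z + w2) w1).
have := cmodD (edge f z w1) (edge f (z + w1) w2).
lra.
Qed.

Lemma paraD f g z w1 w2 : bedges f z w1 w2 -> bedges g z w1 w2 ->
  para (fun u => f u + g u) z w1 w2 = para f z w1 w2 + para g z w1 w2.
Proof. by move=> [b1 b2 b3 b4] [c1 c2 c3 c4]; rewrite /para !edgeD //; ring. Qed.

Lemma para_quad f z w1 w2 : (forall u, in_para z w1 w2 u -> ccont f u) ->
  para f z w1 w2 = para f z (w1 / 2) (w2 / 2) + para f (z + w1 / 2) (w1 / 2) (w2 / 2)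
   + para f (z + w2 / 2) (w1 / 2) (w2 / 2) + para f (z + w1 / 2 + w2 / 2) (w1 / 2) (w2 / 2).
Proof.
move=> cf; have [b1 b2 b3 b4] := para_cont_bedges cf.
rewrite /para (edge_half b1) (edge_half b2) (edge_half b3) (edge_half b4).
have -> : z + w1 / 2 + w1 / 2 = z + w1 by field.
have -> : z + w2 / 2 + w2 / 2 = z + w2 by field.
have -> : z + w1 / 2 + w2 / 2 + w1 / 2 = z + w1 + w2 / 2 by field.
have -> : z + w1 / 2 + w2 / 2 + w2 / 2 = z + w2 + w1 / 2 by field.
have -> : z + w2 / 2 + w1 / 2 = z + w1 / 2 + w2 / 2 by ring.
by ring.
Qed.

Lemma sub_para z w1 w2 (s t q : R) u : 0 <= s -> 0 <= t -> 0 <= q -> s + q <= 1 -> t + q <= 1 ->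
  in_para (z + w1 * s%:C + w2 * t%:C) (w1 * q%:C) (w2 * q%:C) u -> in_para z w1 w2 u.
Proof.
move=> s0 t0 q0 s1 t1 [s' [t' [/andP[h1 h2] /andP[h3 h4] ->]]].
exists (s + q * s'), (t + q * t'); split.
- rewrite /in01 addr_ge0 ?mulr_ge0 //= (le_trans _ s1) // lerD2l ler_piMr //.
- rewrite /in01 addr_ge0 ?mulr_ge0 //= (le_trans _ t1) // lerD2l ler_piMr //.
- by rewrite !rmorphD !rmorphM /=; ring.
Qed.

(** Goursat's argument: keep the quarter with the largest integral; at the common point of the
    nested parallelograms, the affine part of [f] has integral 0 and the remainder is small compared
    with the area. *)
Theorem goursat f z w1 w2 : (forall u, in_para z w1 w2 u -> exists d, cder f u d) ->
  para f z w1 w2 = 0.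
Proof.
move=> df; have cf u : in_para z w1 w2 u -> ccont f u by move=> /df [d /cder_cont].
pose Z (p : R * R) := z + w1 * p.1%:C + w2 * p.2%:C.
pose q n : R := 2^-1 ^+ n.
have q0 n : 0 < q n by rewrite exprn_gt0 // invr_gt0.
have qS n : q n.+1 = q n / 2 by rewrite /q exprSr.
pose J n p := cmod (para f (Z p) (w1 * (q n)%:C) (w2 * (q n)%:C)).
pose valid n (p : R * R) := [/\ 0 <= p.1, 0 <= p.2, p.1 + q n <= 1 & p.2 + q n <= 1].
(* At least one quarter carries a fourth of the integral. [p] holds the coordinates, relative to the
   two sides, of the corner of the current parallelogram. *)
have step np : exists p' : R * R, valid np.1 np.2 ->
    [/\ valid np.1.+1 p', J np.1 np.2 <= 4 * J np.1.+1 p',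
        np.2.1 <= p'.1 /\ p'.1 + q np.1.+1 <= np.2.1 + q np.1 &
        np.2.2 <= p'.2 /\ p'.2 + q np.1.+1 <= np.2.2 + q np.1].
  case: np => n p; case: (pselect (valid n p)) => [|nv]; last by exists p.
  move=> [/= h1 h2 h3 h4].
  pose d (a b : bool) : R * R := (p.1 + a%:R * q n.+1, p.2 + b%:R * q n.+1).
  have dv a b : [/\ valid n.+1 (d a b), p.1 <= (d a b).1 /\ (d a b).1 + q n.+1 <= p.1 + q n &
        p.2 <= (d a b).2 /\ (d a b).2 + q n.+1 <= p.2 + q n].
    have := q0 n; have h5 := qS n.
    by case: a; case: b; rewrite /valid /d /=; (split; [split|split|split]); lra.
  suff [a [b hab]] : exists a b, J n p <= 4 * J n.+1 (d a b).
    by exists (d a b) => _; have [? ? ?] := dv a b; split.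
  apply: contrapT => H.
  have Hab a b : 4 * J n.+1 (d a b) < J n p.
    by rewrite ltNge; apply/negP => hab; apply: H; exists a, b.
  have := para_quad (f := f) (z := Z p) (w1 := w1 * (q n)%:C) (w2 := w2 * (q n)%:C).
  have qE : forall w, w * (q n)%:C / 2 = w * (q n.+1)%:C.
    by move=> w; rewrite qS rmorphM /= fmorphV rmorph_nat mulrA.
  rewrite !qE => quad.
  have zE a b : Z (d a b) = Z p + a%:R * (w1 * (q n.+1)%:C) + b%:R * (w2 * (q n.+1)%:C).
    by rewrite /Z /d /= !rmorphD !rmorphM !rmorph_nat; ring.
  have := Hab false false; have := Hab true false; have := Hab false true; have := Hab true true.
  rewrite /J !zE !mul1r !mul0r !addr0 quad; last first.
    by move=> u hu; apply: cf; apply: sub_para hu => //; exact: ltW.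
  set A := para _ _ _ _; set B := para _ _ _ _; set D := para _ _ _ _; set E := para _ _ _ _.
  have := cmodD (B + D + E) A; have := cmodD (B + D) E; have := cmodD B D.
  lra.
have [nx nxP] := choice step.
pose x := fix x n : R * R := if n is n'.+1 then nx (n', x n') else (0, 0).
have xv n : valid n (x n).
  elim: n => [|n IH]; first by rewrite /valid /= /q expr0 add0r lexx.
  by have [] := nxP (n, x n) IH.
have xJ n : J 0%N (0, 0) <= 4 ^+ n * J n (x n).
  elim: n => [|n IH]; first by rewrite expr0 mul1r.
  rewrite (le_trans IH) // exprSr -mulrA ler_wpM2l ?exprn_ge0 //.
  by have [] := nxP (n, x n) (xv n).
(* Nested intervals, applied to each of the two coordinates. *)
have mono (c : R * R -> R) : (forall n, c (x n) <= c (x n.+1) /\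
      c (x n.+1) + q n.+1 <= c (x n) + q n) ->
    exists l, forall n, c (x n) <= l <= c (x n) + q n.
  move=> H.
  have up m n : c (x m) <= c (x (n + m)%N) by elim: n => // n IH; rewrite (le_trans IH) // (H _).1.
  have dn m n : c (x (n + m)%N) + q (n + m)%N <= c (x m) + q m.
    by elim: n => // n IH; rewrite (le_trans _ IH) // (H _).2.
  have cmp m n : c (x m) <= c (x n) + q n.
    case: (leP m n) => h.
      by rewrite -(subnK h) (le_trans (up m (n - m)%N)) // lerDl ltW.
    by have := dn n (m - n)%N; rewrite subnK 1?ltnW // => h2; rewrite (le_trans _ h2) // lerDl ltW.
  have hs : has_sup [set c (x n) | n in setT].
    split; first by exists (c (x 0%N)); exists 0%N.
    by exists (c (x 0%N) + q 0%N) => _ [n _ <-].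
  exists (sup [set c (x n) | n in setT]) => n; apply/andP; split.
    by apply: sup_upper_bound => //; exists n.
  by apply: ge_sup; [exact: hs.1 | move=> _ [m _ <-]].
have [l1 l1P] : exists l, forall n, (x n).1 <= l <= (x n).1 + q n.
  by apply: (mono fst) => n; have [] := nxP (n, x n) (xv n).
have [l2 l2P] : exists l, forall n, (x n).2 <= l <= (x n).2 + q n.
  by apply: (mono snd) => n; have [] := nxP (n, x n) (xv n).
pose zt := z + w1 * l1%:C + w2 * l2%:C.
have ztP : in_para z w1 w2 zt.
  by exists l1, l2; split => //; [have := l1P 0%N | have := l2P 0%N]; rewrite /= /q expr0 add0r.
have [d /cderP dP] := df zt ztP.
pose W := cmod w1 + cmod w2; have W0 : 0 <= W by rewrite addr_ge0 ?cmod_ge0.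
suff : J 0%N (0, 0) <= 0.
  rewrite /J /Z /q /= expr0 !rmorph1 !rmorph0 !mulr1 !mulr0 !addr0 => h.
  by apply/eqP; rewrite -cmod_eq0 eq_le h cmod_ge0.
apply/ler_addgt0Pr => e e0; rewrite add0r.
(* The final bound is 4 W^2 e', as [4 ^+ n] and [q n ^+ 2] cancel; the added 1 keeps the denominator
   positive. *)
pose e' := e / (4 * W ^+ 2 + 1).
have P0 : 0 < 4 * W ^+ 2 + 1 by rewrite ltr_wpDl // mulr_ge0 // exprn_ge0.
have e'0 : 0 < e' by rewrite divr_gt0.
have [r r0 rP] := dP e' e'0.
have [n nP] : exists n, W * q n < r.
  have h : `|2^-1 : R| < 1 by rewrite ger0_norm ?invr_ge0 // invf_lt1 // ltr1n.
  have := cvg_expr h => /cvgr0Pnorm_lt /(_ (r / (W + 1))).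
  rewrite divr_gt0 ?ltr_wpDl // => /(_ isT) [N _ NP]; exists N.
  have := NP N (leqnn N); rewrite /= ger0_norm; last by rewrite ltW.
  rewrite ltr_pdivlMr ?ltr_wpDl // => h2; rewrite (le_lt_trans _ h2) // mulrC.
  by rewrite ler_wpM2l ?ltW ?ltrDl.
have bound u : in_para (Z (x n)) (w1 * (q n)%:C) (w2 * (q n)%:C) u ->
    cmod (f u - (f zt - d * zt + d * u)) <= e' * (W * q n).
  move=> [s [t [/andP[s0 s1] /andP[t0 t1] uE]]].
  have uz : u - zt = w1 * ((x n).1 + q n * s - l1)%:C + w2 * ((x n).2 + q n * t - l2)%:C.
    by rewrite uE /Z /zt !rmorphB !rmorphD !rmorphM /=; ring.
  have hh (a l s' : R) : a <= l <= a + q n -> 0 <= s' -> s' <= 1 -> `|a + q n * s' - l| <= q n.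
    move=> /andP[? ?] ? ?; have ? : 0 <= q n * s' by rewrite mulr_ge0 // ltW.
    have ? : q n * s' <= q n by rewrite ler_piMr // ltW.
    by rewrite ler_norml; apply/andP; split; lra.
  have du : cmod (u - zt) <= W * q n.
    rewrite uz (le_trans (cmodD _ _)) // !cmodM !cmodR mulrDl lerD //.
      by rewrite ler_wpM2l ?cmod_ge0 // hh.
    by rewrite ler_wpM2l ?cmod_ge0 // hh.
  have -> : f u - (f zt - d * zt + d * u) = f u - f zt - d * (u - zt) by ring.
  apply: (le_trans (rP u _)); first exact: le_lt_trans du nP.
  by apply: ler_wpM2l => //; exact: ltW.
have Jn : J n (x n) <= 4 * e' * W ^+ 2 * q n ^+ 2.
  rewrite /J.
  have cfu u : in_para (Z (x n)) (w1 * (q n)%:C) (w2 * (q n)%:C) u -> ccont f u.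
    by have [? ? ? ?] := xv n; move=> hu; apply: cf; apply: sub_para hu => //; exact: ltW.
  have ca u : ccont (fun u => (f zt - d * zt) + d * u) u.
    by apply: ccvgD; [exact: ccvg_cst | apply: ccvgM; [exact: ccvg_cst | exact: ccvg_id]].
  pose g u := f u - (f zt - d * zt + d * u).
  have [b1 b2 b3 b4] := para_cont_bedges (fun u hu => ca u) (z := Z (x n)) (w1 := w1 * (q n)%:C) (w2 := w2 * (q n)%:C).
  have [c1 c2 c3 c4] : bedges g (Z (x n)) (w1 * (q n)%:C) (w2 * (q n)%:C).
    by apply: para_cont_bedges => u hu; apply: ccvgB; [exact: cfu | exact: ca].
  have -> : para f (Z (x n)) (w1 * (q n)%:C) (w2 * (q n)%:C) =
      para g (Z (x n)) (w1 * (q n)%:C) (w2 * (q n)%:C).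
    rewrite -[RHS]add0r -(para_affine (f zt - d * zt) d (Z (x n)) (w1 * (q n)%:C) (w2 * (q n)%:C)).
    rewrite -(paraD (And4 b1 b2 b3 b4) (And4 c1 c2 c3 c4)).
    apply: (congr1 (fun h => para h (Z (x n)) (w1 * (q n)%:C) (w2 * (q n)%:C))).
    by apply/funext => u; rewrite /g subrKC.
  apply: (le_trans (para_le bound)).
  rewrite !cmodM !cmodR -mulrDl -/W (ger0_norm (ltW (q0 n))).
  by rewrite (_ : 4 * (e' * (W * q n)) * (W * q n) = 4 * e' * W ^+ 2 * q n ^+ 2) //; ring.
rewrite (le_trans (xJ n)) // (le_trans (ler_wpM2l _ Jn)) ?exprn_ge0 //.
have -> : 4 ^+ n * (4 * e' * W ^+ 2 * q n ^+ 2) = e' * (4 * W ^+ 2) * (4 ^+ n * q n ^+ 2) by ring.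
have -> : 4 ^+ n * q n ^+ 2 = 1 :> R.
  by rewrite /q -exprM mulnC exprM -exprMn expr2 (_ : 4 * _ = 1) ?expr1n //; field.
by rewrite mulr1 /e' mulrAC ler_pdivrMr // ler_pM2l // lerDl.
Qed.
End Goursat.

(** * Means over circles and Cauchy's formula *)

Section Circle.
Context {R : realType}.
Local Notation C := R[i].
Local Notation Re := (@complex.Re R).
Local Notation Im := (@complex.Im R).
Implicit Types (z w u v x : C) (f g : C -> C) (s : R).

Definition cpt s (t : R) : C := s%:C * cexp (twopii * t%:C).

Lemma cmod_cpt s t : 0 <= s -> cmod (cpt s t) = s.
Proof.
move=> s0; rewrite /cpt cmodM cmodR cmod_cexp Re_mul /= !mul0r mulr0 subrr expR0 mulr1.
exact: ger0_norm.
Qed.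

(** The integral of f(z) dz / (2 pi i z) over the circle of radius [s]. *)
Definition circ f s := mean (fun t => f (cpt s t)).

Definition bcirc f s := exists M : R, forall z, cmod z = s -> cmod (f z) <= M.

Lemma bcirc_b01 f s : 0 <= s -> bcirc f s -> bounded01 (fun t => f (cpt s t)).
Proof. by move=> s0 [M fM]; exists M => t _; apply: fM; exact: cmod_cpt. Qed.

Lemma bcircD f g s : bcirc f s -> bcirc g s -> bcirc (fun z => f z + g z) s.
Proof.
move=> [M fM] [N gN]; exists (M + N) => z zs.
by rewrite (le_trans (cmodD _ _)) // lerD ?fM ?gN.
Qed.

Lemma bcircM f g s : bcirc f s -> bcirc g s -> bcirc (fun z => f z * g z) s.
Proof.
move=> [M fM] [N gN]; exists (M * N) => z zs.
by rewrite cmodM ler_pM ?cmod_ge0 ?fM ?gN.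
Qed.

Lemma bcirc_cst c s : bcirc (fun=> c) s.
Proof. by exists (cmod c). Qed.

Lemma bcircN f s : bcirc f s -> bcirc (fun z => - f z) s.
Proof. by move=> [M fM]; exists M => z zs; rewrite cmodN fM. Qed.

Lemma bcirc_id s : bcirc id s.
Proof. by exists s => z ->. Qed.

Lemma kernel_ge x z s : cmod z = s -> s - cmod x <= cmod (z - x).
Proof. by move=> <-; exact: lerB_cmod. Qed.

Lemma bcirc_ker x s : cmod x < s -> bcirc (fun z => (z - x)^-1) s.
Proof.
move=> xs; exists (s - cmod x)^-1 => z zs; rewrite cmodV.
have h := kernel_ge x zs; have h0 : 0 < s - cmod x by rewrite subr_gt0.
by rewrite lef_pV2 // posrE // (lt_le_trans h0).
Qed.

Lemma circD f g s : 0 <= s -> bcirc f s -> bcirc g s ->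
  circ (fun z => f z + g z) s = circ f s + circ g s.
Proof. by move=> s0 bf bg; rewrite /circ meanD //; exact: bcirc_b01. Qed.

Lemma circB f g s : 0 <= s -> bcirc f s -> bcirc g s ->
  circ (fun z => f z - g z) s = circ f s - circ g s.
Proof. by move=> s0 bf bg; rewrite /circ meanB //; exact: bcirc_b01. Qed.

Lemma circZ c f s : 0 <= s -> bcirc f s -> circ (fun z => c * f z) s = c * circ f s.
Proof. by move=> s0 bf; rewrite /circ meanZ //; exact: bcirc_b01. Qed.

Lemma circ_cst c s : circ (fun=> c) s = c.
Proof. exact: mean_cst. Qed.

Lemma circ_bound f s (M : R) : 0 <= s -> (forall z, cmod z = s -> cmod (f z) <= M) ->
  cmod (circ f s) <= 2 * M.
Proof. by move=> s0 fM; apply: mean_bound => t _; apply: fM; exact: cmod_cpt. Qed.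

Lemma eq_circ f g s : 0 <= s -> (forall z, cmod z = s -> f z = g z) -> circ f s = circ g s.
Proof.
by move=> s0 fg; rewrite /circ; congr mean; apply/funext => t; apply: fg; exact: cmod_cpt.
Qed.

Lemma cpt_cvg s (t : R) : ccvg (filter_prod (nbhs s) (nbhs t)) (fun p => cpt p.1 p.2) (cpt s t).
Proof.
have c1 : ccvg (filter_prod (nbhs s) (nbhs t)) (fun p : R * R => p.1%:C) s%:C.
  by move=> e e0; exact: (cvg_fst (rcont_real s e0)).
have c2 : ccvg (filter_prod (nbhs s) (nbhs t)) (fun p : R * R => p.2%:C) t%:C.
  by move=> e e0; exact: (cvg_snd (rcont_real t e0)).
apply: ccvgM => //; apply: (@ccvg_comp _ _ _ _ (fun p : R * R => twopii * p.2%:C)).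
  by apply: ccvgM => //; exact: ccvg_cst.
exact: cder_cont (cexp_der _).
Qed.

Lemma rcont_circ f s : (forall z, cmod z = s -> ccont f z) -> 0 <= s ->
  forall t, rcont (fun t => f (cpt s t)) t.
Proof.
move=> cf s0 t; apply: (@ccvg_comp _ _ _ _ (cpt s)); last by apply: cf; exact: cmod_cpt.
move=> e e0; have [[U V] /= [sU tV] UV] := cpt_cvg s t e0.
by apply: filterS tV => t' Vt'; apply: (UV (s, t')); split=> //=; exact: nbhs_singleton.
Qed.

Lemma bcirc_cont f s : 0 <= s -> (forall z, cmod z = s -> ccont f z) -> bcirc f s.
Proof.
move=> s0 cf; have [|M H] := @rcont_bounded01 _ (fun t => f (cpt s t)).
  by move=> t _; exact: rcont_circ.
exists M => z zs; have [s00|sn0] := eqVneq s 0.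
  have -> : z = cpt s 0 by rewrite /cpt s00 rmorph0 mul0r; apply/eqP; rewrite -cmod_eq0 zs s00.
  by apply: H; exact: in01_0.
have zs0 : z / s%:C != 0 by rewrite mulf_neq0 // ?invr_eq0 ?fmorph_eq0 // -cmod_eq0 zs.
have [u uE] := cexp_surj zs0.
have u0 : Re u = 0.
  by apply: expR_inj; rewrite -cmod_cexp uE cmodM cmodV cmodR ger0_norm // zs divff // expR0.
have p0 : 0 < 2 * pi :> R by rewrite mulr_gt0 // pi_gt0.
have [k /andP[k1 k2]] := window (Im u - pi) p0.
pose t := (Im u + 2 * pi * k%:~R) / (2 * pi).
have -> : z = cpt s t.
  rewrite /cpt (_ : twopii * t%:C = u + twopii *~ k); last first.
    apply: complex_ext; rewrite ?(Re_add, Im_add) ?Re_mulz ?Im_mulz ?Re_mul ?Im_mul /= ?u0; first by ring.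
    by rewrite mul0r add0r /t mulrC divfK // gt_eqF.
  by rewrite cexp_per uE mulrC divfK // fmorph_eq0.
apply: H; rewrite /in01 /t ler_pdivlMr // mul0r ler_pdivrMr // mul1r.
by apply/andP; split; lra.
Qed.

(** In the logarithmic coordinate the annulus is a rectangle. Its two horizontal sides cancel by
    periodicity, and its vertical sides are the two circles. *)
Lemma circ_indep0 f s s' : 0 < s -> s <= s' ->
  (forall z, s <= cmod z <= s' -> exists d, cder f z d) -> circ f s = circ f s'.
Proof.
move=> s0 ss df; have s'0 : 0 < s' := lt_le_trans s0 ss.
pose g z := f (cexp z); pose w1 : C := (ln s' - ln s)%:C.
have lss : ln s <= ln s' by rewrite ler_ln ?posrE.
have dg u : in_para (ln s)%:C w1 twopii u -> exists d, cder g u d.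
  move=> [a [b [/andP[a0 a1] _ uE]]].
  have Ru : Re u = ln s + (ln s' - ln s) * a.
    by rewrite uE !Re_add !Re_mul /= !mul0r mulr0 subrr subr0 addr0.
  have [|d dP] := df (cexp u).
    have h1 : 0 <= (ln s' - ln s) * a by rewrite mulr_ge0 // subr_ge0.
    have h2 : (ln s' - ln s) * a <= ln s' - ln s by rewrite ler_piMr // subr_ge0.
    have e1 : expR (ln s) = s by rewrite lnK ?posrE.
    have e2 : expR (ln s') = s' by rewrite lnK ?posrE.
    rewrite cmod_cexp Ru; apply/andP; split.
      by rewrite -[leLHS]e1 ler_expR lerDl.
    by rewrite -[leRHS]e2 ler_expR; lra.
  by eexists; exact: (cder_comp (cexp_der u) dP).
have := goursat dg; rewrite /para.
have -> : edge g ((ln s)%:C + twopii) w1 = edge g (ln s)%:C w1.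
  rewrite /edge; congr (_ * mean _); apply/funext => t; rewrite /g; congr f.
  by rewrite addrAC -{1}[twopii]mulr1z cexp_per.
have eE (a : R) : 0 < a -> edge g (ln a)%:C twopii = twopii * circ f a.
  move=> a0; rewrite /edge; congr (_ * mean _); apply/funext => t; rewrite /g; congr f.
  rewrite /cpt cexpD; congr (_ * _).
  by apply: complex_ext; rewrite ?Re_cexp ?Im_cexp /= ?cos0 ?sin0 ?mulr1 ?mulr0 // lnK.
have -> : (ln s)%:C + w1 = (ln s')%:C by rewrite /w1 -rmorphD /= subrKC.
rewrite !eE // => h.
have t0 : (twopii : C) != 0.
  by apply/eqP => /(congr1 Im) /eqP; rewrite /= mulf_eq0 pnatr_eq0 /= gt_eqF ?pi_gt0.
apply: (mulfI t0); apply/eqP; rewrite -subr_eq0; apply/eqP; rewrite -oppr0 -h; ring.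
Qed.

(** Compactness of [0, 1] makes the continuity in the radius uniform in the angle. *)
Lemma circ_cont f a b s : a < s < b -> 0 <= a ->
  (forall z, a < cmod z < b -> ccont f z) ->
  forall e : R, 0 < e -> exists2 r : R, 0 < r &
   forall s', `|s' - s| < r -> cmod (circ f s' - circ f s) <= 2 * e.
Proof.
move=> /andP[as_ sb] a0 cf e e0.
have := @segment_compact R 0 1; rewrite compact_near_coveringP.
move=> /(_ R (nbhs s) (fun s' t => cmod (f (cpt s' t) - f (cpt s t)) < e) _) H.
have s0 : 0 < s := le_lt_trans a0 as_.
have {H} : nbhs s [set s' | `[0, 1]%classic `<=` (fun t => cmod (f (cpt s' t) - f (cpt s t)) < e)].
  apply: H => t _; have e2 : 0 < e / 2 by rewrite divr_gt0.
  have cs : cmod (cpt s t) = s by rewrite cmod_cpt // ltW.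
  have cft : ccont f (cpt s t) by apply: cf; rewrite cs as_ sb.
  have [[U V] /= [Us Vt] UV] := @ccvg_comp _ _ _ _ _ _ _ (cpt_cvg s t) cft _ e2.
  exists (V, U); first by split.
  case=> t' s' /= [Vt' Us'].
  have h1 : cmod (f (cpt s' t') - f (cpt s t)) < e / 2 := UV (s', t') (conj Us' Vt').
  have h2 : cmod (f (cpt s t') - f (cpt s t)) < e / 2 := UV (s, t') (conj (nbhs_singleton Us) Vt').
  have -> : f (cpt s' t') - f (cpt s t') = (f (cpt s' t') - f (cpt s t)) - (f (cpt s t') - f (cpt s t)) by ring.
  by rewrite (le_lt_trans (cmodB _ _)) //; lra.
move/nbhsR_norm => [r r0 rP].
exists (Num.min r (Num.min (s - a) (b - s))).
  by rewrite !lt_min r0 !subr_gt0 as_.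
move=> s'; rewrite !lt_min !ltr_norml => /and3P[h1 /andP[h2 _] /andP[_ h3]].
have bc q : a < q -> q < b -> bounded01 (fun t => f (cpt q t)).
  move=> aq qb; apply: rcont_bounded01 => t _; apply: rcont_circ; last by lra.
  by move=> z zq; apply: cf; rewrite zq aq qb.
rewrite /circ -meanB; [|by apply: bc; lra|by apply: bc].
apply: mean_bound => t t01; apply: ltW; apply: rP => //.
by rewrite ltr_norml.
Qed.

(** On the exceptional radii [E] only continuity is known. Each of them splits the annulus in two,
    and [circ_cont] joins the means on both sides. *)
Lemma circ_indep f (E : seq R) a b : 0 <= a ->
  (forall z, a < cmod z < b -> ccont f z) ->
  (forall z, a < cmod z < b -> cmod z \notin E -> exists d, cder f z d) ->
  forall s s', a < s < b -> a < s' < b -> circ f s = circ f s'.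
Proof.
elim: E a b => [|c E IH] a b a0 cf df.
  move=> s s'; wlog ss : s s' / s <= s'.
    move=> H; case: (leP s s') => h h1 h2; first exact: H.
    by apply/esym; apply: H => //; exact: ltW.
  move=> /andP[h1 _] /andP[_ h2]; apply: circ_indep0 => //; first by lra.
  by move=> z /andP[? ?]; apply: df => //; lra.
have [/andP[ac cb]|nc] := boolP (a < c < b); last first.
  apply: (IH a b) => // z zab zE; apply: df => //; rewrite in_cons negb_or zE andbT.
  by apply: contraNneq nc => <-.
suff H s : a < s < b -> circ f s = circ f c by move=> s s' /H -> /H ->.
move=> /andP[as_ sb]; have [-> //|sc] := eqVneq s c.
apply/eqP; rewrite -subr_eq0 -cmod_eq0 eq_le cmod_ge0 andbT.
apply/ler_addgt0Pr => e e0; rewrite add0r.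
have e2 : 0 < e / 2 by rewrite divr_gt0.
have [|r r0 rP] := circ_cont (s := c) _ a0 cf e2; first by rewrite ac.
have fin s' : `|s' - c| < r -> circ f s = circ f s' -> cmod (circ f s - circ f c) <= e.
  by move=> /rP h ->; rewrite (le_trans h) //; lra.
have [lt_sc|lt_cs|/eqP] := ltgtP s c; last by rewrite (negPf sc).
  pose s' := Num.max s (c - r / 2).
  have h1 : s <= s' by rewrite le_max lexx.
  have h2 : c - r / 2 <= s' by rewrite le_max lexx orbT.
  have h3 : s' < c by rewrite gt_max lt_sc /=; lra.
  apply: (fin s'); first by rewrite ltr_norml; lra.
  apply: (IH a c) => //; last 2 first.
  - by rewrite as_.
  - by apply/andP; split; lra.
  - by move=> z /andP[? ?]; apply: cf; lra.
  move=> z /andP[? ?] zE; apply: df; first by lra.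
  by rewrite in_cons negb_or zE andbT lt_eqF.
pose s' := Num.min s (c + r / 2).
have h1 : s' <= s by rewrite ge_min lexx.
have h2 : s' <= c + r / 2 by rewrite ge_min lexx orbT.
have h3 : c < s' by rewrite lt_min lt_cs /=; lra.
apply: (fin s'); first by rewrite ltr_norml; lra.
apply: (IH c b) => //; last 2 first.
- by rewrite lt_cs.
- by apply/andP; split; lra.
- by lra.
- by move=> z /andP[? ?]; apply: cf; lra.
move=> z /andP[? ?] zE; apply: df; first by lra.
by rewrite in_cons negb_or zE andbT gt_eqF.
Qed.

Lemma circ_le_all f s : 0 <= s -> 
  (forall e : R, 0 < e -> cmod (circ f s) <= e) -> circ f s = 0.
Proof.
move=> s0 H; apply/eqP; rewrite -cmod_eq0 eq_le cmod_ge0 andbT.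
by apply/ler_addgt0Pr => e e0; rewrite add0r H.
Qed.

Definition hol f (r : R) := forall z, cmod z < r -> exists d, cder f z d.

Lemma hol_ccont f r z : hol f r -> cmod z < r -> ccont f z.
Proof. by move=> hf /hf [d /cder_cont]. Qed.

Lemma hol_le f r r' : r' <= r -> hol f r -> hol f r'.
Proof. by move=> rr hf z zr; apply: hf; exact: lt_le_trans rr. Qed.

Lemma hol_cst (c : C) r : hol (fun=> c) r.
Proof. by move=> z _; exists 0; exact: cder_cst. Qed.

Lemma hol_id r : hol id r.
Proof. by move=> z _; exists 1; exact: cder_id. Qed.

Lemma holD f g r : hol f r -> hol g r -> hol (fun z => f z + g z) r.
Proof. move=> hf hg z zr; have [d dP] := hf z zr; have [d' dP'] := hg z zr.
by exists (d + d'); exact: cderD. Qed.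

Lemma holM f g r : hol f r -> hol g r -> hol (fun z => f z * g z) r.
Proof. move=> hf hg z zr; have [d dP] := hf z zr; have [d' dP'] := hg z zr.
by exists (d * g z + f z * d'); exact: cderM. Qed.

Lemma holB f g r : hol f r -> hol g r -> hol (fun z => f z - g z) r.
Proof. move=> hf hg z zr; have [d dP] := hf z zr; have [d' dP'] := hg z zr.
by exists (d - d'); exact: cderB. Qed.

Lemma ker_der x z : z != x -> exists d, cder (fun y => (y - x)^-1) z d.
Proof.
move=> zx; have h : cder (fun y => y - x) z (1 - 0).
  by apply: cderB; [exact: cder_id | exact: cder_cst].
by eexists; apply: (cderV _ h); rewrite subr_eq0.
Qed.

(** As z / (z - x) = 1 + x / (z - x), it remains to see that the mean of the second term,
    independent of the radius, tends to 0 as the radius grows. *)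
Lemma circ_ker x s : cmod x < s -> circ (fun z => z / (z - x)) s = 1.
Proof.
move=> xs; have s0 : 0 < s := le_lt_trans (cmod_ge0 x) xs.
have bk : bcirc (fun z => x * (z - x)^-1) s by apply: bcircM; [exact: bcirc_cst | exact: bcirc_ker].
have -> : circ (fun z => z / (z - x)) s = circ (fun z => 1 + x * (z - x)^-1) s.
  apply: eq_circ; first exact: ltW.
  move=> z zs; have zx : z - x != 0.
    by rewrite -cmod_gt0 (lt_le_trans _ (kernel_ge x zs)) // subr_gt0.
  by field.
rewrite circD ?circ_cst ?ltW //; last exact: bcirc_cst.
rewrite (_ : circ _ s = 0) ?addr0 //; apply: circ_le_all; first exact: ltW.
move=> e e0; pose s' := Num.max (s + 1) (cmod x + 2 * cmod x / e + 1).
have h1 : s + 1 <= s' by rewrite le_max lexx.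
have h2 : cmod x + 2 * cmod x / e + 1 <= s' by rewrite le_max lexx orbT.
have x0 := cmod_ge0 x; have xe0 : 0 <= 2 * cmod x / e by rewrite !mulr_ge0 // invr_ge0 ltW.
have -> : circ (fun z => x * (z - x)^-1) s = circ (fun z => x * (z - x)^-1) s'.
  have dk z : cmod x < cmod z < s' + 1 -> exists d, cder (fun z => x * (z - x)^-1) z d.
    move=> /andP[xz _]; have [|d dP] := @ker_der x z; last by eexists; exact: cderZ dP.
    by apply: contraTneq xz => ->; rewrite ltxx.
  apply: (circ_indep (E := [::]) (a := cmod x) (b := s' + 1)) => //.
  - by move=> z /dk [d /cder_cont].
  - by move=> z /dk.
  - by rewrite xs; lra.
  - by apply/andP; split; lra.
have s'0 : 0 <= s' by lra.
have d0 : 0 < s' - cmod x by lra.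
apply: (le_trans (circ_bound (M := cmod x / (s' - cmod x)) s'0 _)).
  move=> z zs; rewrite cmodM cmodV ler_wpM2l //.
  have := kernel_ge x zs => h; rewrite lef_pV2 // posrE; lra.
rewrite mulrA ler_pdivrMr // -ler_pdivrMl // [e^-1 * _]mulrC; lra.
Qed.

(** The function z (f z - f x) / (z - x) extends continuously to [x], so its mean does not change
    when the radius crosses [cmod x]. It tends to 0 with the radius, thanks to the factor z and the
    boundedness of [f] near 0. *)
Lemma cauchy_punct f r x s :
  (forall z, 0 < cmod z < r -> exists d, cder f z d) ->
  (exists M d : R, 0 < d /\ forall z, 0 < cmod z < d -> cmod (f z) <= M) ->
  0 < cmod x -> cmod x < s -> s < r ->
  f x = circ (fun z => f z * (z / (z - x))) s.
Proof.
move=> df [M [d0 [d00 fM]]] x0 xs sr.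
have [|d [phi [cphi phix fE]]] := df x; first by rewrite x0 (lt_trans xs sr).
have cf z : 0 < cmod z < r -> ccont f z by move=> /df [e /cder_cont].
have s0 : 0 < s := lt_trans x0 xs.
pose h z := phi z * z.
have hE z : z != x -> h z = (f z - f x) / (z - x) * z.
  move=> zx; have zx0 : z - x != 0 by rewrite subr_eq0.
  by rewrite /h fE; field.
have near_neq z : z != x -> cnbhs z [set y | h y = (f y - f x) * (y - x)^-1 * y].
  move=> zx; exists (cmod (z - x)); first by rewrite cmod_gt0 subr_eq0.
  by move=> y yz; apply: hE; apply: contraTneq yz => ->; rewrite cmodBC ltxx.
have dh z : 0 < cmod z < r -> z != x -> (exists d, cder f z d) -> exists d, cder h z d.
  move=> zr zx [e eP]; have [k kP] := ker_der zx; eexists.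
  apply: (@cder_near _ (fun y => (f y - f x) * (y - x)^-1 * y)).
    by apply: filterS (near_neq _ zx) => y /= ->.
  apply: cderM; last exact: cder_id.
  by apply: cderM kP; apply: cderB; [exact: eP | exact: cder_cst].
have ch z : 0 < cmod z < r -> ccont h z.
  move=> zr; have [->|zx] := eqVneq z x; first by apply: ccvgM; [exact: cphi | exact: ccvg_id].
  have [k kP] := ker_der zx.
  rewrite /ccont hE //; apply: (@ccvg_eq _ _ _ _ (fun y => (f y - f x) * (y - x)^-1 * y)).
    by apply: filterS (near_neq _ zx) => y /= ->.
  apply: ccvgM; last exact: ccvg_id.
  apply: ccvgM; last exact: cder_cont kP.
  by apply: ccvgB; [exact: cf | exact: ccvg_cst].
have h0 : circ h s = 0.
  apply: circ_le_all; first exact: ltW.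
  move=> e e0.
  pose K := (`|M| + cmod (f x)) * 2 / cmod x; have K0 : 0 <= K.
    by rewrite mulr_ge0 ?invr_ge0 ?cmod_ge0 // mulr_ge0 // addr_ge0 ?cmod_ge0.
  pose s' := Num.min (Num.min s (d0 / 2)) (Num.min (cmod x / 2) (e / (2 * K + 1))).
  have K1 : 0 < 2 * K + 1 by lra.
  have s'0 : 0 < s' by rewrite !lt_min s0 !divr_gt0.
  have [q1 [q2 [q3 q4]]] : s' <= s /\ s' <= d0 / 2 /\ s' <= cmod x / 2 /\ s' <= e / (2 * K + 1).
    by rewrite !ge_min !lexx /= !orbT.
  have -> : circ h s = circ h s'.
   apply: (@circ_indep h [:: cmod x] 0 r) => //; last 2 first.
   - by rewrite s0.
   - by rewrite s'0 (le_lt_trans q1 sr).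
   move=> z zr; rewrite inE => zx; apply: dh => //; last exact: df.
   by apply: contraNneq zx => ->.
  apply: (le_trans (circ_bound (M := K * s') (ltW s'0) _)).
    move=> z zs; have zx : z != x.
      apply/eqP => zx; have : cmod x = s' by rewrite -zx.
      by lra.
    rewrite hE // !cmodM cmodV zs (ler_wpM2r (ltW s'0)) //.
    rewrite /K -mulrA ler_pM ?invr_ge0 ?cmod_ge0 //.
      rewrite (le_trans (cmodB _ _)) // lerD2r (le_trans _ (ler_norm M)) // fM // zs s'0 /=; lra.
    have := lerB_cmod x z; rewrite cmodBC zs => h1.
    have -> : 2 / cmod x = (cmod x / 2)^-1 by field; rewrite gt_eqF.
    rewrite lef_pV2 ?posrE ?divr_gt0 //; lra.
  have : s' * (2 * K + 1) <= e by rewrite -ler_pdivlMr.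
  lra.
have bk : bcirc (fun z => z / (z - x)) s.
  by apply: bcircM; [exact: bcirc_id | exact: bcirc_ker].
have bf : bcirc f s by apply: bcirc_cont; [exact: ltW | move=> z zs; apply: cf; rewrite zs s0].
have := circB (ltW s0) (bcircM bf bk) (bcircM (bcirc_cst (f x) s) bk).
rewrite circZ ?ltW // circ_ker // mulr1.
have -> : circ (fun z => f z * (z / (z - x)) - f x * (z / (z - x))) s = circ h s.
  apply: eq_circ; first exact: ltW.
  move=> z zs; have zx : z != x by apply: contraTneq xs => <-; rewrite zs ltxx.
  by rewrite hE //; ring.
by rewrite h0 => /esym/eqP; rewrite subr_eq0 => /eqP.
Qed.

Lemma circ_center f r s : hol f r -> 0 < s < r -> circ f s = f 0.
Proof.
move=> hf /andP[s0 sr]; apply/eqP; rewrite -subr_eq0 -cmod_eq0 eq_le cmod_ge0 andbT.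
apply/ler_addgt0Pr => e e0; rewrite add0r; have e2 : 0 < e / 2 by rewrite divr_gt0.
have f0 : ccont f 0 by apply: (hol_ccont hf); rewrite cmod0; lra.
have [d d0 dP] := f0 _ e2.
pose s' := Num.min s (d / 2).
have [h1 h2] : s' <= s /\ s' <= d / 2 by rewrite !ge_min !lexx orbT.
have s'0 : 0 < s' by rewrite lt_min s0 divr_gt0.
have -> : circ f s = circ f s'.
  apply: (@circ_indep f [::] 0 r) => //.
  - by move=> z /andP[_ zr]; exact: hol_ccont hf zr.
  - by move=> z /andP[_ zr] _; exact: hf.
  - by rewrite s0.
  - by rewrite s'0; lra.
have bf : bcirc f s'.
  by apply: bcirc_cont; [exact: ltW | move=> z zs; apply: (hol_ccont hf); lra].
rewrite -{1}(circ_cst (f 0) s') -circB //; [|exact: ltW|exact: bcirc_cst].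
rewrite (le_trans (circ_bound (M := e / 2) (ltW s'0) _)) //; last by lra.
by move=> z zs; apply: ltW; apply: dP; rewrite subr0 zs; lra.
Qed.

Lemma cauchy_formula f r x s : hol f r -> cmod x < s -> s < r ->
  f x = circ (fun z => f z * (z / (z - x))) s.
Proof.
move=> hf xs sr; have s0 : 0 < s := le_lt_trans (cmod_ge0 x) xs.
have [->|x0] := eqVneq x 0.
  rewrite -(circ_center (s := s) hf) ?s0 //; apply: eq_circ; first exact: ltW.
  move=> z zs; have z0 : z != 0 by rewrite -cmod_gt0 zs.
  by rewrite subr0 divff // mulr1.
apply: (cauchy_punct (r := r)) => //.
- by move=> z /andP[_ zr]; exact: hf.
- have f0 : ccont f 0 by apply: (hol_ccont hf); rewrite cmod0; lra.
  have [d d0 dP] := f0 1 ltr01; exists (cmod (f 0) + 1), d; split=> // z /andP[_ zd].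
  have := cmodD (f z - f 0) (f 0); rewrite subrK.
  have : cmod (f z - f 0) < 1 by apply: dP; rewrite subr0.
  by lra.
- by rewrite cmod_gt0.
Qed.
End Circle.

(** * Cauchy's kernels and their derivatives *)

Section Kernels.
Context {R : realType}.
Local Notation C := R[i].
Local Notation Re := (@complex.Re R).
Local Notation Im := (@complex.Im R).
Implicit Types (z w u v x : C) (f g : C -> C) (s r : R).

(* Cauchy's integrals for [g], [g'] and [g'']; as [circ] is the mean over the circle,
   the kernels carry an additional factor [z]. *)
Definition K1 g s x := circ (fun z => g z * (z / (z - x))) s.
Definition K2 g s x := circ (fun z => g z * (z / (z - x) ^+ 2)) s.
Definition K3 g s x := circ (fun z => g z * (2 * z / (z - x) ^+ 3)) s.

Lemma bker1 x s : cmod x < s -> bcirc (fun z => z / (z - x)) s.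
Proof. by move=> xs; apply: bcircM; [exact: bcirc_id | exact: bcirc_ker]. Qed.

Lemma bker2 x s : cmod x < s -> bcirc (fun z => z / (z - x) ^+ 2) s.
Proof.
move=> xs; rewrite (_ : (fun z => _) = fun z => z / (z - x) * (z - x)^-1).
  by apply: bcircM; [exact: bker1 | exact: bcirc_ker].
by apply/funext => z; rewrite expr2 invfM mulrA.
Qed.

Lemma bker3 x s : cmod x < s -> bcirc (fun z => 2 * z / (z - x) ^+ 3) s.
Proof.
move=> xs; rewrite (_ : (fun z => _) = fun z => 2 * (z / (z - x) ^+ 2 * (z - x)^-1)).
  apply: bcircM; first exact: bcirc_cst.
  by apply: bcircM; [exact: bker2 | exact: bcirc_ker].
by apply/funext => z; rewrite exprSr invfM !mulrA.
Qed.

Lemma circ_lin3 f g h (d : C) s : 0 <= s -> bcirc f s -> bcirc g s -> bcirc h s ->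
  circ f s - circ g s - circ h s * d = circ (fun z => f z - g z - h z * d) s.
Proof.
move=> s0 bf bg bh; rewrite !circB //; last 2 first.
- by apply: bcircD => //; exact: bcircN.
- by apply: bcircM => //; exact: bcirc_cst.
congr (_ - _); rewrite mulrC -circZ //; apply: eq_circ => // z _; exact: mulrC.
Qed.

(** In the disc of radius 3/4 s, points stay at distance at least s / 4 from the circle; the powers
    of 4 / s below come from here. *)
Lemma ker_ge x z s : cmod z = s -> cmod x <= 3 / 4 * s -> s / 4 <= cmod (z - x).
Proof. by move=> zs xs; have := kernel_ge x zs; lra. Qed.

Lemma ker_neq x z s : 0 < s -> cmod z = s -> cmod x <= 3 / 4 * s -> z - x != 0.
Proof.
by move=> s0 zs xs; rewrite -cmod_gt0 (lt_le_trans _ (ker_ge zs xs)) // divr_gt0.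
Qed.

Lemma kerV_le x z s : 0 < s -> cmod z = s -> cmod x <= 3 / 4 * s -> cmod (z - x)^-1 <= 4 / s.
Proof.
move=> s0 zs xs; rewrite cmodV; have h := ker_ge zs xs.
have -> : 4 / s = (s / 4)^-1 by field; rewrite gt_eqF.
by rewrite lef_pV2 // posrE ?divr_gt0 // (lt_le_trans _ h) // divr_gt0.
Qed.

Variables (g : C -> C) (s M : R).
Hypothesis s0 : 0 < s.
Hypothesis gM : forall z, cmod z = s -> cmod (g z) <= M.

Let bg : bcirc g s. Proof. by exists M. Qed.

Let M0 : 0 <= M.
Proof. by apply: (le_trans (cmod_ge0 (g (cpt s 0)))); apply: gM; rewrite cmod_cpt // ltW. Qed.

Let s34 (x : C) : cmod x <= 3 / 4 * s -> cmod x < s.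
Proof. by move=> xs; move: s0 => h0; lra. Qed.

Lemma K1_bound x : cmod x <= 3 / 4 * s -> cmod (K1 g s x) <= 8 * M.
Proof.
move=> xs; have -> : 8 * M = 2 * (4 * M) by ring.
apply: circ_bound; first exact: ltW.
move=> z zs; rewrite !cmodM zs.
have h : s * cmod (z - x)^-1 <= 4.
  have := kerV_le s0 zs xs => h; rewrite (le_trans (ler_wpM2l (ltW s0) h)) //.
  by rewrite mulrC divfK // gt_eqF.
by rewrite mulrC ler_pM ?cmod_ge0 ?gM // mulr_ge0 ?cmod_ge0 // ltW.
Qed.

Lemma K2_bound x : cmod x <= 3 / 4 * s -> cmod (K2 g s x) <= 32 * M / s.
Proof.
move=> xs; have -> : 32 * M / s = 2 * (M * (s * (4 / s) ^+ 2)) by field; rewrite gt_eqF.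
apply: circ_bound; first exact: ltW.
move=> z zs; rewrite -exprVn !(cmodX, cmodM) zs.
apply: ler_pM; [exact: cmod_ge0| |exact: gM|].
  by rewrite mulr_ge0 ?exprn_ge0 ?cmod_ge0 // ltW.
apply: ler_wpM2l; first exact: ltW.
by apply: lerXn2r; rewrite ?nnegrE ?cmod_ge0 ?divr_ge0 ?(ltW s0) ?kerV_le.
Qed.

(** The second-order remainder of the kernel is a product of three inverses, each at most 4 / s;
    with the factor 2 of [circ_bound] this gives 128. *)
Lemma K1_diff x x0 : cmod x <= 3 / 4 * s -> cmod x0 <= 3 / 4 * s ->
  cmod (K1 g s x - K1 g s x0 - K2 g s x0 * (x - x0)) <= 128 * M / s ^+ 2 * cmod (x - x0) ^+ 2.
Proof.
move=> xs x0s; rewrite /K1 /K2 circ_lin3; last 4 first.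
- exact: ltW.
- by apply: bcircM => //; apply: bker1; exact: s34.
- by apply: bcircM => //; apply: bker1; exact: s34.
- by apply: bcircM => //; apply: bker2; exact: s34.
have -> : 128 * M / s ^+ 2 * cmod (x - x0) ^+ 2 =
    2 * (M * (s * ((4 / s) ^+ 3 * cmod (x - x0) ^+ 2))) by field; rewrite gt_eqF.
apply: circ_bound; first exact: ltW.
move=> z zs; have n1 := ker_neq s0 zs xs; have n2 := ker_neq s0 zs x0s.
have -> : g z * (z / (z - x)) - g z * (z / (z - x0)) - g z * (z / (z - x0) ^+ 2) * (x - x0) =
   g z * (z * ((z - x)^-1 * (z - x0)^-1 ^+ 2 * (x - x0) ^+ 2)).
  by field; rewrite n1 n2.
rewrite !(cmodX, cmodM) zs; have h1 := kerV_le s0 zs xs; have h2 := kerV_le s0 zs x0s.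
have p0 : 0 <= 4 / s by rewrite divr_ge0 // ltW.
apply: ler_pM; [exact: cmod_ge0| |exact: gM|].
  by rewrite !mulr_ge0 ?exprn_ge0 ?cmod_ge0 // ltW.
apply: ler_wpM2l; first exact: ltW.
apply: ler_wpM2r; first by rewrite exprn_ge0 ?cmod_ge0.
rewrite (exprS (4 / s)); apply: ler_pM => //; rewrite ?exprn_ge0 ?cmod_ge0 //.
by apply: lerXn2r; rewrite ?nnegrE ?cmod_ge0.
Qed.

Lemma K2_diff x x0 : cmod x <= 3 / 4 * s -> cmod x0 <= 3 / 4 * s ->
  cmod (K2 g s x - K2 g s x0 - K3 g s x0 * (x - x0)) <= 1536 * M / s ^+ 3 * cmod (x - x0) ^+ 2.
Proof.
move=> xs x0s; rewrite /K2 /K3 circ_lin3; last 4 first.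
- exact: ltW.
- by apply: bcircM => //; apply: bker2; exact: s34.
- by apply: bcircM => //; apply: bker2; exact: s34.
- by apply: bcircM => //; apply: bker3; exact: s34.
have -> : 1536 * M / s ^+ 3 * cmod (x - x0) ^+ 2 =
    2 * (M * (s * ((4 / s * (4 / s) ^+ 2 * (3 * (4 / s))) * cmod (x - x0) ^+ 2))).
  by field; rewrite gt_eqF.
apply: circ_bound; first exact: ltW.
move=> z zs; have n1 := ker_neq s0 zs xs; have n2 := ker_neq s0 zs x0s.
have -> : g z * (z / (z - x) ^+ 2) - g z * (z / (z - x0) ^+ 2) -
     g z * (2 * z / (z - x0) ^+ 3) * (x - x0) =
   g z * (z * (((z - x)^-1 * (z - x0)^-1 ^+ 2 * ((z - x)^-1 + 2 * (z - x0)^-1)) * (x - x0) ^+ 2)).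
  by field; rewrite n1 n2.
rewrite !(cmodX, cmodM) zs; have h1 := kerV_le s0 zs xs; have h2 := kerV_le s0 zs x0s.
have p0 : 0 <= 4 / s by rewrite divr_ge0 // ltW.
apply: ler_pM; [exact: cmod_ge0| |exact: gM|].
  by rewrite !mulr_ge0 ?exprn_ge0 ?cmod_ge0 // ltW.
apply: ler_wpM2l; first exact: ltW.
apply: ler_wpM2r; first by rewrite exprn_ge0 ?cmod_ge0.
apply: ler_pM; rewrite ?mulr_ge0 ?exprn_ge0 ?cmod_ge0 //.
  apply: ler_pM => //; rewrite ?exprn_ge0 ?cmod_ge0 //.
  by apply: lerXn2r; rewrite ?nnegrE ?cmod_ge0.
rewrite (le_trans (cmodD _ _)) // cmodM.
have -> : cmod (2 : C) = 2.
  by rewrite -(rmorph_nat (real_complex R)) cmodR ger0_norm.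
by move: h1 h2; move: (cmod _) (cmod _) (4 / s) => a b c; lra.
Qed.

Let margin (x : C) : cmod x < 3 / 4 * s -> exists2 r : R, 0 < r &
  forall y, cmod (y - x) < r -> cmod y <= 3 / 4 * s.
Proof.
move=> xs; exists (3 / 4 * s - cmod x); first by rewrite subr_gt0.
move=> y yx; have := cmodD (y - x) x; rewrite subrK => h.
by move: yx h; move: (cmod _) (cmod _) (cmod _) => a b c; lra.
Qed.

Lemma K1_der x : cmod x < 3 / 4 * s -> cder (K1 g s) x (K2 g s x).
Proof.
move=> xs; have [r r0 rP] := margin xs; apply: (cder_sq r0) => y yx.
by apply: K1_diff; [exact: rP | exact: ltW].
Qed.

Lemma K2_der x : cmod x < 3 / 4 * s -> cder (K2 g s) x (K3 g s x).
Proof.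
move=> xs; have [r r0 rP] := margin xs; apply: (cder_sq r0) => y yx.
by apply: K2_diff; [exact: rP | exact: ltW].
Qed.
End Kernels.

(** * Cauchy estimates, removable singularities and the identity theorem *)

Section Holomorphic.
Context {R : realType}.
Local Notation C := R[i].
Local Notation Re := (@complex.Re R).
Local Notation Im := (@complex.Im R).
Implicit Types (z w u v x : C) (f g : C -> C) (s r : R).

Definition cd f x : C := xget 0 [set d | cder f x d].

Lemma cdP f x d : cder f x d -> cd f x = d.
Proof.
by move=> fd; apply: (cder_uniq (f := f) (x := x)) => //; rewrite /cd; apply: (xgetPex 0); exists d.
Qed.

Lemma hol_cd f r x : hol f r -> cmod x < r -> cder f x (cd f x).
Proof. by move=> hf /hf [d dP]; rewrite (cdP dP). Qed.

Lemma bcirc_hol f r s : hol f r -> 0 < s < r ->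
  exists M : R, forall z, cmod z = s -> cmod (f z) <= M.
Proof.
move=> hf /andP[s0 sr]; apply: bcirc_cont; first exact: ltW.
by move=> z zs; apply: (hol_ccont hf); rewrite zs.
Qed.

Lemma cd_K2 f r s x : hol f r -> 0 < s < r -> cmod x < 3 / 4 * s -> cd f x = K2 f s x.
Proof.
move=> hf /andP[s0 sr] xs; have [M fM] := bcirc_hol hf (introT andP (conj s0 sr)).
apply: cdP; apply: (@cder_near _ (K1 f s)); last exact: (K1_der s0 fM).
exists (s - cmod x); first by move: xs s0; lra.
move=> y yx; rewrite /= /K1 -(cauchy_formula (r := r) hf) //.
exact: cmod_near yx.
Qed.

Lemma hol_bound f r s (M : R) x : hol f r -> 0 < s < r ->
  (forall z, cmod z = s -> cmod (f z) <= M) -> cmod x <= 3 / 4 * s -> cmod (f x) <= 8 * M.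
Proof.
move=> hf /andP[s0 sr] fM xs; rewrite (cauchy_formula (r := r) (s := s) hf) //; last first.
  by move: xs s0; lra.
exact: K1_bound.
Qed.

Lemma cd_bound f r s (M : R) x : hol f r -> 0 < s < r ->
  (forall z, cmod z = s -> cmod (f z) <= M) -> cmod x < 3 / 4 * s ->
  cmod (cd f x) <= 32 * M / s.
Proof.
by move=> hf sr fM xs; rewrite (cd_K2 hf sr xs); apply: K2_bound => //; [case/andP: sr|exact: ltW].
Qed.

Lemma hol_cd_hol f r : 0 < r -> hol f r -> hol (cd f) (r / 2).
Proof.
(* With this radius, [K2_der] applies on the disc of radius 9/16 r, which contains that of radius r
   / 2. *)
move=> r0 hf x xr; pose s := 3 / 4 * r; have sr : 0 < s < r by rewrite /s; apply/andP; split; lra.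
have xs : cmod x < 3 / 4 * s by rewrite /s; lra.
have [M fM] := bcirc_hol hf sr.
exists (K3 f s x); apply: (@cder_near _ (K2 f s)); last exact: (K2_der (proj1 (andP sr)) fM xs).
exists (3 / 4 * s - cmod x); first by rewrite subr_gt0.
move=> y yx; rewrite /= -(cd_K2 hf) //.
exact: cmod_near yx.
Qed.

Lemma dense_off f g z : ccont f z -> ccont g z ->
  (forall e : R, 0 < e -> exists y, cmod (y - z) < e /\ f y = g y) -> f z = g z.
Proof.
move=> cf cg H; apply/eqP; rewrite -subr_eq0 -cmod_eq0 eq_le cmod_ge0 andbT.
apply/ler_addgt0Pr => e e0; rewrite add0r; have e2 : 0 < e / 2 by rewrite divr_gt0.
have [r1 r10 H1] := cf _ e2; have [r2 r20 H2] := cg _ e2.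
have [|y [yz fg]] := H (Num.min r1 r2); first by rewrite lt_min r10.
move: yz; rewrite lt_min => /andP[/H1 /= h1 /H2 /= h2].
have -> : f z - g z = (g y - g z) - (f y - f z) by rewrite fg; ring.
by rewrite (le_trans (cmodB _ _)) //; lra.
Qed.

Lemma removable f r s : 0 < s < r ->
  (forall z, 0 < cmod z < r -> exists d, cder f z d) ->
  (exists M d : R, 0 < d /\ forall z, 0 < cmod z < d -> cmod (f z) <= M) ->
  hol (K1 f s) (3 / 4 * s) /\ (forall z, z != 0 -> cmod z < 3 / 4 * s -> f z = K1 f s z).
Proof.
move=> /andP[s0 sr] df bf.
have [M fM] : bcirc f s.
  apply: bcirc_cont; first exact: ltW.
  by move=> z zs; have [|d /cder_cont] := df z; rewrite ?zs ?s0.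
split=> [x xs|z z0 zs]; first by exists (K2 f s x); exact: (K1_der s0 fM).
by apply: (cauchy_punct (r := r)) => //; rewrite ?cmod_gt0 //; lra.
Qed.

(** A substitute for the three circles theorem: the first [N] Taylor coefficients are read off on
    the small circle, and the remainder, on the large circle, gains 2^-N. If [f] is small enough on
    the small circle compared with (s / sg)^N, it is small at [x]. *)
Lemma taylor_bound f r s sg (Ms Mg : R) x N : hol f r -> 0 < s < r -> 0 < sg <= s ->
  (forall z, cmod z = s -> cmod (f z) <= Ms) ->
  (forall z, cmod z = sg -> cmod (f z) <= Mg) -> cmod x <= s / 2 ->
  cmod (f x) <= N%:R * (s / sg) ^+ N * (2 * Mg) + 4 * 2^-1 ^+ N * Ms.
Proof.
move=> hf /andP[s0 sr] /andP[g0 gs] fMs fMg xs.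
have xs' : cmod x < s by lra.
have z0 (z : C) q : 0 < q -> cmod z = q -> z != 0 by move=> q0 zq; rewrite -cmod_gt0 zq.
have bV k q : 0 < q -> bcirc (fun z => z^-1 ^+ k) q.
  by move=> q0; exists (q^-1 ^+ k) => z zq; rewrite cmodX cmodV zq.
have bf q : 0 < q < r -> bcirc f q by move=> qr; exact: (bcirc_hol hf qr).
have bfs : bcirc f s by apply: bf; rewrite s0.
pose a k := circ (fun z => f z * z^-1 ^+ k) s.
have aE k : a k = circ (fun z => f z * z^-1 ^+ k) sg.
  have dk z : 0 < cmod z < r -> exists d, cder (fun z => f z * z^-1 ^+ k) z d.
    move=> /andP[zz zr]; have [d dP] := hf z zr.
    have zn0 : z != 0 by rewrite -cmod_gt0.
    elim: k => [|k [e IH]].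
      by exists d; apply: cder_near dP; apply: filterE => y /=; rewrite expr0 mulr1.
    have := cderM IH (cderV zn0 (cder_id z)) => h; eexists; apply: cder_near h.
    by apply: filterE => y /=; rewrite -mulrA -exprSr.
  apply: (@circ_indep _ _ [::] 0 r) => //.
  - by move=> z /dk [d /cder_cont].
  - by move=> z /dk.
  - by rewrite s0.
  - by rewrite g0 (le_lt_trans gs).
(* The geometric expansion of Cauchy's kernel, with its exact remainder. *)
have fE : f x = \sum_(k < N) x ^+ k * a k +
    x ^+ N * circ (fun z => f z * z^-1 ^+ N * (z / (z - x))) s.
  elim: N => [|N IH].
    rewrite big_ord0 add0r expr0 mul1r (cauchy_formula (r := r) hf xs') //.
    by apply: eq_circ => [|z _]; [exact: ltW | rewrite expr0 mulr1].
  rewrite IH big_ord_recr /= -addrA; congr (_ + _).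
  rewrite exprSr -[x ^+ N * x * _]mulrA -mulrDr; congr (_ * _).
  rewrite /a -circZ ?(ltW s0) //; last first.
    by apply: bcircM; [apply: bcircM => //; exact: bV | exact: bker1].
  rewrite -circD ?(ltW s0) //; last 2 first.
  - by apply: bcircM => //; exact: bV.
  - apply: bcircM; first exact: bcirc_cst.
    by apply: bcircM; [apply: bcircM => //; exact: bV | exact: bker1].
  apply: eq_circ => [|z zs]; first exact: ltW.
  have zn := z0 z s s0 zs; have zx : z - x != 0.
    by rewrite subr_eq0; apply: contraTneq xs' => <-; rewrite zs ltxx.
  by rewrite exprSr; field; rewrite zn zx.
rewrite fE (le_trans (cmodD _ _)) // lerD //.
  have ba k : cmod (a k) <= 2 * (Mg * sg^-1 ^+ k).
    rewrite aE; apply: circ_bound; first exact: ltW.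
    move=> z zg; rewrite cmodM cmodX cmodV zg.
    by apply: ler_wpM2r; [rewrite exprn_ge0 // invr_ge0 ltW | exact: fMg].
  have Mg0 : 0 <= Mg by apply: (le_trans (cmod_ge0 (f (cpt sg 0)))); apply: fMg; rewrite cmod_cpt // ltW.
  have q1 : 1 <= s / sg by rewrite ler_pdivlMr // mul1r.
  apply: (@le_trans _ _ (\sum_(k < N) (s / sg) ^+ N * (2 * Mg))); last first.
    by rewrite sumr_const card_ord -mulrA [N%:R * _]mulr_natl.
  have cs (I : Type) (l : seq I) (F : I -> C) : cmod (\sum_(i <- l) F i) <= \sum_(i <- l) cmod (F i).
    elim: l => [|i l IH]; rewrite ?big_nil ?cmod0 // !big_cons (le_trans (cmodD _ _)) // lerD2l //.
  rewrite (le_trans (cs _ _ _)) //; apply: ler_sum => k _.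
  rewrite cmodM cmodX (le_trans (ler_wpM2l _ (ba k))) ?exprn_ge0 ?cmod_ge0 //.
  have -> : cmod x ^+ k * (2 * (Mg * sg^-1 ^+ k)) = (cmod x / sg) ^+ k * (2 * Mg).
    by rewrite exprMn; ring.
  apply: ler_wpM2r; first by rewrite mulr_ge0.
  apply: (@le_trans _ _ ((s / sg) ^+ k)); last by rewrite ler_weXn2l // ltnW.
  apply: lerXn2r; rewrite ?nnegrE ?divr_ge0 ?cmod_ge0 ?(ltW s0) ?(ltW g0) //.
  by apply: ler_wpM2r; [rewrite invr_ge0 ltW | lra].
rewrite cmodM cmodX.
have b1 : cmod (circ (fun z => f z * z^-1 ^+ N * (z / (z - x))) s) <= 2 * (Ms * s^-1 ^+ N * 2).
  apply: circ_bound; first exact: ltW.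
  move=> z zs; rewrite !cmodM cmodX cmodV zs.
  have hk : s / cmod (z - x) <= 2.
    have := kernel_ge x zs => h; have hp : 0 < cmod (z - x) by lra.
    by rewrite ler_pdivrMr //; lra.
  apply: ler_pM => //; rewrite ?mulr_ge0 ?exprn_ge0 ?cmod_ge0 ?invr_ge0 ?(ltW s0) ?cmod_ge0 //.
    by apply: ler_wpM2r; [rewrite exprn_ge0 // invr_ge0 ltW | exact: fMs].
  by rewrite cmodV.
have Ms0 : 0 <= Ms by apply: (le_trans (cmod_ge0 (f (cpt s 0)))); apply: fMs; rewrite cmod_cpt // ltW.
rewrite (le_trans (ler_wpM2l _ b1)) ?exprn_ge0 ?cmod_ge0 //.
have -> : cmod x ^+ N * (2 * (Ms * s^-1 ^+ N * 2)) = 4 * (cmod x / s) ^+ N * Ms.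
  by rewrite exprMn; ring.
apply: ler_wpM2r => //; apply: ler_wpM2l => //.
apply: lerXn2r; rewrite ?nnegrE ?divr_ge0 ?cmod_ge0 ?(ltW s0) ?invr_ge0 //.
by rewrite ler_pdivrMr //; lra.
Qed.

(** Take [Mg] = 0 in [taylor_bound] and let N tend to infinity; the radius r / 2 + |x| lies between
    2 |x| and r. *)
Lemma identity_thm f r d x : hol f r -> 0 < d -> (forall z, cmod z < d -> f z = 0) ->
  cmod x < r / 2 -> f x = 0.
Proof.
move=> hf d0 f0 xr; pose s := (r / 2 + cmod x); have x0 := cmod_ge0 x.
have sr : 0 < s < r by rewrite /s; apply/andP; split; lra.
have xs : cmod x <= s / 2 by rewrite /s; lra.
have [M fM] := bcirc_hol hf sr.
have M0 : 0 <= M.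
  by apply: (le_trans (cmod_ge0 (f (cpt s 0)))); apply: fM; rewrite cmod_cpt //; case/andP: sr => /ltW.
pose sg := Num.min s (d / 2).
have gs : 0 < sg <= s by rewrite /sg lt_min ge_min lexx (andP sr).1 divr_gt0.
have gd : sg < d by rewrite /sg gt_min; apply/orP; right; lra.
have fg z : cmod z = sg -> cmod (f z) <= 0 by move=> zg; rewrite f0 ?zg // cmod0.
have H N := taylor_bound N hf sr gs fM fg xs.
apply/eqP; rewrite -cmod_eq0 eq_le cmod_ge0 andbT.
apply/ler_addgt0Pr => e e0; rewrite add0r.
have h2 : `|2^-1 : R| < 1 by rewrite ger0_norm ?invr_ge0 // invf_lt1 // ltr1n.
have := cvg_expr h2 => /cvgr0Pnorm_lt /(_ (e / (4 * M + 1))).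
rewrite divr_gt0 ?ltr_wpDl ?mulr_ge0 // => /(_ isT) [N _ NP].
have := NP N (leqnn N); rewrite /= ger0_norm ?exprn_ge0 ?invr_ge0 //.
rewrite ltr_pdivlMr ?ltr_wpDl ?mulr_ge0 // => hN.
have := H N; rewrite !mulr0 add0r => h; rewrite (le_trans h) // (le_trans _ (ltW hN)) //.
have q0 : 0 <= 2^-1 ^+ N :> R by rewrite exprn_ge0 ?invr_ge0.
by move: q0; move: (2^-1 ^+ N) => q q0; rewrite mulrDr mulr1 mulrA [4 * q]mulrC lerDl.
Qed.
End Holomorphic.

(** * The a priori estimate *)

Section MVT.
Context {R : realType}.
Local Notation C := R[i].
Local Notation Re := (@complex.Re R).
Local Notation Im := (@complex.Im R).
Implicit Types (z w u v x : C) (f g : C -> C) (s r : R).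

Lemma is_derive_real (g : R -> R) (t l : R) :
  (forall e : R, 0 < e -> exists2 r : R, 0 < r &
     forall h, `|h| < r -> `|g (t + h) - g t - l * h| <= e * `|h|) ->
  is_derive t 1 g l.
Proof.
move=> H.
have c : h^-1 *: (g (h *: 1 + t) - g t) @[h --> 0^'] --> l.
  apply/cvgrPdist_le => e e0; have [r r0 rP] := H e e0.
  rewrite near_withinE; apply/nbhs_normP; exists r => // h /=.
  rewrite sub0r normrN => hr h0; have := rP h hr.
  rewrite /GRing.scale /= mulr1 (addrC h) => hh.
  have -> : l - h^-1 * (g (t + h) - g t) = - (g (t + h) - g t - l * h) / h by field.
  by rewrite normrM normrN normfV ler_pdivrMr ?normr_gt0.
by split; [apply/cvg_ex; exists l | exact: cvg_lim c].
Qed.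

(** Here [p] stands for the real or the imaginary part. *)
Lemma is_derive_part (p : C -> R) f (a w d : C) (t : R) :
  (forall z, `|p z| <= cmod z) -> (forall u v, p (u - v) = p u - p v) ->
  (forall (k : R) u, p (u * k%:C) = p u * k) ->
  cder f (a + w * t%:C) d ->
  is_derive t 1 (fun t : R => p (f (a + w * t%:C))) (p (d * w)).
Proof.
move=> pn pB pZ /cderP df; apply: is_derive_real => e e0.
have e'0 : 0 < e / (cmod w + 1) by rewrite divr_gt0 // ltr_wpDl ?cmod_ge0.
have [r r0 rP] := df _ e'0.
have w1 : 0 < cmod w + 1 by rewrite ltr_wpDl ?cmod_ge0.
exists (r / (cmod w + 1)); first by rewrite divr_gt0.
move=> h; rewrite ltr_pdivlMr // => hr; rewrite -pZ -pB -pB.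
have E : a + w * (t + h)%:C - (a + w * t%:C) = w * h%:C by rewrite rmorphD /=; ring.
have hw : `|h| * cmod w <= `|h| * (cmod w + 1) by rewrite ler_wpM2l // lerDl.
have := rP (a + w * (t + h)%:C); rewrite /= E cmodM cmodR mulrA.
rewrite [cmod w * _]mulrC => /(_ (le_lt_trans hw hr)) h1.
rewrite (le_trans (pn _)) // (le_trans h1) //.
have -> : e * `|h| = e / (cmod w + 1) * (`|h| * (cmod w + 1)) by field; rewrite gt_eqF.
by apply: ler_wpM2l => //; exact: ltW.
Qed.

(** The real mean value theorem is applied to both parts of [f] along the segment, whence the factor
    2. *)
Lemma mvt_ineq f (a b : C) (M : R) :
  (forall t, in01 t -> exists2 d, cder f (a + (b - a) * t%:C) d & cmod d <= M) ->
  cmod (f b - f a) <= 2 * M * cmod (b - a).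
Proof.
move=> H.
have [d dP] : exists d : R -> C, forall t, in01 t -> cder f (a + (b - a) * t%:C) (d t) /\ cmod (d t) <= M.
  have /choice [d dP] : forall t, exists dt, in01 t -> cder f (a + (b - a) * t%:C) dt /\ cmod dt <= M.
    move=> t; case: (pselect (in01 t)) => [/H [dt ? ?]|?]; last by exists 0.
    by exists dt.
  by exists d.
have part (p : C -> R) : (forall z, `|p z| <= cmod z) -> (forall u v, p (u - v) = p u - p v) ->
    (forall (k : R) u, p (u * k%:C) = p u * k) -> `|p (f b - f a)| <= M * cmod (b - a).
  move=> pn pB pZ; pose g (t : R) := p (f (a + (b - a) * t%:C)).
  have dg (t : R) : t \in `]0, 1[%R -> is_derive t 1 g (p (d t * (b - a))).
    rewrite in_itv /= => /andP[t0 t1]; have [//|h1 _] := dP t _; first by rewrite /in01 !ltW.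
    exact: (is_derive_part pn pB pZ h1).
  have dg' (t : R) : t \in `[0, 1]%R -> derivable g t 1.
    rewrite in_itv /= => t01; have [h1 _] := dP t t01.
    by have [] := is_derive_part pn pB pZ h1.
  have [t t01 E] := MVT_segment ler01 dg (derivable_within_continuous dg').
  have -> : f b - f a = f (a + (b - a) * 1%:C) - f (a + (b - a) * 0%:C).
    by rewrite rmorph1 rmorph0 mulr1 mulr0 addr0 subrKC.
  rewrite pB -/(g 1) -/(g 0) E subr0 mulr1 (le_trans (pn _)) // cmodM.
  apply: ler_wpM2r; first exact: cmod_ge0.
  by move: t01; rewrite in_itv /= => t01; have [] := dP t t01.
rewrite (le_trans (cmod_ReIm _)) // -mulrA mulr_natl mulr2n lerD // part //.
- exact: cmod_Re.
- by move=> u v; rewrite Re_add Re_opp.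
- by move=> k u; rewrite Re_mul /= mulr0 subr0.
- exact: cmod_Im.
- by move=> u v; rewrite Im_add Im_opp.
- by move=> k u; rewrite Im_mul /= mulr0 add0r.
Qed.

(** If every bound psi improves to a + q psi, iteration from any finite bound [phi] leads to the
    fixed point a / (1 - q). The value of [phi] disappears, so a merely qualitative bound is enough
    to start. *)
Lemma absorb (X : Type) (F : X -> R) (P : X -> Prop) (a q phi : R) : 0 <= a -> 0 <= q < 1 ->
  (forall psi : R, 0 <= psi -> (forall x : X, P x -> F x <= psi) -> forall x : X, P x -> F x <= a + q * psi) ->
  0 <= phi -> (forall x : X, P x -> F x <= phi) -> forall x : X, P x -> F x <= a / (1 - q).
Proof.
move=> a0 /andP[q0 q1] H phi0 Fphi; have q1' : 0 < 1 - q by rewrite subr_gt0.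
have aq0 : 0 <= a / (1 - q) by rewrite divr_ge0 // ltW.
have K k (x : X) : P x -> F x <= a / (1 - q) + q ^+ k * phi.
  elim: k x => [|k IH] x Px.
    by rewrite expr0 mul1r (le_trans (Fphi x Px)) // lerDr.
  have h := H _ (addr_ge0 aq0 (mulr_ge0 (exprn_ge0 k q0) phi0)) IH x Px.
  rewrite (le_trans h) // le_eqVlt; apply/orP; left; apply/eqP.
  by rewrite exprS; field; rewrite gt_eqF.
move=> x Px; apply/ler_addgt0Pr => e e0.
have h2 : `|q| < 1 by rewrite ger0_norm.
have := cvg_expr h2 => /cvgr0Pnorm_lt /(_ (e / (phi + 1))).
rewrite divr_gt0 ?ltr_wpDl // => /(_ isT) [N _ NP].
have := NP N (leqnn N); rewrite /= ger0_norm ?exprn_ge0 //.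
rewrite ltr_pdivlMr ?ltr_wpDl // => hN.
rewrite (le_trans (K N x Px)) // lerD2l (le_trans _ (ltW hN)) //.
by rewrite ler_wpM2l ?exprn_ge0 // lerDl.
Qed.
End MVT.

(** * Bounds of high order near the merging singular points *)

Section Apriori.
Context {R : realType}.
Local Notation C := R[i].
Variable n : nat.
Variables (b c r : R).
Hypotheses (b0 : 0 <= b) (c0 : 0 < c) (r0 : 0 < r).

Definition comm_mx2 (A D : 'M[C]_n) : 'M[C]_n := A *m D - D *m A.

Definition lam (L0 L1 : 'rV[C]_n) (x : C) (i : 'I_n) : C := L0 ord0 i + x * L1 ord0 i.

(** The class of coefficients over which the estimate is uniform: bounded by [b], with leading
    exponents at least [c] apart. *)
Definition adm (L0 L1 : 'rV[C]_n) (Rf : C -> 'M[C]_n) :=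
  [/\ forall i, cmod (L0 ord0 i) <= b, forall i, cmod (L1 ord0 i) <= b,
      forall x, cmod x < r -> forall i j, cmod (Rf x i j) <= b &
      forall i j, i != j -> c <= cmod (L0 ord0 i - L0 ord0 j)].

(** The diagonal equation is stated with the factor x^2 - e divided out, so that it says something
    at the singular points too. *)
Definition sol (e : C) (L0 L1 : 'rV[C]_n) (Rf D : C -> 'M[C]_n) :=
  [/\ forall i j, hol (fun x => D x i j) r,
      forall x, cmod x < r -> forall i j,
        (x ^+ 2 - e) * cd (fun x => D x i j) x =
        (lam L0 L1 x i - lam L0 L1 x j) * D x i j + (x ^+ 2 - e) * comm_mx2 (Rf x) (D x) i j &
      forall x, cmod x < r -> forall j, cd (fun x => D x j j) x = comm_mx2 (Rf x) (D x) j j].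

(** [y] is a square root of the parameter and [phi] a bound of [D]. The data [m] dominate the
    diagonal at [y] and also [cmod y * phi], into which the terms |y|^(k+1) phi go when |x| <
    |y|. *)
Definition inst (y : C) (D : C -> 'M[C]_n) (phi m : R) :=
  exists L0 L1 Rf, [/\ adm L0 L1 Rf, sol (y ^+ 2) L0 L1 Rf D,
    forall x, cmod x <= r / 2 -> forall i j, cmod (D x i j) <= phi,
    cmod y * phi <= m /\ forall j, cmod (D y j j) <= m & 0 <= phi /\ 0 <= m].

Let N2 : R := 2 * n%:R * b.
Let N20 : 0 <= N2. Proof. by rewrite /N2 !mulr_ge0. Qed.

Ltac lra_goal := clear - R n b c r b0 c0 r0 N20; lra.

Lemma cmod_sum (I : Type) (l : seq I) (F : I -> C) :
  cmod (\sum_(i <- l) F i) <= \sum_(i <- l) cmod (F i).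
Proof.
elim: l => [|i l IH]; rewrite ?big_nil ?cmod0 // !big_cons.
by rewrite (le_trans (cmodD _ _)) // lerD2l.
Qed.

Lemma comm_bound (A D : 'M[C]_n) (a : R) i j : (forall i j, cmod (A i j) <= b) ->
  (forall i j, cmod (D i j) <= a) -> cmod (comm_mx2 A D i j) <= N2 * a.
Proof.
move=> Ab Da; rewrite /comm_mx2 !mxE (le_trans (cmodB _ _)) //.
have a0 : 0 <= a := le_trans (cmod_ge0 _) (Da i j).
have h (X Y : 'I_n -> C) (p q : R) : 0 <= p -> 0 <= q -> (forall k, cmod (X k) <= p) ->
    (forall k, cmod (Y k) <= q) -> cmod (\sum_k X k * Y k) <= n%:R * (p * q).
  move=> p0 q0 Xp Yq; rewrite (le_trans (cmod_sum _ _)) //.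
  apply: (@le_trans _ _ (\sum_(k < n) p * q)); last by rewrite sumr_const card_ord [n%:R * _]mulr_natl.
  by apply: ler_sum => k _; rewrite cmodM ler_pM ?cmod_ge0.
have h1 : cmod (\sum_k A i k * D k j) <= n%:R * (b * a) by apply: h.
have h2 : cmod (\sum_k D i k * A k j) <= n%:R * (a * b) by apply: h.
by rewrite /N2; move: h1 h2; move: (cmod _) (cmod _) => p q; lra.
Qed.

(* Off the diagonal, [(lam_i - lam_j) D_ij = (x^2 - y^2) (D_ij' - [R, D]_ij)], and
   Cauchy's estimate of [D'] on a disc of radius comparable to [cmod x] costs one
   power of [cmod x] out of two, so the exponent grows by one. On the diagonal,
   [D_ii' = [R, D]_ii] is integrated from [y], where [D_ii] is controlled by [m]. *)
Definition local_bound (k : nat) := exists Ck sg : R, [/\ 0 <= Ck, 0 < sg, sg <= r / 2, sg <= 1 &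
  forall y D phi m, inst y D phi m -> cmod y <= sg -> forall x, cmod x <= sg -> forall i j,
    cmod (D x i j) <= Ck * (m + cmod x ^+ k * phi)].

Lemma local_bound0 : local_bound 0.
Proof.
exists 1, (Num.min (r / 2) 1); rewrite lt_min divr_gt0 // ltr01 !ge_min !lexx orbT; split=> //.
move=> y D phi m [L0 [L1 [Rf [_ _ Dphi _ [phi0 m0]]]]] _ x; rewrite le_min => /andP[xr _] i j.
by rewrite expr0 !mul1r (le_trans (Dphi x xr i j)) // lerDr.
Qed.

Lemma expr_le1 (a : R) k : 0 <= a <= 1 -> a ^+ k.+1 <= a.
Proof.
by move=> /andP[a0 a1]; rewrite exprSr ler_piMl // exprn_ile1.
Qed.

Lemma local_boundS k : local_bound k -> local_bound k.+1.
Proof.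
move=> [Ck [sg [Ck0 sg0 sgr sg1 HS]]].
(* Circles of radius 2 |u| with |u| <= 2 sg' stay within [sg], and 4 b sg' <= c / 2 preserves half
   of the gap. *)
have [sg' sg'E] : exists q, q = Num.min (sg / 4) (c / (8 * b + 1)) by eexists.
have [NN NNE] : exists q, q = N2 by eexists.
have NN0 : 0 <= NN by rewrite NNE.
have b1 : 0 < 8 * b + 1 by rewrite ltr_wpDl // mulr_ge0.
have s'0 : 0 < sg' by rewrite sg'E lt_min !divr_gt0.
have [s'1 s'2] : sg' <= sg / 4 /\ sg' <= c / (8 * b + 1) by rewrite sg'E !ge_min !lexx orbT.
move: sg'E => _.
have s'c : 8 * b * sg' + sg' <= c.
  by move: s'2; rewrite ler_pdivlMr // mulrDr mulr1 mulrC.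
move: s'2 => _.
have bs0 : 0 <= b * sg' by rewrite mulr_ge0 // ltW.
have [A1 A1E] : exists q, q = 4 / c * Ck * (16 * 2 ^+ k + NN) by eexists.
have tk0 : 0 <= 2 ^+ k :> R by rewrite exprn_ge0.
have A10 : 0 <= A1.
  by rewrite A1E !mulr_ge0 ?invr_ge0 ?(ltW c0) // addr_ge0 // mulr_ge0.
exists (A1 * (9 + 8 * 2 ^+ k.+1) + 1 + 8 * NN * Ck), sg'.
have tkS0 : 0 <= 2 ^+ k.+1 :> R by rewrite exprn_ge0.
have A2 : 0 <= A1 * (8 + 8 * 2 ^+ k.+1) by rewrite mulr_ge0 // addr_ge0 // mulr_ge0.
have NNC : 0 <= NN * Ck by rewrite mulr_ge0.
split=> //; try lra.
have T9 : A1 * (9 + 8 * 2 ^+ k.+1) = A1 * (8 + 8 * 2 ^+ k.+1) + A1 by ring.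
have T1 : A1 <= A1 * (9 + 8 * 2 ^+ k.+1) + 1 + 8 * NN * Ck by rewrite T9; lra.
have T0 := le_trans A10 T1.
move=> y D phi m Hi ys x xs i j.
have Hi' := Hi; move: Hi' => [L0 [L1 [Rf [[aL0 aL1 aR aG] [Dh De Dd] Dphi [yphi Dy] [phi0 m0]]]]].
have y0 := cmod_ge0 y; have y1 : cmod y <= 1 by move: ys s'1 sg1; lra_goal.
have U u p q : cmod u <= sg -> cmod (D u p q) <= Ck * (m + cmod u ^+ k * phi).
  by move=> us; apply: (HS y) => //; move: ys s'1 sg0; lra_goal.
(* For |u| >= |y| one has |u^2 - y^2| <= 2 |u|^2, and the derivative is estimated on the circle of
   radius |u| around 0 enlarged twice. *)
have offA u p q : p != q -> cmod y <= cmod u -> 0 < cmod u -> cmod u <= 2 * sg' ->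
    cmod (D u p q) <= A1 * (m + cmod u ^+ k.+1 * phi).
  move=> pq yu u0 us; have ur : cmod u < r by move: us s'1 sgr (r0); lra_goal.
  have uk0 : 0 <= cmod u ^+ k by rewrite exprn_ge0 // cmod_ge0.
  have [E EE] : exists q, q = m + cmod u ^+ k * phi by eexists.
  have E0 : 0 <= E by rewrite EE addr_ge0 // mulr_ge0.
  have tk1 : 1 <= 2 ^+ k :> R by rewrite exprn_ege1 // ler1n.
  have dB : cmod (cd (fun x => D x p q) u) <= 16 * (Ck * (2 ^+ k * E)) / cmod u.
    have -> : 16 * (Ck * (2 ^+ k * E)) / cmod u = 32 * (Ck * (2 ^+ k * E)) / (2 * cmod u).
      by field; rewrite gt_eqF.
    apply: (cd_bound (r := r)) => //; try by apply/andP; split; move: u0 us s'1 sgr (r0); lra_goal.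
      move=> z zs; apply: (le_trans (U z p q _)); rewrite zs; first by move: us s'1 sg0; lra_goal.
      apply: ler_wpM2l => //; rewrite exprMn EE mulrDr -mulrA lerD2r.
      by rewrite ler_peMl.
    by move: u0; lra_goal.
  have cB : cmod (comm_mx2 (Rf u) (D u) p q) <= NN * (Ck * E).
    by rewrite NNE; apply: comm_bound; [exact: aR | move=> i' j'; rewrite EE; apply: U; move: us s'1 sg0; lra_goal].
  have gap : c / 2 <= cmod (lam L0 L1 u p - lam L0 L1 u q).
    have -> : lam L0 L1 u p - lam L0 L1 u q = (L0 ord0 p - L0 ord0 q) - u * (L1 ord0 q - L1 ord0 p).
      by rewrite /lam; ring.
    have h1 := lerB_cmod (L0 ord0 p - L0 ord0 q) (u * (L1 ord0 q - L1 ord0 p)).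
    have h2 := aG _ _ pq.
    have h3 : cmod (u * (L1 ord0 q - L1 ord0 p)) <= (2 * sg') * (2 * b).
      rewrite cmodM ler_pM ?cmod_ge0 // (le_trans (cmodB _ _)) //.
      by have := aL1 p; have := aL1 q; lra_goal.
    by move: h1 h2 h3 s'c s'0; lra_goal.
  have eq := De u ur p q.
  have eqB : cmod (lam L0 L1 u p - lam L0 L1 u q) * cmod (D u p q) <=
      (2 * cmod u ^+ 2) * (16 * (Ck * (2 ^+ k * E)) / cmod u + NN * (Ck * E)).
    rewrite -cmodM (_ : _ * D u p q = (u ^+ 2 - y ^+ 2) *
       (cd (fun x => D x p q) u - comm_mx2 (Rf u) (D u) p q)); last first.
      by rewrite mulrBr eq; ring.
    rewrite cmodM; apply: ler_pM; rewrite ?cmod_ge0 //.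
      rewrite (le_trans (cmodB _ _)) // !cmodX.
      have : cmod y ^+ 2 <= cmod u ^+ 2 by apply: lerXn2r; rewrite ?nnegrE ?cmod_ge0.
      by lra_goal.
    by rewrite (le_trans (cmodB _ _)) // lerD.
  have h4 : c / 2 * cmod (D u p q) <=
      (2 * cmod u ^+ 2) * (16 * (Ck * (2 ^+ k * E)) / cmod u + NN * (Ck * E)).
    by rewrite (le_trans _ eqB) // ler_wpM2r ?cmod_ge0.
  have u1 : cmod u <= 1 by move: us s'1 sg1; lra_goal.
  have CE0 : 0 <= Ck * E by rewrite mulr_ge0.
  have h5 : (2 * cmod u ^+ 2) * (16 * (Ck * (2 ^+ k * E)) / cmod u + NN * (Ck * E)) <=
      c / 2 * (A1 * (cmod u * E)).
    have -> : (2 * cmod u ^+ 2) * (16 * (Ck * (2 ^+ k * E)) / cmod u + NN * (Ck * E)) =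
       2 * cmod u * (Ck * E) * (16 * 2 ^+ k + cmod u * NN) by field; rewrite gt_eqF.
    have -> : c / 2 * (A1 * (cmod u * E)) = 2 * cmod u * (Ck * E) * (16 * 2 ^+ k + NN).
      by rewrite A1E; field; rewrite gt_eqF.
    apply: ler_wpM2l; first by rewrite !mulr_ge0 // ltW.
    by rewrite lerD2l ler_piMl.
  have h6 : cmod (D u p q) <= A1 * (cmod u * E).
    by rewrite -(ler_pM2l (_ : 0 < c / 2)) ?divr_gt0 // (le_trans h4).
  rewrite (le_trans h6) //; apply: ler_wpM2l => //.
  rewrite EE mulrDr exprS mulrA lerD2r ler_piMl //.
(* For |u| < |y|, [hol_bound] transports the estimate from the circle of radius 2 |y|, where [offA]
   applies and |z|^(k+1) phi <= 2^(k+1) m. *)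
have offB u p q : p != q -> cmod u < cmod y -> cmod (D u p q) <= 8 * (A1 * ((1 + 2 ^+ k.+1) * m)).
  move=> pq uy; have yp : 0 < cmod y := le_lt_trans (cmod_ge0 u) uy.
  apply: (hol_bound (r := r) (s := 2 * cmod y) (Dh p q)).
  - by apply/andP; split; move: yp ys s'1 sgr (r0); lra_goal.
  - move=> z zs; apply: (le_trans (offA z p q pq _ _ _)); rewrite zs; try by move: yp ys y0; lra_goal.
    apply: ler_wpM2l => //; rewrite [(1 + _) * m]mulrDl mul1r lerD2l exprMn -mulrA.
    apply: ler_wpM2l => //; rewrite (le_trans _ yphi) //.
    by apply: ler_wpM2r => //; apply: expr_le1; rewrite y0.
  - by move: uy (cmod_ge0 u); lra_goal.
have P0 : 0 <= cmod x ^+ k.+1 * phi by rewrite mulr_ge0 // exprn_ge0 // cmod_ge0.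
have [<-|ij] := eqVneq i j; last first.
  have [yx|xy] := lerP (cmod y) (cmod x).
    (* For x = y = 0 the equation reads (lam_i - lam_j) D_ij = 0, and the gap forces D_ij = 0. *)
    have [x0|x0] := eqVneq (cmod x) 0.
      have yz : y = 0 by apply/eqP; rewrite -cmod_eq0 eq_le y0 andbT -x0.
      have xz : x = 0 by apply/eqP; rewrite -cmod_eq0 x0.
      have xr : cmod x < r by rewrite x0.
      have := De x xr i j; rewrite yz xz !expr0n /= subrr !mul0r addr0 => /eqP.
      rewrite eq_sym mulf_eq0 => /orP[/eqP h|/eqP h].
        by have := aG _ _ ij; move: h; rewrite /lam !mul0r !addr0 => ->; rewrite cmod0 leNgt c0.
      by rewrite h !cmod0 expr0n /= mul0r addr0 mulr_ge0.
    have x0' : 0 < cmod x by rewrite lt_neqAle eq_sym x0 cmod_ge0.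
    apply: (le_trans (offA x i j ij yx x0' _)); first by move: xs s'0; lra_goal.
    by apply: ler_wpM2r => //; rewrite addr_ge0.
  apply: (le_trans (offB x i j ij xy)).
  apply: (@le_trans _ _ ((A1 * (9 + 8 * 2 ^+ k.+1) + 1 + 8 * NN * Ck) * m)).
    rewrite (_ : 8 * (A1 * ((1 + 2 ^+ k.+1) * m)) = 8 * A1 * (1 + 2 ^+ k.+1) * m); last by ring.
    apply: ler_wpM2r => //; have -> : A1 * (9 + 8 * 2 ^+ k.+1) = 8 * A1 * (1 + 2 ^+ k.+1) + A1 by ring.
    by move: A10 NNC; lra_goal.
  by apply: ler_wpM2l => //; rewrite lerDl.
(* The segment from [y] to [x] lies in the disc of radius [tau]; its length, at most 2 tau, supplies
   the additional power. *)
have [tau tauE] : exists q, q = Num.max (cmod x) (cmod y) by eexists.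
have [tx ty] : cmod x <= tau /\ cmod y <= tau by rewrite tauE !le_max !lexx orbT.
have ts : tau <= sg' by rewrite tauE ge_max xs ys.
have t0 : 0 <= tau := le_trans y0 ty.
have mv : cmod (D x i i - D y i i) <= 2 * (NN * (Ck * (m + tau ^+ k * phi))) * cmod (x - y).
  apply: (mvt_ineq (f := fun x => D x i i)) => t /andP[tt0 tt1].
  pose u := y + (x - y) * t%:C; have ut : cmod u <= tau.
    have -> : u = (1 - t)%:C * y + t%:C * x by rewrite /u rmorphB rmorph1 /=; ring.
    rewrite (le_trans (cmodD _ _)) // !cmodM !cmodR !ger0_norm ?subr_ge0 //.
    have h1 : (1 - t) * cmod y <= (1 - t) * tau by rewrite ler_wpM2l ?subr_ge0.
    have h2 : t * cmod x <= t * tau by rewrite ler_wpM2l.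
    by move: h1 h2; lra_goal.
  have ur : cmod u < r by move: ut ts s'1 sgr (r0); lra_goal.
  exists (cd (fun x => D x i i) u); first exact: (hol_cd (Dh i i)).
  rewrite Dd // NNE; apply: comm_bound; first exact: aR.
  move=> p q; apply: (le_trans (U u p q _)); first by move: ut ts s'1 sg0; lra_goal.
  apply: ler_wpM2l => //; rewrite lerD2l; apply: ler_wpM2r => //.
  by apply: lerXn2r; rewrite ?nnegrE ?cmod_ge0.
have xy2 : cmod (x - y) <= 2 * tau by rewrite (le_trans (cmodB _ _)) //; move: tx ty; lra_goal.
have tphi : tau ^+ k.+1 * phi <= cmod x ^+ k.+1 * phi + m.
  have yk : cmod y ^+ k.+1 * phi <= m.
    rewrite (le_trans _ yphi) //; apply: ler_wpM2r => //; apply: expr_le1; by rewrite y0.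
  have [h|h] := leP (cmod x) (cmod y).
    by rewrite tauE (max_r h) (le_trans yk) // lerDr.
  by rewrite tauE (max_l (ltW h)) lerDl.
have tk : tau * (m + tau ^+ k * phi) <= m + (cmod x ^+ k.+1 * phi + m).
  rewrite mulrDr mulrA -exprS lerD // ler_piMl //.
  by rewrite (le_trans ts) // (le_trans s'1) // ler_pdivrMr // mul1r (le_trans sg1) // ler1n.
have big : cmod (D x i i - D y i i) <= 4 * NN * Ck * (m + (cmod x ^+ k.+1 * phi + m)).
  rewrite (le_trans mv) //.
  apply: (@le_trans _ _ (2 * (NN * (Ck * (m + tau ^+ k * phi))) * (2 * tau))).
    apply: ler_wpM2l => //; rewrite !mulr_ge0 // addr_ge0 // mulr_ge0 // exprn_ge0 //.
  have -> : 2 * (NN * (Ck * (m + tau ^+ k * phi))) * (2 * tau) =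
     4 * NN * Ck * (tau * (m + tau ^+ k * phi)) by ring.
  by apply: ler_wpM2l => //; rewrite -mulrA mulr_ge0.
have := cmodD (D x i i - D y i i) (D y i i); rewrite subrK => h.
have hy := Dy i.
apply: (le_trans h); apply: (le_trans (lerD big hy)).
set P := cmod x ^+ k.+1 * phi in P0 *.
set Q := NN * Ck in NNC *.
have -> : 4 * NN * Ck * (m + (P + m)) + m = 4 * (Q * P) + 8 * (Q * m) + m by rewrite /Q; ring.
have Qm : 0 <= Q * m by rewrite mulr_ge0.
have QP : 0 <= Q * P by rewrite mulr_ge0.
have -> : (A1 * (9 + 8 * 2 ^+ k.+1) + 1 + 8 * NN * Ck) * (m + P) =
   (A1 * (9 + 8 * 2 ^+ k.+1)) * (m + P) + m + P + 8 * (Q * m) + 8 * (Q * P) by rewrite /Q; ring.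
have : 0 <= (A1 * (9 + 8 * 2 ^+ k.+1)) * (m + P).
  rewrite mulr_ge0 ?addr_ge0 //.
  have -> : A1 * (9 + 8 * 2 ^+ k.+1) = A1 * (8 + 8 * 2 ^+ k.+1) + A1 by ring.
  by rewrite addr_ge0.
by move: QP Qm P0; lra_goal.
Qed.

Lemma local_boundP k : local_bound k. Proof. by elim: k => [|k]; [exact: local_bound0 | exact: local_boundS]. Qed.
End Apriori.

(** * Propagation to a fixed disc and the a priori estimate *)

Section Growth.
Context {R : realType}.
Local Notation C := R[i].
Variable n : nat.
Implicit Types (b c r : R) (x y : C) (D : C -> 'M[C]_n).

(** A bound of D' relative to D on the annulus r / 4 <= |u| <= r / 2 when |y| <= r / 8; there |u^2 -
    y^2| >= r^2 / 32, whence 32 / r^2. *)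
Definition rate b r := (2 * b + 2 * b * r) * (32 / r ^+ 2) + 2 * n%:R * b.

Lemma rate_ge0 b r : 0 <= b -> 0 < r -> 0 <= rate b r.
Proof.
move=> b0 r0; rewrite /rate addr_ge0 // ?mulr_ge0 // ?addr_ge0 // ?mulr_ge0 ?(ltW r0) //.
by rewrite invr_ge0 exprn_ge0 // ltW.
Qed.

Lemma rate_bound b c r y D phi m (A : R) u : 0 <= b -> 0 < r -> inst b c r y D phi m ->
  cmod y <= r / 8 -> r / 4 <= cmod u <= r / 2 -> (forall i j, cmod (D u i j) <= A) ->
  forall i j, cmod (cd (fun x => D x i j) u) <= rate b r * A.
Proof.
move=> b0 r0 [L0 [L1 [Rf [[aL0 aL1 aR aG] [Dh De Dd] Dphi _ _]]]] y8 /andP[u1 u2] DA i j.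
have ur : cmod u < r by rewrite (le_lt_trans u2) // ltr_pdivrMr // ltr_pMr // ltr1n.
have A0 : 0 <= A := le_trans (cmod_ge0 _) (DA i j).
have uy : r ^+ 2 / 32 <= cmod (u ^+ 2 - y ^+ 2).
  apply: le_trans (lerB_cmod _ _); rewrite !cmodX.
  have h1 : (r / 4) ^+ 2 <= cmod u ^+ 2.
    by apply: lerXn2r; rewrite ?nnegrE ?cmod_ge0 ?divr_ge0 ?(ltW r0).
  have h2 : cmod y ^+ 2 <= (r / 8) ^+ 2.
    by apply: lerXn2r; rewrite ?nnegrE ?cmod_ge0 ?divr_ge0 ?(ltW r0).
  have h3 : (r / 4) ^+ 2 = 4 * (r ^+ 2 / 64) by field.
  have h4 : (r / 8) ^+ 2 = r ^+ 2 / 64 by field.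
  have h5 : r ^+ 2 / 32 = 2 * (r ^+ 2 / 64) by field.
  have h6 : 0 <= r ^+ 2 / 64 by rewrite divr_ge0 // exprn_ge0 // ltW.
  move: h1 h2; rewrite h3 h4 h5; move: h6; move: (r ^+ 2 / 64) (cmod u ^+ 2) (cmod y ^+ 2) => p q s.
  by clear; move=> *; lra.
have uy0 : 0 < r ^+ 2 / 32 by rewrite divr_gt0 // exprn_gt0.
have nz : u ^+ 2 - y ^+ 2 != 0 by rewrite -cmod_gt0 (lt_le_trans uy0).
have cE : cd (fun x => D x i j) u =
    (lam L0 L1 u i - lam L0 L1 u j) * D u i j / (u ^+ 2 - y ^+ 2) + comm_mx2 (Rf u) (D u) i j.
  by apply: (mulfI nz); rewrite De // mulrDr [_ * (_ / _)]mulrC divfK.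
rewrite cE (le_trans (cmodD _ _)) // /rate [leRHS]mulrDl; apply: lerD; last first.
  by apply: comm_bound => //; exact: aR.
have lb k : cmod (lam L0 L1 u k) <= b + b * r.
  rewrite /lam (le_trans (cmodD _ _)) //; apply: lerD => //; rewrite cmodM mulrC.
  by apply: ler_pM; rewrite ?cmod_ge0 // ltW.
rewrite cmodM cmodV cmodM mulrAC.
apply: ler_pM; rewrite ?mulr_ge0 ?invr_ge0 ?cmod_ge0 //.
apply: ler_pM; rewrite ?invr_ge0 ?cmod_ge0 //.
  rewrite (le_trans (cmodB _ _)) //; have -> : 2 * b + 2 * b * r = (b + b * r) + (b + b * r) by ring.
  by apply: lerD.
have -> : 32 / r ^+ 2 = (r ^+ 2 / 32)^-1 by field; rewrite gt_eqF.
by rewrite lef_pV2 // posrE // (lt_le_trans uy0).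
Qed.

(** Integrating along the radius from the circle of radius [q], a bound psi improves to A + psi / 2,
    and [absorb] gives 2 A. *)
Lemma growth_step b c r y D phi m (A q eta : R) : 0 <= b -> 0 < r -> inst b c r y D phi m ->
  cmod y <= r / 8 -> r / 4 <= q -> 0 < eta -> q + eta <= r / 2 -> 4 * rate b r * eta <= 1 ->
  0 <= A -> (forall x, cmod x <= q -> forall i j, cmod (D x i j) <= A) ->
  forall x, cmod x <= q + eta -> forall i j, cmod (D x i j) <= 2 * A.
Proof.
move=> b0 r0 Hi y8 rq eta0 qr be A0 DA x xq i j.
have rt0 := rate_ge0 b0 r0.
have q0 : 0 < q by rewrite (lt_le_trans _ rq) // divr_gt0.
have -> : 2 * A = A / (1 - 2^-1) by field.
have Hi' := Hi; move: Hi' => [L0 [L1 [Rf [_ [Dh _ _] Dphi _ [phi0 _]]]]].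
pose F (p : C * ('I_n * 'I_n)) := cmod (D p.1 p.2.1 p.2.2).
apply: (@absorb R _ F (fun p => cmod p.1 <= q + eta) A 2^-1 phi A0 _ _ phi0 _ (x, (i, j))) => //.
- by rewrite invr_ge0 ler0n /= invf_lt1 // ltr1n.
- move=> psi psi0 Dpsi [z [k l]] /= zq; rewrite /F /=.
  have [zq'|qz] := lerP (cmod z) q.
    by rewrite (le_trans (DA z zq' k l)) // lerDl mulr_ge0 // invr_ge0.
  have z0 : 0 < cmod z := lt_trans q0 qz.
  pose k0 := q / cmod z; have k00 : 0 < k0 by rewrite divr_gt0.
  have k01 : k0 < 1 by rewrite ltr_pdivrMr // mul1r.
  have kz : k0 * cmod z = q by rewrite divfK // gt_eqF.
  have zz : cmod (z - k0%:C * z) = cmod z - q.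
    by rewrite -{1}[z]mul1r -mulrBl cmodM -(rmorph1 (real_complex R)) -rmorphB cmodR ger0_norm ?subr_ge0 ?(ltW k01) // mulrBl mul1r kz.
  have mv : cmod (D z k l - D (k0%:C * z) k l) <= 2 * (rate b r * psi) * cmod (z - k0%:C * z).
    apply: (mvt_ineq (f := fun x => D x k l)) => t /andP[t0 t1].
    pose k1 := k0 + (1 - k0) * t.
    have uE : k0%:C * z + (z - k0%:C * z) * t%:C = k1%:C * z.
      by rewrite /k1 !(rmorphD, rmorphM, rmorphN, rmorph1) /=; ring.
    have k1b : k0 <= k1 <= 1.
      rewrite /k1 lerDl mulr_ge0 ?subr_ge0 ?(ltW k01) //=.
      have : (1 - k0) * t <= 1 - k0 by rewrite ler_piMr // subr_ge0 ltW.
      by move: ((1 - k0) * t) => p; clear; move=> *; lra.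
    have k10 : 0 < k1 by case/andP: k1b => h _; exact: lt_le_trans k00 h.
    have uz : cmod (k1%:C * z) = k1 * cmod z by rewrite cmodM cmodR gtr0_norm.
    have u1 : q <= cmod (k1%:C * z) by rewrite uz -kz ler_wpM2r ?(ltW z0) //; case/andP: k1b.
    have u2 : cmod (k1%:C * z) <= cmod z by rewrite uz ler_piMl ?(ltW z0) //; case/andP: k1b.
    have ur : cmod (k1%:C * z) <= r / 2 := le_trans (le_trans u2 zq) qr.
    rewrite uE; exists (cd (fun x => D x k l) (k1%:C * z)).
      apply: (hol_cd (Dh k l)); rewrite (le_lt_trans ur) // ltr_pdivrMr // ltr_pMr // ltr1n //.
    apply: (rate_bound b0 r0 Hi y8); first by rewrite (le_trans rq u1) ur.
    by move=> k' l'; apply: (Dpsi (_, (k', l'))) => /=; rewrite (le_trans u2).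
  have := cmodD (D z k l - D (k0%:C * z) k l) (D (k0%:C * z) k l); rewrite subrK => h.
  have hA : cmod (D (k0%:C * z) k l) <= A by apply: DA; rewrite cmodM cmodR gtr0_norm // kz.
  rewrite (le_trans h) // addrC; apply: lerD => //; apply: (le_trans mv).
  have ze : cmod z - q <= eta by rewrite lerBlDl.
  rewrite zz; apply: (@le_trans _ _ (2 * (rate b r * psi) * eta)).
    by apply: ler_wpM2l => //; rewrite !mulr_ge0.
  have -> : 2 * (rate b r * psi) * eta = 2^-1 * psi * (4 * rate b r * eta) by field.
  by rewrite ler_piMr // mulr_ge0 // invr_ge0.
- by move=> [z [k l]] /= zq; apply: Dphi; exact: le_trans zq qr.
Qed.

(** A discrete Gronwall inequality: J steps of length [eta] lead from r / 4 to r / 2, and each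
    doubles the bound. *)
Lemma growth b c r : 0 <= b -> 0 < r -> exists2 K : R, 1 <= K & forall y D phi m (A : R),
  inst b c r y D phi m -> cmod y <= r / 8 -> 0 <= A ->
  (forall x, cmod x <= r / 4 -> forall i j, cmod (D x i j) <= A) ->
  forall x, cmod x <= r / 2 -> forall i j, cmod (D x i j) <= K * A.
Proof.
move=> b0 r0; have rt0 := rate_ge0 b0 r0.
pose J := (Num.bound (rate b r * r)).+1.
have J0 : 0 < J%:R :> R by rewrite ltr0n.
have JP : rate b r * r <= J%:R.
  rewrite (le_trans (ltW (Num.Theory.archi_boundP _))) ?mulr_ge0 ?(ltW r0) // ler_nat //.
pose eta := r / 4 / J%:R.
have eta0 : 0 < eta by rewrite !divr_gt0.
have be : 4 * rate b r * eta <= 1.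
  have -> : 4 * rate b r * eta = rate b r * r / J%:R by rewrite /eta; field; rewrite gt_eqF.
  by rewrite ler_pdivrMr // mul1r.
exists (2 ^+ J); first by rewrite exprn_ege1 // ler1n.
move=> y D phi m A Hi y8 A0 DA.
have K k : (k <= J)%N -> forall x, cmod x <= r / 4 + k%:R * eta ->
    forall i j, cmod (D x i j) <= 2 ^+ k * A.
  elim: k => [|k IH] kJ x; first by rewrite mul0r addr0 expr0 mul1r; exact: DA.
  rewrite -[k.+1%:R]natr1 mulrDl mul1r addrA exprS -mulrA.
  apply: (growth_step b0 r0 Hi y8) => //.
  - by rewrite lerDl mulr_ge0 // ltW.
  - have -> : r / 4 + k%:R * eta + eta = r / 4 + k.+1%:R * eta by rewrite -[k.+1%:R]natr1; ring.
    have -> : r / 2 = r / 4 + J%:R * eta by rewrite /eta; field; rewrite gt_eqF.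
    by rewrite lerD2l ler_wpM2r ?(ltW eta0) // ler_nat.
  - by rewrite mulr_ge0 // exprn_ge0.
  - by apply: IH; exact: ltnW.
move=> x xr; apply: (K J (leqnn J)).
by rewrite (_ : r / 4 + J%:R * eta = r / 2) // /eta; field; rewrite gt_eqF.
Qed.

Lemma fin_bound (I : finType) (T : Type) (P : T -> Prop) (F : I -> T -> R) :
  (forall i, exists M : R, forall t, P t -> F i t <= M) ->
  exists2 M : R, 0 <= M & forall i t, P t -> F i t <= M.
Proof.
move=> /choice [M MP]; exists (\sum_i `|M i|); first exact: sumr_ge0.
move=> i t Pt; rewrite (le_trans (MP i t Pt)) // (le_trans (ler_norm _)) //.
by rewrite (bigD1 i) //= lerDl sumr_ge0.
Qed.

(* [local_bound] with a large exponent makes [D] small, relative to its maximum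
   [phi], on a tiny circle; [taylor_bound] carries this to the disc of radius
   [r / 4], and [growth] to radius [r / 2], where [phi] is then absorbed. *)
Theorem apriori b c r : 0 <= b -> 0 < c -> 0 < r ->
  exists Cst rho : R, [/\ 0 <= Cst, 0 < rho & forall y L0 L1 Rf D (dat : R),
    cmod y <= rho -> adm b c r L0 L1 Rf -> sol r (y ^+ 2) L0 L1 Rf D -> 0 <= dat ->
    (forall j, cmod (D y j j) <= dat) ->
    forall x, cmod x <= r / 2 -> forall i j : 'I_n, cmod (D x i j) <= Cst * dat].
Proof.
move=> b0 c0 r0; have [K K1 KP] := growth c b0 r0.
have K0 : 0 < K := lt_le_trans ltr01 K1.
(* This [N] makes the Taylor remainder at most psi / (4 K), where [K] is the loss of [growth]. *)
have [N NP] : exists N, 4 * 2^-1 ^+ N * (4 * K) <= 1 :> R.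
  have h2 : `|2^-1 : R| < 1 by rewrite ger0_norm ?invr_ge0 // invf_lt1 // ltr1n.
  have := cvg_expr h2 => /cvgr0Pnorm_lt /(_ (16 * K)^-1).
  rewrite invr_gt0 mulr_gt0 // => /(_ isT) [N _ NP]; exists N.
  have := NP N (leqnn N); rewrite /= ger0_norm ?exprn_ge0 ?invr_ge0 // => /ltW h.
  rewrite -(@ler_pM2r _ (16 * K)^-1) ?invr_gt0 ?mulr_gt0 // mul1r (le_trans _ h) //.
  by rewrite le_eqVlt; apply/orP; left; apply/eqP; field; rewrite gt_eqF.
have [Ck [sg [Ck0 sg0 sgr sg1 HS]]] := local_boundP n b0 c0 r0 N.+1.
(* The exponent N + 1 in [local_bound] exceeds by one power of [g] the loss (r / 2 / g)^N in
   [taylor_bound]. What remains is W g psi, small with [g]. *)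
have [W WE] : exists W, W = 2 * N%:R * Ck * (r / 2) ^+ N by eexists.
have W0 : 0 <= W by rewrite WE !mulr_ge0 // exprn_ge0 // divr_ge0 // ltW.
have [g gE] : exists g, g = Num.min sg (4 * K * W + 1)^-1 by eexists.
have WK : 0 < 4 * K * W + 1 by rewrite ltr_wpDl // !mulr_ge0 // ltW.
have g0 : 0 < g by rewrite gE lt_min sg0 invr_gt0.
have [g1 g2] : g <= sg /\ g <= (4 * K * W + 1)^-1 by rewrite gE !ge_min !lexx orbT.
have WgK : W * g * (4 * K) <= 1.
  have : g * (4 * K * W + 1) <= 1 by rewrite -ler_pdivlMr // mul1r.
  have g0' := ltW g0.
  move: g0'; clear; have -> : W * g * (4 * K) = g * (4 * K * W) by ring.
  by move: (4 * K * W) => p *; lra.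
have [C3 C3E] : exists q, q = N%:R * (r / 2 / g) ^+ N * (2 * Ck) by eexists.
have C30 : 0 <= C3.
  by rewrite C3E !mulr_ge0 // exprn_ge0 // !divr_ge0 // ltW.
have KC0 : 0 < 4 * (K * C3) + 1 by rewrite ltr_wpDl // !mulr_ge0 // ltW.
pose rho := Num.min (Num.min sg (r / 8)) (4 * (K * C3) + 1)^-1.
exists (4 * (K * C3)), rho; split.
- by rewrite !mulr_ge0 // ltW.
- by rewrite !lt_min sg0 divr_gt0 // invr_gt0.
move=> y L0 L1 Rf D dat; rewrite !le_min => /andP[/andP[y1 y2] y3] aH sH dat0 Ddat x xr i j.
have [Dh _ _] := sH.
have [phi phi0 phiP] : exists2 M : R, 0 <= M & forall (p : 'I_n * 'I_n) z, cmod z <= r / 2 ->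
    cmod (D z p.1 p.2) <= M.
  apply: fin_bound => -[k l] /=.
  have s34 : 0 < 3 / 4 * r < r.
    by rewrite mulr_gt0 ?divr_gt0 //= gtr_pMl // ltr_pdivrMr // mul1r ltr_nat.
  have [M MP] := bcirc_hol (Dh k l) s34; exists (8 * M) => z zr.
  apply: (hol_bound (Dh k l) s34 MP); rewrite (le_trans zr) // mulrA mulrC.
  by rewrite ler_pM2r //; clear; lra.
pose F (p : C * ('I_n * 'I_n)) := cmod (D p.1 p.2.1 p.2.2).
(* The factor 3/4 is 1/2 from the two terms psi / (4 K), plus at most 1/4 from the part |y| psi of
   [m], by the third bound on [rho]. *)
have -> : 4 * (K * C3) * dat = (K * C3 * dat) / (1 - 3 / 4) by field.
apply: (@absorb R _ F (fun p => cmod p.1 <= r / 2) (K * C3 * dat) (3 / 4) phi _ _ _ phi0 _ (x, (i, j))) => //.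
- by rewrite !mulr_ge0 // ltW.
- by rewrite divr_ge0 //= ltr_pdivrMr // mul1r ltr_nat.
- move=> psi psi0 Dpsi [z [k l]] /= zr; rewrite /F /=.
  pose m := dat + cmod y * psi.
  have m0 : 0 <= m by rewrite addr_ge0 // mulr_ge0 // cmod_ge0.
  have Hi : inst b c r y D psi m.
    exists L0, L1, Rf; split=> //.
    - by move=> u ur p q; exact: (Dpsi (u, (p, q))).
    - split; first by rewrite /m lerDr.
      by move=> p; rewrite (le_trans (Ddat p)) // /m lerDl mulr_ge0 // cmod_ge0.
  have small u : cmod u <= r / 4 -> forall p q, cmod (D u p q) <= C3 * m + psi / (2 * K).
    move=> ur p q.
    have s0 : 0 < r / 2 < r by rewrite divr_gt0 //= ltr_pdivrMr // ltr_pMr // ltr1n.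
    have gs : 0 < g <= r / 2 by rewrite g0 (le_trans g1).
    have ur2 : cmod u <= r / 2 / 2 by rewrite (le_trans ur) // -mulrA -invfM -natrM.
    have gB w : cmod w = g -> cmod (D w p q) <= Ck * (m + g ^+ N.+1 * psi).
      by move=> wg; rewrite -wg; apply: (HS y D psi m Hi) => //; rewrite wg.
    have sB w : cmod w = r / 2 -> cmod (D w p q) <= psi.
      by move=> wr; apply: (Dpsi (w, (p, q))) => /=; rewrite wr.
    have := taylor_bound N (Dh p q) s0 gs sB gB ur2 => h; apply: (le_trans h).
    have -> : N%:R * (r / 2 / g) ^+ N * (2 * (Ck * (m + g ^+ N.+1 * psi))) =
        C3 * m + W * g * psi.
      rewrite C3E WE expr_div_n exprS; field; rewrite expf_neq0 // gt_eqF //.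
    rewrite -addrA lerD2l.
    have -> : psi / (2 * K) = psi / (4 * K) + psi / (4 * K) by field; rewrite gt_eqF.
    have K4 : 0 < 4 * K by rewrite mulr_gt0.
    apply: lerD; rewrite mulrC; apply: ler_wpM2l => //; rewrite -[leRHS]mul1r ler_pdivlMr //.
  have A0 : 0 <= C3 * m + psi / (2 * K).
    by rewrite addr_ge0 ?mulr_ge0 // invr_ge0 mulr_ge0 // ltW.
  have := KP y D psi m _ Hi y2 A0 small z zr k l => h; apply: (le_trans h).
  have -> : K * (C3 * m + psi / (2 * K)) = K * C3 * dat + (K * C3 * cmod y + 2^-1) * psi.
    by rewrite /m; field; rewrite gt_eqF.
  rewrite lerD2l; apply: ler_wpM2r => //.
  have h2 : cmod y * (4 * (K * C3) + 1) <= 1 by rewrite -ler_pdivlMr // mul1r.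
  have y0 := cmod_ge0 y.
  by move: h2 y0; move: (K * C3) (cmod y) => p q; clear; move=> *; lra.
- by move=> [z [k l]] /= zr; exact: (phiP (k, l)).
Qed.
End Growth.

(** * The sectorial domains *)

Section Geometry.
Context {R : realType}.
Local Notation C := R[i].
Local Notation Re := (@complex.Re R).
Local Notation Im := (@complex.Im R).
Implicit Types (w t x z u : C) (K : consts R).

Lemma sqrt_eps_neq0 w : sqrt_eps w != 0. Proof. exact: cexp_neq0. Qed.

Lemma sqrt_eps_sq w : sqrt_eps w ^+ 2 = eps w.
Proof. by rewrite /sqrt_eps /eps expr2 -cexpD; congr cexp; field. Qed.

Lemma eps_neq0 w : eps w != 0. Proof. exact: cexp_neq0. Qed.

Lemma Im_half z : Im (z / 2) = Im z / 2.
Proof. by rewrite -(rmorph_nat (real_complex R)) -fmorphV mulrC Im_rM mulrC. Qed.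

Lemma cmod_sqrt_eps w : cmod (sqrt_eps w) = Num.sqrt (cmod (eps w)).
Proof. by rewrite -sqrt_eps_sq cmodX sqrtr_sqr ger0_norm // cmod_ge0. Qed.

Lemma cmod2 : cmod (2 : C) = 2.
Proof. by rewrite -(rmorph_nat (real_complex R)) cmodR ger0_norm. Qed.

(* In the coordinate [eta], the height of [t] above the direction [thhat], the
   lines bounding the two time domains are level lines. *)
Definition eta K w t : R := Im (t * cis (- thhat K w)).
Definition pheight K w : R := eta K w (period w).

Lemma etaD K w t t' : eta K w (t + t') = eta K w t + eta K w t'.
Proof. by rewrite /eta mulrDl Im_add. Qed.
Lemma etaN K w t : eta K w (- t) = - eta K w t.
Proof. by rewrite /eta mulNr Im_opp. Qed.
Lemma etaZ K w (a : R) t : eta K w (a%:C * t) = a * eta K w t.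
Proof. by rewrite /eta -mulrA Im_rM. Qed.
Lemma eta_int K w t (k : int) : eta K w (t *~ k) = eta K w t * k%:~R.
Proof. by rewrite /eta mulrzAl Im_mulz. Qed.

Lemma etaE K w t : eta K w t = Im t * cos (thhat K w) - Re t * sin (thhat K w).
Proof.
rewrite /eta Im_mul /cis Re_cexp Im_cexp /= expR0 !mul1r cosN sinN; ring.
Qed.

Lemma aboveE K w (a : R) t : above (- (a%:C * period w)) (thhat K w) t <->
  - (a * pheight K w) < eta K w t.
Proof.
rewrite /above /= -/(eta K w (t - - (a%:C * period w))) opprK etaD etaZ -/(pheight K w).
by rewrite -ltrBlDr sub0r.
Qed.

Lemma belowE K w (a : R) t : below (a%:C * period w) (thhat K w) t <->
  eta K w t < a * pheight K w.
Proof.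
by rewrite /below /= -/(eta K w (t - a%:C * period w)) etaD etaN etaZ -/(pheight K w) subr_lt0.
Qed.

(** With al = pi - arg sqrt(eps), one has |al| <= pi / 2 + gam and thhat = (2 gam / pi) al, so |al -
    thhat| <= pi / 2 - 2 gam^2 / pi: the tilt keeps the cosine away from 0. *)
Definition gap_cos (g : R) : R := cos (pi / 2 - 2 * g ^+ 2 / pi).

Section Consts.
Variable K : consts R.
Hypotheses (gam0 : 0 < gam K) (gam1 : gam K * (1 + 2 * gam K / pi) < pi / 2).

Let pi0 : 0 < pi :> R. Proof. exact: pi_gt0. Qed.
Let pin : pi != 0 :> R. Proof. by rewrite gt_eqF. Qed.

Lemma gam_sq : 0 < 2 * gam K ^+ 2 / pi < pi / 2.
Proof.
apply/andP; split; first by rewrite !mulr_gt0 ?exprn_gt0 ?invr_gt0.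
apply: le_lt_trans gam1; rewrite mulrDr mulr1.
have -> : gam K * (2 * gam K / pi) = 2 * gam K ^+ 2 / pi by ring.
by rewrite lerDr ltW.
Qed.

Lemma gap_cos_gt0 : 0 < gap_cos (gam K).
Proof.
have /andP[h1 h2] := gam_sq; apply: cos_gt0_pihalf; move: h1 h2.
by move: (2 * gam K ^+ 2 / pi) => q h1 h2; apply/andP; split; lra.
Qed.

Lemma gam_lt : gam K < pi / 2.
Proof.
apply: le_lt_trans gam1; rewrite ler_pMr // lerDl divr_ge0 ?(ltW pi0) // mulr_ge0 // ltW //.
Qed.

(** The first bound, |thhat| <= gam (1 + 2 gam / pi), keeps the bounding lines from being vertical;
    the second keeps the period transverse to them. *)
Lemma angle_bounds w : Sdom K w -> `|thhat K w| < pi / 2 /\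
  gap_cos (gam K) <= cos (pi - arg_sqrt_eps w - thhat K w).
Proof.
move=> [_ /andP[h1 h2]]; rewrite /thhat /arg_sqrt_eps.
have [al alE] : exists a, a = pi - arg_eps w / 2 by eexists.
rewrite -alE; have ab : `|al| <= pi / 2 + gam K.
  by rewrite ler_norml alE; move: h1 h2; apply: (fun P => P);
     move: (arg_eps w) (gam K) => a g h1 h2; apply/andP; split; lra.
have k0 : 0 < 2 * gam K / pi by rewrite !mulr_gt0 ?invr_gt0.
have k1 : 2 * gam K / pi < 1.
  by rewrite ltr_pdivrMr // mul1r; have := gam_lt; move: (gam K) => g; lra.
split.
  rewrite normrM ger0_norm ?(ltW k0) // (le_lt_trans (ler_wpM2l (ltW k0) ab)) //.
  apply: le_lt_trans gam1; rewrite le_eqVlt; apply/orP; left; apply/eqP.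
  by move: pin; move: (gam K) (pi : R) => g p pn; field.
have -> : al - 2 * gam K / pi * al = (1 - 2 * gam K / pi) * al by ring.
have b2 : `|(1 - 2 * gam K / pi) * al| <= pi / 2 - 2 * gam K ^+ 2 / pi.
  have k2 : 0 <= 1 - 2 * gam K / pi by rewrite subr_ge0 ltW.
  rewrite normrM (ger0_norm k2) (le_trans (ler_wpM2l k2 ab)) //.
  rewrite le_eqVlt; apply/orP; left; apply/eqP.
  by move: pin; move: (gam K) (pi : R) => g p pn; field.
rewrite -(cos_norm ((1 - _) * al)) /gap_cos.
have /andP[g1 g2] := gam_sq.
move: b2 g1 g2 pi0; move: (2 * gam K ^+ 2 / pi) ((1 - 2 * gam K / pi) * al) => q b b2 g1 g2 p0.
rewrite leNgt; apply/negP => hlt; have : pi / 2 - q < `|b|.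
  rewrite -ltr_cos // in_itv /=; apply/andP; split=> //; rewrite ?normr_ge0 //; lra.
by rewrite ltNge b2.
Qed.

Lemma pheightE w : pheight K w = pi / cmod (sqrt_eps w) * cos (pi - arg_sqrt_eps w - thhat K w).
Proof.
have s0 := sqrt_eps_neq0 w.
rewrite /pheight /eta /period /sqrt_eps -cexpN /cis -[X in Im X]mulrA -cexpD.
rewrite mulNr Im_opp Im_mul Re_cexp /= mul0r add0r.
have -> : Re (- (w / 2) + 0 +i* (- thhat K w)) = - Re (w / 2).
  by rewrite Re_add Re_opp /= addr0.
have -> : Im (- (w / 2) + 0 +i* (- thhat K w)) = - (arg_sqrt_eps w + thhat K w).
  by rewrite Im_add Im_opp /= Im_half /arg_sqrt_eps /arg_eps opprD.
rewrite cmod_cexp expRN cosN; have -> : pi - arg_sqrt_eps w - thhat K w = - (arg_sqrt_eps w + thhat K w) + pi by ring.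
by rewrite cosDpi cosN; ring.
Qed.

(** Across the tilted direction, the period has a height of order 1 / |sqrt(eps)|, uniformly up to
    the edges of the sector. *)
Lemma pheight_ge w : Sdom K w -> pi * gap_cos (gam K) / cmod (sqrt_eps w) <= pheight K w.
Proof.
move=> Sw; rewrite pheightE mulrAC; apply: ler_wpM2l.
  by rewrite divr_ge0 ?cmod_ge0 // ltW.
by have [] := angle_bounds Sw.
Qed.

Lemma pheight_gt0 w : Sdom K w -> 0 < pheight K w.
Proof.
move=> Sw; apply: lt_le_trans (pheight_ge Sw).
by rewrite divr_gt0 ?mulr_gt0 ?gap_cos_gt0 // cmod_gt0 sqrt_eps_neq0.
Qed.

Lemma cos_th_gt0 w : Sdom K w -> 0 < cos (thhat K w).
Proof.
move=> Sw; have [h _] := angle_bounds Sw; apply: cos_gt0_pihalf.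
by rewrite -ltr_norml.
Qed.

Hypotheses (c00 : 0 < c0 K) (h0 : 0 < hgt K) (kap0 : 0 < kap K) (kap1 : kap K < 2^-1).
Hypothesis r0 : 0 < rdisc K.
Hypothesis small : forall w, Sdom K w ->
  hgt K * cmod (sqrt_eps w) + c0 K <= pi * gap_cos (gam K) / 4.

Lemma sigma_bound w (u : R) :
  `|sigma_hat K w u - u * tan (thhat K w)| <= c0 K / cmod (sqrt_eps w) * `|tan (thhat K w)|.
Proof.
rewrite /sigma_hat -cmod_sqrt_eps; set a := c0 K / _; set T := tan _.
have a0 : 0 <= a by rewrite divr_ge0 ?cmod_ge0 // ltW.
case: ifP => [ua|/negbT]; first by rewrite sub0r normrN normrM ler_wpM2r.
rewrite -ltNge => ua; have -> : (u - Num.sg u * a) * T - u * T = - (Num.sg u * a * T) by ring.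
rewrite normrN normrM ler_wpM2r // normrM (ger0_norm a0) -[leRHS]mul1r ler_wpM2r //.
by rewrite normr_sg; case: (u != 0).
Qed.

(** The curve bounding a time domain deviates from the tilted line only through the flat part of
    [sigma_hat], of half-width c0 / |sqrt(eps)|. *)
Lemma eta_sigma w t : Sdom K w ->
  `|(eta K w t) - cos (thhat K w) * (Im t - sigma_hat K w (Re t))| <= c0 K / cmod (sqrt_eps w).
Proof.
move=> Sw; have cth := cos_th_gt0 Sw; rewrite etaE.
have -> : Im t * cos (thhat K w) - Re t * sin (thhat K w) -
    cos (thhat K w) * (Im t - sigma_hat K w (Re t)) =
    cos (thhat K w) * (sigma_hat K w (Re t) - Re t * tan (thhat K w)).
  by rewrite /tan; field; rewrite gt_eqF.
rewrite normrM (gtr0_norm cth) (le_trans (ler_wpM2l (ltW cth) (sigma_bound _ _))) //.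
rewrite mulrCA -[leRHS]mulr1; apply: ler_wpM2l; first by rewrite divr_ge0 ?cmod_ge0 // ltW.
by rewrite -{1}(gtr0_norm cth) -normrM /tan mulrC divfK ?gt_eqF // sin_max.
Qed.

(** The choice of [c0] and of the radius in eps makes both deviations together at most a quarter of
    a period height; such fractions decide below which multiples of the period can occur. *)
Lemma quarter w : Sdom K w -> hgt K + c0 K / cmod (sqrt_eps w) <= pheight K w / 4.
Proof.
move=> Sw; have s0 : 0 < cmod (sqrt_eps w) by rewrite cmod_gt0 sqrt_eps_neq0.
have := pheight_ge Sw; rewrite ler_pdivrMr // => h1.
rewrite -(ler_pM2r s0) mulrDl divfK ?gt_eqF // (le_trans (small Sw)) //.
by move: h1; move: (pi * _) (cmod _) (pheight K w) => a b p; lra.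
Qed.

Lemma upperD w t : Sdom K w -> Im t < hgt K + sigma_hat K w (Re t) -> eta K w t < pheight K w / 4.
Proof.
move=> Sw h; apply: lt_le_trans (quarter Sw).
have := eta_sigma t Sw; rewrite ler_norml => /andP[_ h1].
have cth := cos_th_gt0 Sw; have c1 := cos_le1 (thhat K w).
have : cos (thhat K w) * (Im t - sigma_hat K w (Re t)) < hgt K.
  apply: (@lt_le_trans _ _ (cos (thhat K w) * hgt K)); last by rewrite ler_piMl // ltW.
  by rewrite ltr_pM2l // ltrBlDr.
by move: h1; move: (eta _ _ _) (cos _ * _) (_ / _) (hgt K) => a b d e; lra.
Qed.

Lemma lowerU w t : Sdom K w -> - hgt K + sigma_hat K w (Re t) < Im t -> - (pheight K w / 4) < eta K w t.
Proof.
move=> Sw h; rewrite ltrNl; apply: lt_le_trans (quarter Sw).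
have := eta_sigma t Sw; rewrite ler_norml => /andP[h1 _].
have cth := cos_th_gt0 Sw; have c1 := cos_le1 (thhat K w).
have : - hgt K < cos (thhat K w) * (Im t - sigma_hat K w (Re t)).
  apply: (@le_lt_trans _ _ (cos (thhat K w) * - hgt K)); last by rewrite ltr_pM2l // ltrBrDr.
  by rewrite mulrN lerN2 ler_piMl // ltW.
by move: h1; move: (eta _ _ _) (cos _ * _) (_ / _) (hgt K) => a b d e; lra.
Qed.

(* [Zt] turns [t |-> x(t)] into a Moebius map, and [t] is determined by [Zt] up
   to multiples of the period. *)
Definition Zt w t : C := cexp (2 * (sqrt_eps w * t)).

Lemma csinhE w t : csinh (sqrt_eps w * t) = (Zt w t - 1) / (2 * cexp (sqrt_eps w * t)).
Proof.
rewrite /csinh /Zt cexpN; have -> : 2 * (sqrt_eps w * t) = sqrt_eps w * t + sqrt_eps w * t by ring.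
by rewrite cexpD; field; rewrite cexp_neq0.
Qed.

Lemma ccoshE w t : ccosh (sqrt_eps w * t) = (Zt w t + 1) / (2 * cexp (sqrt_eps w * t)).
Proof.
rewrite /ccosh /Zt cexpN; have -> : 2 * (sqrt_eps w * t) = sqrt_eps w * t + sqrt_eps w * t by ring.
by rewrite cexpD; field; rewrite cexp_neq0.
Qed.

Lemma csinh_eq0 w t : (csinh (sqrt_eps w * t) == 0) = (Zt w t == 1).
Proof.
rewrite csinhE mulf_eq0 subr_eq0 invr_eq0 mulf_eq0 (negPf (cexp_neq0 _)) orbF pnatr_eq0 orbF //.
Qed.

Lemma xtE w t : Zt w t != 1 -> xt w t = - sqrt_eps w * (Zt w t + 1) / (Zt w t - 1).
Proof.
move=> Z1; rewrite /xt csinhE ccoshE; field.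
by rewrite cexp_neq0 subr_eq0 Z1.
Qed.

Lemma Zt_period w t (k : int) : Zt w (t + period w *~ k) = Zt w t.
Proof.
rewrite /Zt -(cexp_per (2 * (sqrt_eps w * t)) (- k)); congr cexp.
have s0 := sqrt_eps_neq0 w.
have h : 2 * sqrt_eps w * period w = - twopii.
  rewrite /period; apply: (@eq_trans _ _ (- (2 * (0 +i* pi)))); first by field.
  by congr (- _); apply: complex_ext; rewrite ?Re_mul ?Im_mul /=; ring.
by rewrite !mulrDr; congr (_ + _); rewrite !mulrzAr mulrA h mulNrz mulrNz.
Qed.

Lemma Zt_eq w t t' : Zt w t = Zt w t' -> exists k : int, t' = t + period w *~ k.
Proof.
move=> /esym /cexp_eq [k kE]; exists (- k); have s0 := sqrt_eps_neq0 w.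
have h : 2 * sqrt_eps w * period w = - twopii.
  rewrite /period; apply: (@eq_trans _ _ (- (2 * (0 +i* pi)))); first by field.
  by congr (- _); apply: complex_ext; rewrite ?Re_mul ?Im_mul /=; ring.
have s20 : 2 * sqrt_eps w != 0 by rewrite mulf_neq0 // pnatr_eq0.
apply: (mulfI s20); rewrite -[2 * sqrt_eps w * t']mulrA kE.
by rewrite mulrDr mulrzAr h mulNrz mulrNz opprK mulrA.
Qed.

Lemma Zt_of_x w t x : Zt w t != 1 -> xt w t = x ->
  x + sqrt_eps w != 0 /\ Zt w t = (x - sqrt_eps w) / (x + sqrt_eps w).
Proof.
move=> Z1 <-; rewrite xtE //; set s := sqrt_eps w; set Z := Zt w t in Z1 *.
have s0 : s != 0 := sqrt_eps_neq0 w.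
have Z10 : Z - 1 != 0 by rewrite subr_eq0.
have E : - s * (Z + 1) / (Z - 1) + s = - 2 * s / (Z - 1) by field.
rewrite E; have n0 : - 2 * s / (Z - 1) != 0.
  apply: mulf_neq0; last by rewrite invr_eq0.
  by apply: mulf_neq0 => //; rewrite oppr_eq0 pnatr_eq0.
by split=> //; field; rewrite ?oppr_eq0 ?s0 ?Z10 ?pnatr_eq0.
Qed.

Lemma xt_of_Z w t x : x + sqrt_eps w != 0 -> Zt w t = (x - sqrt_eps w) / (x + sqrt_eps w) ->
  Zt w t != 1 /\ xt w t = x.
Proof.
move=> xs ZE; have s0 := sqrt_eps_neq0 w.
have Z1 : Zt w t - 1 = - 2 * sqrt_eps w / (x + sqrt_eps w) by rewrite ZE; field.
have Z10 : Zt w t - 1 != 0.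
  rewrite Z1; apply: mulf_neq0; last by rewrite invr_eq0.
  by apply: mulf_neq0 => //; rewrite oppr_eq0 pnatr_eq0.
have Zn : Zt w t != 1 by rewrite -subr_eq0.
split=> //; rewrite xtE // Z1 ZE; field.
by rewrite ?xs ?s0 ?oppr_eq0 ?pnatr_eq0.
Qed.

Lemma not_Nhat w t : Zt w t != 1 -> cmod (xt w t) < rdisc K -> ~ Nhat K w t.
Proof.
rewrite -csinh_eq0 => Z1 xr /connected_component_sub /=; apply/negP; rewrite -ltNge.
move: xr; have -> : cmod (xt w t) =
    cmod (sqrt_eps w * ccosh (sqrt_eps w * t)) / cmod (csinh (sqrt_eps w * t)).
  by rewrite -cmodV -cmodM /xt !mulNr cmodN.
by rewrite ltr_pdivrMr // cmod_gt0.
Qed.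

Lemma Nhat0 w : Nhat K w 0.
Proof.
apply: connected_component_refl; rewrite /outside /= mulr0.
by rewrite /csinh oppr0 subrr mul0r cmod0 mulr0 cmod_ge0.
Qed.

Lemma pole w t : Zt w t = 1 -> exists k : int, t = period w *~ k.
Proof.
move=> Z1; have /Zt_eq [k kE] : Zt w 0 = Zt w t by rewrite Z1 /Zt !mulr0 cexp0.
by exists k; rewrite kE add0r.
Qed.

Lemma half_kap : 2^-1 + kap K < 1.
Proof. by move: kap1; move: (kap K) => k; lra. Qed.

Lemma int_small (p : R) (k : int) : 0 < p -> - p < p * k%:~R -> p * k%:~R < p -> k = 0.
Proof.
move=> p0; rewrite -[X in _ < X -> _ -> _]/(_) -{1}[p]mulr1 -mulrN ltr_pM2l // => h1.
rewrite -[X in _ < X]mulr1 ltr_pM2l // => h2; apply/eqP.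
have : - 1 < k by rewrite -(ltr_int R) rmorphN rmorph1.
have : k < 1 by rewrite -(ltr_int R) rmorph1.
by case: k {h1 h2} => [[|k]|[|k]].
Qed.

(** A pole is a multiple of the period. In this domain its height is less than one period in
    absolute value, so it would be 0, which belongs to [Nhat]. *)
Lemma GamD_Z w t : Sdom K w -> GamD K w t -> Zt w t != 1.
Proof.
move=> Sw [nN up /aboveE lo]; apply/eqP => /pole [k kE]; apply: nN.
suff -> : t = 0 by exact: Nhat0.
have p0 := pheight_gt0 Sw; have := upperD Sw up; rewrite kE eta_int -/(pheight K w) => h1.
move: lo; rewrite kE eta_int -/(pheight K w) => h2.
rewrite (_ : k = 0) ?mulr0z //; apply: (int_small p0).
  by apply: lt_trans h2; rewrite ltrN2 -[ltRHS]mul1r ltr_pM2r // half_kap.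
by apply: (lt_trans h1); rewrite ltr_pdivrMr // ltr_pMr // ltr1n.
Qed.

Lemma GamU_Z w t : Sdom K w -> GamU K w t -> Zt w t != 1.
Proof.
move=> Sw [nN lo /belowE up]; apply/eqP => /pole [k kE]; apply: nN.
suff -> : t = 0 by exact: Nhat0.
have p0 := pheight_gt0 Sw; have := lowerU Sw lo; rewrite kE eta_int -/(pheight K w) => h1.
move: up; rewrite kE eta_int -/(pheight K w) => h2.
rewrite (_ : k = 0) ?mulr0z //; apply: (int_small p0).
  by apply: lt_trans h1; rewrite ltrN2 ltr_pdivrMr // ltr_pMr // ltr1n.
by apply: (lt_trans h2); rewrite -[ltRHS]mul1r ltr_pM2r // half_kap.
Qed.

Lemma GamDU w t : Sdom K w -> ~ Nhat K w t ->
  - (pheight K w / 2) <= eta K w t <= pheight K w / 2 -> GamD K w t \/ GamU K w t.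
Proof.
move=> Sw nN /andP[e1 e2]; have p0 := pheight_gt0 Sw.
have hk : pheight K w / 2 < (2^-1 + kap K) * pheight K w.
  by rewrite mulrC ltr_pM2r // ltrDl.
have [h|h] := ltP (Im t) (hgt K + sigma_hat K w (Re t)); [left | right]; split=> //.
- by apply/aboveE; rewrite (lt_le_trans _ e1) // ltrN2.
- apply: lt_le_trans h; rewrite ltrD2r; apply: (@lt_trans _ _ 0) => //; by rewrite oppr_lt0.
- by apply/belowE; rewrite (le_lt_trans e2).
Qed.

(** Among the times over [x], one has height within half a period of 0; [GamDU] places it in one of
    the two domains. *)
Lemma cover_disc w x : Sdom K w -> cmod x < rdisc K -> x ^+ 2 != eps w -> OmD K w x \/ OmU K w x.
Proof.
move=> Sw xr; rewrite -sqrt_eps_sq eqf_sqr negb_or => /andP[xs1 xs2].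
have xs0 : x + sqrt_eps w != 0 by rewrite addr_eq0.
have Z0 : (x - sqrt_eps w) / (x + sqrt_eps w) != 0 by rewrite mulf_neq0 ?invr_eq0 // subr_eq0.
have [u uE] := cexp_surj Z0; have s0 := sqrt_eps_neq0 w.
pose t0 := u / (2 * sqrt_eps w).
have [k kP] := window (eta K w t0) (pheight_gt0 Sw).
pose t := t0 + period w *~ k.
have ZE : Zt w t = (x - sqrt_eps w) / (x + sqrt_eps w).
  by rewrite /t Zt_period /Zt -uE /t0; congr cexp; field.
have [Z1 xtx] := xt_of_Z xs0 ZE.
have nN : ~ Nhat K w t by apply: not_Nhat; rewrite ?xtx.
have [|G|G] := GamDU Sw nN; first by rewrite /t etaD eta_int -/(pheight K w).
  by left; exists t.
by right; exists t.
Qed.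

(** The times over [x] in the two domains differ by k periods, and the height bounds leave k = 0 or
    k = 1. The latter is the component C; for k = 0 the sign of Re t decides, since on the imaginary
    axis x(t) is outside the disc. *)
Lemma overlap w x : Sdom K w -> cmod x < rdisc K ->
  (forall t, Re t = 0 -> `|Im t| < hgt K -> Zt w t != 1 -> rdisc K <= cmod (xt w t)) ->
  OmD K w x -> OmU K w x -> [\/ OmR K w x, OmL K w x | OmC K w x].
Proof.
move=> Sw xr axis [t Gt tx] [t' Gt' tx'].
have Zn := GamD_Z Sw Gt; have Zn' := GamU_Z Sw Gt'.
have [_ ZE] := Zt_of_x Zn tx; have [_ ZE'] := Zt_of_x Zn' tx'.
have [k kE] : exists k : int, t' = t + period w *~ k by apply: Zt_eq; rewrite ZE ZE'.
have p0 := pheight_gt0 Sw; move: (Gt) (Gt') => [nN up /aboveE lo] [nN' lo' /belowE up'].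
have h1 := upperD Sw up; have h2 := lowerU Sw lo'.
have : k = 0 \/ k = 1.
  move: up' h2; rewrite kE etaD eta_int -/(pheight K w) => h3 h4.
  have h5 : - pheight K w < pheight K w * k%:~R.
    by move: h1 h4 p0; move: (pheight K w * k%:~R) (eta _ _ _) (pheight _ _) => a b d; lra.
  have h6 : pheight K w * k%:~R < pheight K w * 2.
    have : (2^-1 + kap K) * pheight K w < 1 * pheight K w by rewrite ltr_pM2r // half_kap.
    by move: lo h3; move: (pheight K w * k%:~R) ((2^-1 + kap K) * pheight K w) (eta _ _ _) (pheight _ _) => a b d e; lra.
  have : -1 < k.
    by rewrite -(ltr_int R) rmorphN rmorph1 -(ltr_pM2l p0) mulrN mulr1.
  have : k < 2 by rewrite -(ltr_int R) -(ltr_pM2l p0).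
  by case: k {kE h3 h4 h5 h6} => [[|[|k]]|[|k]] //; [left|right].
case=> k0; rewrite k0 ?mulr0z ?addr0 in kE; last first.
  by apply: Or33; exists t => //; split=> //; move: kE; rewrite mulr1z => <-.
have [Rt|Rt|Rt] := ltgtP (Re t) 0.
- by apply: Or31; exists t => //; split=> //; rewrite -kE.
- by apply: Or32; exists t => //; split=> //; rewrite -kE.
have s00 : sigma_hat K w 0 = 0.
  rewrite /sigma_hat normr0 ifT // divr_ge0 ?sqrtr_ge0 // ltW //.
move: up lo'; rewrite kE Rt s00 !addr0 => up lo'.
have := axis t Rt _ Zn; rewrite ltr_norml up lo' => /(_ isT).
by rewrite tx leNgt xr.
Qed.

Lemma zero_OmD w : Sdom K w -> OmD K w 0.
Proof.
move=> Sw; have s0 := sqrt_eps_neq0 w; have p0 := pheight_gt0 Sw.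
(* Half a period away from 0 one has Zt = -1, that is, x = 0. *)
pose t := - ((2^-1 : R)%:C * period w).
have ZE : Zt w t = (0 - sqrt_eps w) / (0 + sqrt_eps w).
  rewrite sub0r add0r mulNr divff // /Zt /t /period.
  have -> : 2 * (sqrt_eps w * - ((2^-1 : R)%:C * (- (0 +i* pi) / sqrt_eps w))) = 0 +i* pi.
    by rewrite fmorphV rmorph_nat; field.
  by apply: complex_ext; rewrite ?Re_cexp ?Im_cexp /= ?expR0 ?cospi ?sinpi ?oppr0 mul1r.
have xs : 0 + sqrt_eps w != 0 by rewrite add0r.
have [Z1 x0] := xt_of_Z xs ZE.
have et : eta K w t = - (pheight K w / 2) by rewrite /t etaN etaZ mulrC.
exists t => //; split.
- by apply: not_Nhat => //; rewrite x0 cmod0.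
- rewrite ltNge; apply/negP => h.
  have : - (pheight K w / 4) < eta K w t.
    apply: (lowerU Sw); apply: lt_le_trans h; rewrite ltrD2r.
    by apply: (@lt_trans _ _ 0) => //; rewrite oppr_lt0.
  by rewrite et; move: p0; move: (pheight _ _) => p; lra.
- by apply/aboveE; rewrite et ltrN2 mulrC ltr_pM2r // ltrDl.
Qed.

(** As eps tends to 0, x(t) approaches -1 / t, whose modulus exceeds 1 / hgt > rdisc on this part of
    the axis. *)
Lemma axis_bound : hgt K * rdisc K < 1 -> exists2 d : R, 0 < d & forall w, cmod (sqrt_eps w) < d ->
  forall t, Re t = 0 -> `|Im t| < hgt K -> Zt w t != 1 -> rdisc K <= cmod (xt w t).
Proof.
move=> hr; have hr0 : 0 < hgt K * rdisc K by rewrite mulr_gt0.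
have [q qE] : exists q, q = hgt K * rdisc K by eexists.
rewrite -qE in hr hr0.
(* The solution of 1 - e = (1 + e) q, where 1 - e bounds the cosh from below and (1 + e) |z| the
   sinh from above. *)
pose e := (1 - q) / (1 + q); have e0 : 0 < e by rewrite divr_gt0 ?subr_gt0 // addr_gt0.
have [d d0 dP] := (cderP _ _ _).1 (@cexp_der0 R) e e0.
exists (Num.min d 1 / hgt K); first by rewrite divr_gt0 // lt_min d0 ltr01.
move=> w ws t Rt It Zn.
have [z zE] : exists z, z = sqrt_eps w * t by eexists.
have ct : cmod t < hgt K.
  apply: le_lt_trans It; apply: (le_trans (cmod_ReIm t)); by rewrite Rt normr0 add0r.
have s0 : 0 < cmod (sqrt_eps w) by rewrite cmod_gt0 sqrt_eps_neq0.
have cz : cmod z < Num.min d 1.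
  rewrite zE cmodM; apply: (@lt_trans _ _ (cmod (sqrt_eps w) * hgt K)); first by rewrite ltr_pM2l.
  by rewrite -ltr_pdivlMr.
move: (cz); rewrite lt_min => /andP[zd z1].
have := dP z; have := dP (- z); rewrite !subr0 cmodN => /(_ zd) /= h2 /(_ zd) /= h1.
move: h1 h2; rewrite !subr0 !mul1r cexp0 cmodN => h1 h2.
have n2 : (2 : C) != 0 by rewrite pnatr_eq0.
have sh : cmod (csinh z) <= (1 + e) * cmod z.
  have -> : csinh z = ((cexp z - 1 - z) - (cexp (- z) - 1 - - z)) / 2 + z by rewrite /csinh; field.
  rewrite (le_trans (cmodD _ _)) //; have -> : (1 + e) * cmod z = e * cmod z + cmod z by ring.
  rewrite lerD2r cmodM cmodV cmod2 ler_pdivrMr //.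
  by rewrite (le_trans (cmodB _ _)) // mulr_natr mulr2n lerD.
have ch : 1 - e <= cmod (ccosh z).
  have -> : ccosh z = 1 - - ((cexp z - 1 - z) + (cexp (- z) - 1 - - z)) / 2 by rewrite /ccosh; field.
  apply: le_trans (lerB_cmod _ _); rewrite cmod1 lerD2l lerN2 cmodM cmodV cmod2 cmodN ler_pdivrMr //.
  rewrite (le_trans (cmodD _ _)) // mulr_natr mulr2n lerD //.
    by apply: (le_trans h1); rewrite ler_piMr // ltW.
  by apply: (le_trans h2); rewrite ler_piMr // ltW.
have sh0 : 0 < cmod (csinh z) by rewrite cmod_gt0 zE csinh_eq0.
have -> : cmod (xt w t) = cmod (sqrt_eps w) * cmod (ccosh z) / cmod (csinh z).
  by rewrite -cmodV -cmodM -cmodM /xt zE !mulNr cmodN.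
rewrite ler_pdivlMr //.
apply: (@le_trans _ _ (rdisc K * ((1 + e) * (cmod (sqrt_eps w) * hgt K)))).
  apply: ler_wpM2l; first exact: ltW.
  apply: (le_trans sh); apply: ler_wpM2l; first by rewrite addr_ge0 // ltW.
  by rewrite zE cmodM ler_wpM2l // ltW.
have -> : rdisc K * ((1 + e) * (cmod (sqrt_eps w) * hgt K)) = cmod (sqrt_eps w) * ((1 + e) * q).
  by rewrite qE; ring.
apply: ler_wpM2l; first exact: ltW.
apply: le_trans ch; rewrite le_eqVlt; apply/orP; left; apply/eqP; rewrite /e; field.
by rewrite gt_eqF // addr_gt0.
Qed.

(** * Openness of the sectorial domains *)

Section RealCvg.
Context {T : Type} {F : set_system T} {FF : ProperFilter F}.

Lemma cvg_Re (f : T -> C) a : ccvg F f a -> (fun q => Re (f q)) @ F --> Re a.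
Proof.
move=> fa; apply/cvgrPdist_lt => e e0; apply: filterS (fa e e0) => q /= h.
by rewrite distrC (le_lt_trans _ h) // -Re_opp -Re_add cmod_Re.
Qed.

Lemma cvg_Im (f : T -> C) a : ccvg F f a -> (fun q => Im (f q)) @ F --> Im a.
Proof.
move=> fa; apply/cvgrPdist_lt => e e0; apply: filterS (fa e e0) => q /= h.
by rewrite distrC (le_lt_trans _ h) // -Im_opp -Im_add cmod_Im.
Qed.

Lemma ccvg_ReIm (f g : T -> R) (a b : R) : f @ F --> a -> g @ F --> b ->
  ccvg F (fun q => f q +i* g q) (a +i* b).
Proof.
move=> /cvgrPdist_lt fa /cvgrPdist_lt gb e e0; have e2 : 0 < e / 2 by rewrite divr_gt0.
apply: filterS2 (fa _ e2) (gb _ e2) => q /=; rewrite distrC => h1; rewrite distrC => h2.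
rewrite (le_lt_trans (cmod_ReIm _)) //= .
by move: h1 h2; move: `|_ - _| `|_ - _| => x y; lra.
Qed.

Lemma cvg_pos (f : T -> R) a : f @ F --> a -> 0 < a -> F [set q | 0 < f q].
Proof. by move=> fa a0; move/cvgrPdist_lt: fa => /(_ a a0); apply: filterS => q /=; rewrite ltr_norml => /andP[]; lra. Qed.
End RealCvg.

(* A formula without case distinction, from which continuity in [(w, u)] is
   immediate. *)
Definition sigma_alt w (u : R) : R := let a := c0 K / cmod (sqrt_eps w) in
  ((u - a + `|u - a|) / 2 + (u + a - `|u + a|) / 2) * tan (thhat K w).

Lemma sigma_altE w (u : R) : sigma_hat K w u = sigma_alt w u.
Proof.
rewrite /sigma_hat /sigma_alt -cmod_sqrt_eps; set a := c0 K / _; set T := tan _.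
have a0 : 0 < a by rewrite divr_gt0 // cmod_gt0 sqrt_eps_neq0.
case: ifP => [|/negbT].
  rewrite ler_norml => /andP[h1 h2]; rewrite ler0_norm ?subr_le0 // ger0_norm; last by lra.
  by rewrite (_ : (_ + _) / 2 + _ = 0) ?mul0r //; field.
rewrite -ltNge ltr_normr => /orP[h|h].
  have u0 : 0 < u by lra.
  rewrite gtr0_sg // mul1r ger0_norm; last by lra.
  by rewrite ger0_norm; [congr (_ * _); field | lra].
have u0 : u < 0 by lra.
rewrite ltr0_sg // mulN1r opprK ler0_norm; last by lra.
by rewrite ler0_norm; [congr (_ * _); field | lra].
Qed.

Lemma Sdom_open w : Sdom K w -> cnbhs w (Sdom K).
Proof.
move=> [h1 /andP[h2 h3]].
have c1 : ccvg (cnbhs w) (@eps R) (eps w) := cder_cont (cexp_der w).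
have n1 : cnbhs w [set v | cmod (eps v) < rho K].
  have d0 : 0 < rho K - cmod (eps w) by rewrite subr_gt0.
  apply: filterS (c1 _ d0) => v /= h; have := cmodD (eps v - eps w) (eps w); rewrite subrK.
  by move: h; move: (cmod _) (cmod _) (cmod _) => a b c; lra.
have m0 : 0 < Num.min (Im w - (pi - 2 * gam K)) (3 * pi + 2 * gam K - Im w).
  by rewrite lt_min !subr_gt0 h2 h3.
apply: filterS2 n1 (cnbhs_ball w m0) => v /= r1; rewrite lt_min => /andP[r2 r3].
split=> //; rewrite /arg_eps; have := cmod_Im (v - w); rewrite Im_add Im_opp ler_norml => /andP[r4 r5].
by move: r2 r3 r4 r5; move: (cmod _) => c *; apply/andP; split; lra.
Qed.

(** A time over [x] depending continuously on (w, x), obtained from the local logarithm of Zt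
    relative to its value at [t0]. Openness of the domains then follows from the strictness of the
    inequalities in time. *)
Lemma open_common w0 x0 t0 : Sdom K w0 -> cmod x0 < rdisc K -> Zt w0 t0 != 1 -> xt w0 t0 = x0 ->
  exists tt : C * C -> C, let F := filter_prod (cnbhs w0) (cnbhs x0) in
   [/\ ccvg F tt t0, F [set q | Zt q.1 (tt q) != 1 /\ xt q.1 (tt q) = q.2] &
       F [set q | Sdom K q.1 /\ ~ Nhat K q.1 (tt q)]].
Proof.
move=> Sw xr Z1 xtx; have [xs0 Z0E] := Zt_of_x Z1 xtx.
set F := filter_prod (cnbhs w0) (cnbhs x0).
have FF : ProperFilter F.
  split; last exact: filter_prod_filter.
  by move=> [[A B] /= [/cnbhs_self wA /cnbhs_self xB] AB]; exact: (AB (w0, x0)).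
pose s (q : C * C) := sqrt_eps q.1.
have cw : ccvg F (fun q => q.1) w0 by move=> e e0; exact: (cvg_fst (ccvg_id w0 e0)).
have cx : ccvg F (fun q => q.2) x0 by move=> e e0; exact: (cvg_snd (ccvg_id x0 e0)).
have cs : ccvg F s (sqrt_eps w0).
  apply: (@ccvg_comp _ _ _ _ (fun q : C * C => q.1 / 2)); last exact: (cder_cont (cexp_der _)).
  by apply: ccvgM => //; exact: ccvg_cst.
have Z00 : Zt w0 t0 != 0 := cexp_neq0 _.
pose z q := (q.2 - s q) / (q.2 + s q) / Zt w0 t0.
have cz : ccvg F z 1.
  have -> : (1 : C) = (x0 - sqrt_eps w0) / (x0 + sqrt_eps w0) / Zt w0 t0 by rewrite -Z0E divff.
  apply: ccvgM; last exact: ccvg_cst.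
  by apply: ccvgM; [exact: ccvgB | apply: ccvgV => //; exact: ccvgD].
have czl : ccvg F (fun q => clog1 (z q)) 0.
  move=> e e0; have [d d0 dP] := @clog1_cvg R e e0.
  by apply: filterS (cz d d0) => q /dP.
have czk : F [set q | cexp (clog1 (z q)) = z q].
  by have [d d0 dP] := @clog1K R; apply: filterS (cz d d0) => q /dP.
pose tt q := (2 * (sqrt_eps w0 * t0) + clog1 (z q)) / (2 * s q).
have s0 := sqrt_eps_neq0 w0.
have n2 : (2 : C) != 0 by rewrite pnatr_eq0.
exists tt => /=; split.
- have -> : t0 = (2 * (sqrt_eps w0 * t0) + 0) / (2 * sqrt_eps w0) by field.
  rewrite {1}(_ : t0 = (2 * (sqrt_eps w0 * t0) + 0) / (2 * sqrt_eps w0)); last by field.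
  apply: ccvgM.
    by apply: ccvgD => //; rewrite (_ : (2 * (sqrt_eps w0 * t0) + 0) / (2 * sqrt_eps w0) = t0); [exact: ccvg_cst | field].
  apply: ccvgV; first by rewrite mulf_neq0.
  by apply: ccvgM => //; exact: ccvg_cst.
- have nz : F [set q | q.2 + s q != 0].
    apply: filterS (ccvg_neq0 xs0 (ccvgD cx cs)) => q /=; rewrite -cmod_gt0; apply: le_lt_trans.
    by rewrite divr_ge0 // cmod_ge0.
  apply: filterS2 nz czk => q /= qs qz; apply: xt_of_Z => //.
  rewrite /Zt /tt; have sq := sqrt_eps_neq0 q.1.
  have -> : 2 * (sqrt_eps q.1 * ((2 * (sqrt_eps w0 * t0) + clog1 (z q)) / (2 * s q))) =
     2 * (sqrt_eps w0 * t0) + clog1 (z q) by rewrite /s; field.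
  by rewrite cexpD qz /z -/(Zt w0 t0) mulrC divfK.
- have nz : F [set q | q.2 + s q != 0].
    apply: filterS (ccvg_neq0 xs0 (ccvgD cx cs)) => q /=; rewrite -cmod_gt0; apply: le_lt_trans.
    by rewrite divr_ge0 // cmod_ge0.
  have Sn : F [set q | Sdom K q.1] by apply: (@cvg_fst _ _ (cnbhs w0) (cnbhs x0) _ _ (Sdom_open Sw)).
  have xn : F [set q | cmod q.2 < rdisc K].
    have d0 : 0 < rdisc K - cmod x0 by rewrite subr_gt0.
    apply: filterS (cx _ d0) => q /= h; have := cmodD (q.2 - x0) x0; rewrite subrK.
    by move: h; move: (cmod _) (cmod _) (cmod _) => a b c; lra.
  apply: filterS2 Sn (filterI nz (filterI czk xn)) => q /= Sq [qs [qz qx]].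
  split=> //; have [] := @xt_of_Z q.1 (tt q) q.2 qs _; last first.
    by move=> h1 h2; apply: not_Nhat; rewrite ?h2.
  rewrite /Zt /tt; have sq := sqrt_eps_neq0 q.1.
  have -> : 2 * (sqrt_eps q.1 * ((2 * (sqrt_eps w0 * t0) + clog1 (z q)) / (2 * s q))) =
     2 * (sqrt_eps w0 * t0) + clog1 (z q) by rewrite /s; field.
  by rewrite cexpD qz /z -/(Zt w0 t0) mulrC divfK.
Qed.

Section Limits.
Context {T : Type} {F : set_system T} {FF : ProperFilter F}.
Variables (ww tt : T -> C) (w0 t0 : C).
Hypotheses (cw : ccvg F ww w0) (ct : ccvg F tt t0) (Sw : Sdom K w0).

Lemma thhat_cvg : thhat K (ww q) @[q --> F] --> thhat K w0.
Proof.
rewrite /thhat /arg_sqrt_eps /arg_eps; apply: cvgM; first exact: cvg_cst.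
apply: cvgB; first exact: cvg_cst.
by apply: cvgM; [exact: cvg_Im | exact: cvg_cst].
Qed.

Lemma sigma_cvg : sigma_hat K (ww q) (Re (tt q)) @[q --> F] --> sigma_hat K w0 (Re t0).
Proof.
rewrite sigma_altE (_ : (fun q => _) = fun q => sigma_alt (ww q) (Re (tt q))); last first.
  by apply/funext => q; rewrite sigma_altE.
have cs : cmod (sqrt_eps (ww q)) @[q --> F] --> cmod (sqrt_eps w0).
  have h : ccvg F (fun q => sqrt_eps (ww q)) (sqrt_eps w0).
    apply: (@ccvg_comp _ _ _ _ (fun q => ww q / 2)); last exact: (cder_cont (cexp_der _)).
    by apply: ccvgM => //; exact: ccvg_cst.
  apply/cvgrPdist_lt => e e0; apply: filterS (ccvg_cmod h e0) => q /=; by rewrite distrC.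
have ca : c0 K / cmod (sqrt_eps (ww q)) @[q --> F] --> c0 K / cmod (sqrt_eps w0).
  apply: cvgM; first exact: cvg_cst.
  by apply: cvgV => //; rewrite gt_eqF // cmod_gt0 sqrt_eps_neq0.
have ctan : tan (thhat K (ww q)) @[q --> F] --> tan (thhat K w0).
  apply: (cvg_comp _ _ thhat_cvg); apply: continuous_tan.
  by rewrite gt_eqF // cos_th_gt0.
have cR : (fun q => Re (tt q)) @ F --> Re t0 by exact: cvg_Re.
rewrite /sigma_alt; apply: cvgM => //; apply: cvgD.
  apply: cvgM; last exact: cvg_cst.
  by apply: cvgD; [exact: cvgB | apply: cvg_norm; exact: cvgB].
apply: cvgM; last exact: cvg_cst.
by apply: cvgB; [exact: cvgD | apply: cvg_norm; exact: cvgD].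
Qed.

Lemma cis_cvg : ccvg F (fun q => cis (- thhat K (ww q))) (cis (- thhat K w0)).
Proof.
apply: (@ccvg_comp _ _ _ _ (fun q => 0 +i* (- thhat K (ww q)))); last exact: (cder_cont (cexp_der _)).
by apply: ccvg_ReIm; [exact: cvg_cst | apply: cvgN; exact: thhat_cvg].
Qed.

Lemma eta_cvg (vv : T -> C) v : ccvg F vv v -> eta K (ww q) (vv q) @[q --> F] --> eta K w0 v.
Proof. by move=> cv; apply: cvg_Im; apply: ccvgM => //; exact: cis_cvg. Qed.

Lemma pheight_cvg : pheight K (ww q) @[q --> F] --> pheight K w0.
Proof.
apply: eta_cvg; apply: ccvgM; first exact: ccvg_cst.
apply: ccvgV; first exact: sqrt_eps_neq0.
apply: (@ccvg_comp _ _ _ _ (fun q => ww q / 2)); last exact: (cder_cont (cexp_der _)).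
by apply: ccvgM => //; exact: ccvg_cst.
Qed.

Lemma near_upper : Im t0 < hgt K + sigma_hat K w0 (Re t0) ->
  F [set q | Im (tt q) < hgt K + sigma_hat K (ww q) (Re (tt q))].
Proof.
move=> h; have : hgt K + sigma_hat K (ww q) (Re (tt q)) - Im (tt q) @[q --> F] -->
    hgt K + sigma_hat K w0 (Re t0) - Im t0.
  apply: cvgB; last exact: cvg_Im.
  by apply: cvgD; [exact: cvg_cst | exact: sigma_cvg].
by move/cvg_pos; rewrite subr_gt0 => /(_ h); apply: filterS => q /=; rewrite subr_gt0.
Qed.

Lemma near_lower : - hgt K + sigma_hat K w0 (Re t0) < Im t0 ->
  F [set q | - hgt K + sigma_hat K (ww q) (Re (tt q)) < Im (tt q)].
Proof.
move=> h; have : Im (tt q) - (- hgt K + sigma_hat K (ww q) (Re (tt q))) @[q --> F] -->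
    Im t0 - (- hgt K + sigma_hat K w0 (Re t0)).
  apply: cvgB; first exact: cvg_Im.
  by apply: cvgD; [exact: cvg_cst | exact: sigma_cvg].
by move/cvg_pos; rewrite subr_gt0 => /(_ h); apply: filterS => q /=; rewrite subr_gt0.
Qed.

Lemma near_above : above (- ((2^-1 + kap K)%:C * period w0)) (thhat K w0) t0 ->
  F [set q | above (- ((2^-1 + kap K)%:C * period (ww q))) (thhat K (ww q)) (tt q)].
Proof.
move=> /aboveE h; have : eta K (ww q) (tt q) + (2^-1 + kap K) * pheight K (ww q) @[q --> F] -->
    eta K w0 t0 + (2^-1 + kap K) * pheight K w0.
  apply: cvgD; first exact: eta_cvg.
  by apply: cvgM; [exact: cvg_cst | exact: pheight_cvg].
move/cvg_pos; rewrite -ltrBlDr sub0r => /(_ h); apply: filterS => q /=.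
by rewrite -ltrBlDr sub0r => hq; apply/aboveE.
Qed.

Lemma near_below : below ((2^-1 + kap K)%:C * period w0) (thhat K w0) t0 ->
  F [set q | below ((2^-1 + kap K)%:C * period (ww q)) (thhat K (ww q)) (tt q)].
Proof.
move=> /belowE h; have : (2^-1 + kap K) * pheight K (ww q) - eta K (ww q) (tt q) @[q --> F] -->
    (2^-1 + kap K) * pheight K w0 - eta K w0 t0.
  apply: cvgB; last exact: eta_cvg.
  by apply: cvgM; [exact: cvg_cst | exact: pheight_cvg].
move/cvg_pos; rewrite subr_gt0 => /(_ h); apply: filterS => q /=.
by rewrite subr_gt0 => hq; apply/belowE.
Qed.
End Limits.

Lemma prodC_proper w x : ProperFilter (filter_prod (cnbhs w) (cnbhs x)).
Proof.
split; last exact: filter_prod_filter.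
by move=> [[A B] /= [/cnbhs_self wA /cnbhs_self xB] AB]; exact: (AB (w, x)).
Qed.

Lemma OmD_open w x : Sdom K w -> cmod x < rdisc K -> OmD K w x ->
  filter_prod (cnbhs w) (cnbhs x) [set q | Sdom K q.1 /\ OmD K q.1 q.2].
Proof.
move=> Sw xr [t Gt tx]; have Z1 := GamD_Z Sw Gt; move: Gt => [_ up lo].
have FF := prodC_proper w x.
have [tt [ctt xtn Nn]] := open_common Sw xr Z1 tx.
have cw : ccvg (filter_prod (cnbhs w) (cnbhs x)) (fun q => q.1) w.
  by move=> e e0; exact: (cvg_fst (ccvg_id w e0)).
have n1 := near_upper cw ctt Sw up; have n2 := near_above cw ctt lo.
apply: filterS3 xtn Nn (filterI (n1 FF) (n2 FF)) => q /= [_ xq] [Sq Nq] [u1 u2].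
by split=> //; exists (tt q).
Qed.

Lemma OmU_open w x : Sdom K w -> cmod x < rdisc K -> OmU K w x ->
  filter_prod (cnbhs w) (cnbhs x) [set q | Sdom K q.1 /\ OmU K q.1 q.2].
Proof.
move=> Sw xr [t Gt tx]; have Z1 := GamU_Z Sw Gt; move: Gt => [_ lo up].
have FF := prodC_proper w x.
have [tt [ctt xtn Nn]] := open_common Sw xr Z1 tx.
have cw : ccvg (filter_prod (cnbhs w) (cnbhs x)) (fun q => q.1) w.
  by move=> e e0; exact: (cvg_fst (ccvg_id w e0)).
have n1 := near_lower cw ctt Sw lo; have n2 := near_below cw ctt up.
apply: filterS3 xtn Nn (filterI (n1 FF) (n2 FF)) => q /= [_ xq] [Sq Nq] [u1 u2].
by split=> //; exists (tt q).
Qed.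

Lemma Sdom_onto (e : C) : e != 0 -> cmod e < rho K -> exists2 w, Sdom K w & eps w = e.
Proof.
move=> e0 er; have [u uE] := cexp_surj e0.
have p0 : 0 < 2 * pi :> R by rewrite mulr_gt0.
(* The sector of arguments is centred at 2 pi and is wider than 2 pi. *)
have [k /andP[k1 k2]] := window (Im u - 2 * pi) p0.
exists (u + twopii *~ k); last by rewrite /eps cexp_per.
have h : eps (u + twopii *~ k) = e by rewrite /eps cexp_per.
split; first by rewrite h.
rewrite /arg_eps Im_add Im_mulz /=; move: k1 k2 gam0.
by move: (2 * pi * k%:~R) (gam K) (Im u) => a g b h1 h2 h3; apply/andP; split; lra.
Qed.

(** x = sqrt(eps) would require Zt = 0, and x = - sqrt(eps) an infinite Zt. *)
Lemma not_branch w t x : Zt w t != 1 -> xt w t = x -> x ^+ 2 != eps w.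
Proof.
move=> Z1 tx; have [xs Zx] := Zt_of_x Z1 tx.
rewrite -sqrt_eps_sq eqf_sqr negb_or -addr_eq0 xs andbT; apply/eqP => e.
by have := cexp_neq0 (2 * (sqrt_eps w * t)); rewrite -/(Zt w t) Zx e subrr mul0r eqxx.
Qed.

Lemma OmD_sq w x : Sdom K w -> OmD K w x -> x ^+ 2 != eps w.
Proof. by move=> Sw [t Gt tx]; exact: not_branch (GamD_Z Sw Gt) tx. Qed.

Lemma OmU_sq w x : Sdom K w -> OmU K w x -> x ^+ 2 != eps w.
Proof. by move=> Sw [t Gt tx]; exact: not_branch (GamU_Z Sw Gt) tx. Qed.
End Consts.
End Geometry.

(** * Differentiability in two variables, and matrices *)

Section Bridge.
Context {R : realType}.
Local Notation C := R[i].
Local Notation Re := (@complex.Re R).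
Local Notation Im := (@complex.Im R).
Implicit Types (x y z d a b : C) (p q : C * C).

Lemma derivable_cder (f : C -> C) x : derivable f x 1 -> cder f x (derive1 f x).
Proof.
move=> df; have {}df : (fun h : C => h^-1 *: (f (h + x) - f x)) @ 0^' --> derive1 f x.
  move: df; rewrite /derivable /derive1.
  by under eq_fun do rewrite /= [_%:A]mulr1.
apply/cderP => e e0.
move/cvgrPdist_lt : df => /(_ e%:C); rewrite ltcR => /(_ e0).
rewrite /nbhs /= /dnbhs /within /= => /near0C [r r0 rP]; exists r => // y yr /=.
have [->|yx] := eqVneq y x; first by rewrite !subrr mulr0 subr0 cmod0 mulr0.
have yx0 : y - x != 0 by rewrite subr_eq0.
have := rP (y - x); rewrite subr0 => /(_ yr yx0).
rewrite subrK norm_cmod ltcR => /ltW h.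
have -> : f y - f x - derive1 f x * (y - x) =
   - (derive1 f x - (y - x)^-1 * (f y - f x)) * (y - x) by field.
by rewrite cmodM cmodN ler_wpM2r ?cmod_ge0.
Qed.

Lemma cder_derivable (f : C -> C) x d : cder f x d -> derivable f x 1 /\ derive1 f x = d.
Proof.
move=> fd; suff h : (fun h : C => h^-1 *: (f (h + x) - f x)) @ 0^' --> d.
  have h2 : derivable f x 1.
    apply/cvg_ex; exists d; move: h.
    by under [X in _ -> X @ _ --> _]eq_fun do rewrite /= [_%:A]mulr1.
  split=> //; apply: (cder_uniq _ fd); exact: derivable_cder.
move: fd => /cderP H; apply/cvgrPdist_le => e; rewrite ltcE => /andP[/eqP /= ei e0].
have -> : e = (Re e)%:C by apply: complex_ext.
have [r r0 rP] := H _ e0.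
rewrite /nbhs /= /dnbhs /within /=; apply/near0C; exists r => // y; rewrite subr0 => yr y0.
have := rP (y + x); rewrite addrK /= => /(_ yr) h.
rewrite norm_cmod lecR.
have -> : d - y^-1 * (f (y + x) - f x) = - (f (y + x) - f x - d * y) / y by field.
by move: h; rewrite /= addrK cmodM cmodV cmodN ler_pdivrMr ?cmod_gt0.
Qed.

(** Frechet differentiability, with the derivative given by its two coefficients and real radii. *)
Definition fder (F : C * C -> C) p a b := forall e : R, 0 < e -> exists2 r : R, 0 < r &
  forall q, cmod (q.1 - p.1) < r -> cmod (q.2 - p.2) < r ->
    cmod (F q - F p - (a * (q.1 - p.1) + b * (q.2 - p.2))) <=
      e * (cmod (q.1 - p.1) + cmod (q.2 - p.2)).

Lemma near0CC (P : C * C -> Prop) p : (\forall q \near p, P q) <->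
  exists2 e : R, 0 < e & forall q, cmod (q.1 - p.1) < e -> cmod (q.2 - p.2) < e -> P q.
Proof.
split.
  move=> [[A B] /= [/near0C [r r0 rP] /near0C [s s0 sP]] AB].
  exists (Num.min r s); first by rewrite lt_min r0.
  move=> q; rewrite !lt_min => /andP[h1 _] /andP[_ h2]; apply: AB; split => /=; [exact: rP|exact: sP].
move=> [e e0 H]; exists ([set y | cmod (y - p.1) < e], [set y | cmod (y - p.2) < e]).
  by split; apply/near0C; exists e.
by move=> q [h1 h2]; exact: H.
Qed.

Lemma norm_pair p : `|p| = (Num.max (cmod p.1) (cmod p.2))%:C.
Proof.
rewrite prod_normE /= !norm_cmod; case: (leP (cmod p.1) (cmod p.2)) => h.
  by apply/max_idPr; rewrite lecR.
by rewrite max_l // lecR ltW.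
Qed.

Lemma diff_fder (F : C * C -> C) p : differentiable F p -> exists a b, fder F p a b.
Proof.
move=> /diff_locallyP [_ /eqaddoP H].
exists ('d F p (1, 0)), ('d F p (0, 1)) => e e0.
have e2 : 0 < e%:C by rewrite ltcR.
have [r r0 rP] := (near0CC _ _).1 (H _ e2); exists r => // q q1 q2.
have := rP (q - p); rewrite !subr0 => /(_ q1 q2).
have lin : 'd F p (q - p) = 'd F p (1, 0) * (q.1 - p.1) + 'd F p (0, 1) * (q.2 - p.2).
  have -> : q - p = (q.1 - p.1) *: (1, 0) + (q.2 - p.2) *: (0, 1).
    by apply/eqP; rewrite xpair_eqE /= !scaler0 addr0 add0r; apply/andP; split; apply/eqP;
      rewrite [RHS]mulr1.
  by rewrite linearD !linearZ /= [X in X + _]mulrC [X in _ + X]mulrC.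
have -> : (F \o shift p - (cst (F p) + 'd F p)) (q - p) =
    F q - F p - ('d F p (1, 0) * (q.1 - p.1) + 'd F p (0, 1) * (q.2 - p.2)).
  by rewrite -lin /= -[LHS]/(F (q - p + p) - (F p + 'd F p (q - p))) subrK opprD addrA.
rewrite norm_pair norm_cmod -rmorphM lecR => h; apply: (le_trans h); rewrite ler_wpM2l ?(ltW e0) // ge_max lerDl lerDr !cmod_ge0 //.
Qed.

Definition plane a b (q : C * C) : C := a * q.1 + b * q.2.

Lemma plane_linear a b : linear (plane a b).
Proof. by move=> k u v; rewrite /plane /= /GRing.scale /=; ring. Qed.

HB.instance Definition _ a b :=
  GRing.isLinear.Build C (C * C)%type C *:%R (plane a b) (@plane_linear a b).

Lemma plane_continuous a b : continuous (plane a b).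
Proof.
move=> q; apply/cvgrPdist_le => e; rewrite ltcE => /andP[/eqP /= ei e0].
have -> : e = (Re e)%:C by apply: complex_ext.
have M0 : 0 < cmod a + cmod b + 1 by rewrite ltr_wpDl // addr_ge0 // cmod_ge0.
apply/near0CC; exists (Re e / (cmod a + cmod b + 1)); first by rewrite divr_gt0.
move=> u u1 u2; rewrite norm_cmod lecR /plane.
have -> : a * q.1 + b * q.2 - (a * u.1 + b * u.2) =
  - (a * (u.1 - q.1) + b * (u.2 - q.2)) by ring.
move: u1 u2 M0; rewrite cmodN => u1 u2 M0.
rewrite (le_trans (cmodD _ _)) // !cmodM.
have -> : Re e = cmod a * (Re e / (cmod a + cmod b + 1)) + cmod b * (Re e / (cmod a + cmod b + 1)) +
   Re e / (cmod a + cmod b + 1) by field; rewrite gt_eqF.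
rewrite ler_wpDr ?divr_ge0 ?(ltW e0) ?(ltW M0) // lerD // ler_wpM2l ?cmod_ge0 //; exact: ltW.
Qed.

Lemma fder_diff (F : C * C -> C) p a b : fder F p a b -> differentiable F p.
Proof.
move=> H; have := @diff_unique C _ _ F (plane a b) p (@plane_continuous a b).
set Q := (X in (X -> _) -> _) => D; have h : Q.
  apply/eqaddoP => e; rewrite ltcE => /andP[/eqP /= ei e0].
  (* The sum of the two moduli is at most twice the norm of the pair. *)
  have e2 : 0 < Re e / 2 by rewrite divr_gt0.
  have [r r0 rP] := H _ e2; apply/near0CC; exists r => // q; rewrite !subr0 => q1 q2.
  have -> : e = (Re e)%:C by apply: complex_ext.
  rewrite norm_pair norm_cmod -rmorphM lecR.
  have := rP (q + p); rewrite /= !addrK => /(_ q1 q2).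
  rewrite -[(F \o shift p - (cst (F p) + plane a b)) q]/(F (q + p) - (F p + plane a b q)).
  have -> : F (q + p) - (F p + plane a b q) = F (q + p) - F p - (a * q.1 + b * q.2).
    by rewrite /plane; ring.
  move=> h; apply: (le_trans h).
  have [] := leP (cmod q.1) (cmod q.2) => ? ; nra.
apply/diff_locallyP; rewrite (D h); split=> //; exact: plane_continuous.
Qed.

Lemma fder_cder1 (F : C * C -> C) p a b : fder F p a b -> cder (fun w => F (w, p.2)) p.1 a.
Proof.
move=> H; apply/cderP => e /H [r r0 rP]; exists r => // y yr /=.
have := rP (y, p.2); rewrite /= subrr cmod0 mulr0 !addr0 => /(_ yr r0).
by rewrite -surjective_pairing.
Qed.

Lemma fder_cder2 (F : C * C -> C) p a b : fder F p a b -> cder (fun x => F (p.1, x)) p.2 b.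
Proof.
move=> H; apply/cderP => e /H [r r0 rP]; exists r => // y yr /=.
have := rP (p.1, y); rewrite /= subrr cmod0 mulr0 !add0r => /(_ r0 yr).
by rewrite -surjective_pairing.
Qed.

Lemma cvg_within_entry m n (f : C -> 'M[C]_(m, n)) (D : set C) x (l : 'M[C]_(m, n)) i j :
  f y @[y --> within D (nbhs x)] --> l ->
  ccvg (within D (cnbhs x)) (fun y => f y i j) (l i j).
Proof.
move=> fl; have {fl} : (fun y => f y i j) @ within D (nbhs x) --> l i j.
  exact: (cvg_comp _ _ fl (@coord_continuous _ _ _ i j l)).
move=> /cvgrPdist_lt fl e e0; have /fl : 0 < e%:C by rewrite ltcR.
move=> /near0C [r r0 rP]; exists r => // y /rP H /H.
by rewrite norm_cmod ltcR cmodBC.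
Qed.

Section Mder.
Variable n : nat.
Implicit Types (A B Y : C -> 'M[C]_n).

Definition mder k (Y : C -> 'M[C]_(n, k)) x (D : 'M[C]_(n, k)) :=
  forall i j, cder (fun y => Y y i j) x (D i j).

Lemma cder_sum (I : Type) (l : seq I) (F : I -> C -> C) (D : I -> C) x :
  (forall i, cder (F i) x (D i)) ->
  cder (fun y => \sum_(i <- l) F i y) x (\sum_(i <- l) D i).
Proof.
move=> FD; elim: l => [|i l IH].
  by rewrite big_nil; under eq_fun do rewrite big_nil; exact: cder_cst.
by rewrite big_cons; under eq_fun do rewrite big_cons; exact: cderD.
Qed.

Lemma mderM k A (Y : C -> 'M[C]_(n, k)) x DA DY : mder A x DA -> mder Y x DY ->
  mder (fun y => A y *m Y y) x (DA *m Y x + A x *m DY).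
Proof.
move=> hA hY i j; under eq_fun do rewrite mxE.
by rewrite !mxE -big_split /=; apply: cder_sum => l; exact: cderM.
Qed.

Lemma mder_uniq k (Y : C -> 'M[C]_(n, k)) x D D' : mder Y x D -> mder Y x D' -> D = D'.
Proof. by move=> h h'; apply/matrixP => i j; exact: cder_uniq (h i j) (h' i j). Qed.

Lemma mder_cst k x (A : 'M[C]_(n, k)) : mder (fun=> A) x 0.
Proof. by move=> i j; rewrite mxE; exact: cder_cst. Qed.

Lemma mder_near k (Y Z : C -> 'M[C]_(n, k)) x D :
  cnbhs x [set y | Y y = Z y] -> mder Y x D -> mder Z x D.
Proof. by move=> h hY i j; apply: cder_near (hY i j); apply: filterS h => y /= ->. Qed.

Lemma mder_sum k (I : Type) (l : seq I) (F : I -> C -> 'M[C]_(n, k)) (D : I -> 'M[C]_(n, k)) x :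
  (forall i, mder (F i) x (D i)) ->
  mder (fun y => \sum_(i <- l) F i y) x (\sum_(i <- l) D i).
Proof.
move=> FD i j; under eq_fun do rewrite summxE.
by rewrite summxE; apply: cder_sum => a; exact: FD.
Qed.

Lemma solves_mder k (B : C -> C -> 'M[C]_n) e (Y : C -> 'M[C]_(n, k)) x :
  solves_at B e Y x <->
  exists2 D, mder Y x D & (x ^+ 2 - e) *: D = B e x *m Y x.
Proof.
split=> [[dY eq]|[D hD eq]].
  exists (mx_derive Y x) => // i j; rewrite mxE; exact/derivable_cder/dY.
split=> [i j|]; first by have [] := cder_derivable (hD i j).
rewrite -eq; congr (_ *: _); apply/matrixP => i j; rewrite mxE.
by have [] := cder_derivable (hD i j).
Qed.
End Mder.

(* Limits, derivability and differentiability at a point are all instances of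
   a relation between functions and values that respects the field operations;
   such a relation extends to determinants and inverse matrices. *)
Section Alg.
Context {T : Type} (P : (T -> C) -> C -> Prop).
Definition alg := [/\ forall c, P (fun=> c) c,
  forall f g a b, P f a -> P g b -> P (fun t => f t + g t) (a + b),
  forall f g a b, P f a -> P g b -> P (fun t => f t * g t) (a * b) &
  forall f a, a != 0 -> P f a -> P (fun t => (f t)^-1) a^-1].
Hypothesis Palg : alg.

Lemma alg_sum (I : Type) (l : seq I) (F : I -> T -> C) (a : I -> C) :
  (forall i, P (F i) (a i)) -> P (fun t => \sum_(i <- l) F i t) (\sum_(i <- l) a i).
Proof.
have [Pc Pa _ _] := Palg; move=> h; elim: l => [|i l IH].
  by rewrite big_nil; under eq_fun do rewrite big_nil; exact: Pc.
by rewrite big_cons; under eq_fun do rewrite big_cons; exact: Pa.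
Qed.

Lemma alg_prod (I : Type) (l : seq I) (F : I -> T -> C) (a : I -> C) :
  (forall i, P (F i) (a i)) -> P (fun t => \prod_(i <- l) F i t) (\prod_(i <- l) a i).
Proof.
have [Pc _ Pm _] := Palg; move=> h; elim: l => [|i l IH].
  by rewrite big_nil; under eq_fun do rewrite big_nil; exact: Pc.
by rewrite big_cons; under eq_fun do rewrite big_cons; exact: Pm.
Qed.

Definition malg m n (A : T -> 'M[C]_(m, n)) (L : 'M[C]_(m, n)) :=
  forall i j, P (fun t => A t i j) (L i j).

Lemma malg_cst m n (L : 'M[C]_(m, n)) : malg (fun=> L) L.
Proof. by have [Pc _ _ _] := Palg; move=> i j; exact: Pc. Qed.

Lemma malg_mul m n k (A : T -> 'M[C]_(m, n)) (B : T -> 'M[C]_(n, k)) L L' :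
  malg A L -> malg B L' -> malg (fun t => A t *m B t) (L *m L').
Proof.
have [_ _ Pm _] := Palg; move=> h h' i j; under eq_fun do rewrite mxE; rewrite mxE.
by apply: alg_sum => l; exact: Pm.
Qed.

Lemma malg_sum m n (I : Type) (l : seq I) (F : I -> T -> 'M[C]_(m, n)) (L : I -> 'M[C]_(m, n)) :
  (forall i, malg (F i) (L i)) -> malg (fun t => \sum_(i <- l) F i t) (\sum_(i <- l) L i).
Proof.
by move=> h i j; under eq_fun do rewrite summxE; rewrite summxE; apply: alg_sum => k; exact: h.
Qed.

Lemma alg_det n (A : T -> 'M[C]_n) L : malg A L -> P (fun t => \det (A t)) (\det L).
Proof.
have [Pc _ Pm _] := Palg; move=> h; rewrite /determinant; apply: alg_sum => s.
by apply: Pm; [exact: Pc | apply: alg_prod => i; exact: h].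
Qed.

(** Cramer's formula without the case distinction of [invmx], so that [P] passes through it entry by
    entry. *)
Definition minv n (A : 'M[C]_n) : 'M[C]_n := (\det A)^-1 *: \adj A.

Lemma malg_minv n (A : T -> 'M[C]_n) L : L \in unitmx -> malg A L ->
  malg (fun t => minv (A t)) (minv L).
Proof.
have [Pc _ Pm Pv] := Palg; rewrite unitmxE unitfE => L0 h i j.
under eq_fun do rewrite /minv mxE [\adj _ i j]mxE; rewrite /minv mxE [\adj _ i j]mxE.
apply: (Pm); first by apply: Pv => //; exact: alg_det.
apply: (Pm); first exact: Pc.
apply: alg_det => a b; under eq_fun do rewrite 2!mxE; rewrite 2!mxE; exact: h.
Qed.
End Alg.

Lemma minvE n (A : 'M[C]_n) : A \in unitmx -> minv A = invmx A.
Proof. by move=> u; rewrite /minv /invmx u. Qed.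

Lemma alg_ccvg T (F : set_system T) {FF : Filter F} : alg (ccvg F).
Proof.
split=> *; [exact: ccvg_cst | exact: ccvgD | exact: ccvgM | exact: ccvgV].
Qed.

Lemma alg_cder x : alg (fun f l => f x = l /\ exists d, cder f x d).
Proof.
split=> [c|f g a b [<- [d fd]] [<- [d' gd]]|f g a b [<- [d fd]] [<- [d' gd]]|f a a0 [fa [d fd]]].
- by split=> //; exists 0; exact: cder_cst.
- by split=> //; eexists; exact: cderD fd gd.
- by split=> //; eexists; exact: cderM fd gd.
- by split; [rewrite fa | eexists; apply: cderV fd; rewrite fa].
Qed.

Lemma alg_diff p : alg (fun F l => F p = l /\ differentiable F p).
Proof.
split=> [c|f g a b [<- df] [<- dg]|f g a b [<- df] [<- dg]|f a a0 [fa df]].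
- by split.
- by split; [exact: erefl | exact: (@differentiableD _ _ _ f g p df dg)].
- by split; [exact: erefl | exact: (@differentiableM _ _ f g p df dg)].
- split; first by rewrite fa.
  by apply: (differentiable_comp df); apply: differentiable_Rinv; rewrite fa.
Qed.
End Bridge.

(** * The deformed projectors *)

Section Isolated.
Context {R : realType}.
Local Notation C := R[i].

Lemma cder_shift (f : C -> C) (a z d : C) : cder f (a + z) d <-> cder (fun y => f (a + y)) z d.
Proof.
have sh (b y : C) : cder (fun y => b + y) y 1.
  by rewrite -[1]add0r; apply: cderD; [exact: cder_cst | exact: cder_id].
split=> h; first by rewrite -[d]mulr1; exact: (@cder_comp _ (fun y => a + y) f).
rewrite -[d]mulr1; have -> : f = fun y => f (a + (- a + y)) by apply/funext => y; rewrite addNKr.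
by apply: (@cder_comp _ (fun y => - a + y) (fun y => f (a + y))); rewrite ?addKr.
Qed.

(** The holomorphic extension given by Cauchy's integral agrees with [f] away from [a], hence at [a]
    by continuity. *)
Lemma removable_cont (f : C -> C) (a : C) (r : R) : 0 < r -> ccont f a ->
  (forall z, 0 < cmod (z - a) < r -> exists d, cder f z d) -> exists d, cder f a d.
Proof.
move=> r0 cf df; pose g z := f (a + z).
have dg z : 0 < cmod z < r -> exists d, cder g z d.
  move=> zr; have [|d dP] := df (a + z); first by rewrite addrC addKr.
  by exists d; apply/cder_shift.
have s0 : 0 < r / 2 < r by apply/andP; split; lra.
have cg0 : ccont g 0.
  move=> e /cf [d d0 dP]; exists d => // y; rewrite subr0 => yd.
  by rewrite /g addr0; apply: dP; rewrite addrC addKr.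
have [|h1 h2] := @removable _ g r (r / 2) s0 dg.
- have [d d0 dP] := cg0 1 ltr01; exists (cmod (g 0) + 1), d; split=> // z /andP[_ zd].
  have := dP z; rewrite subr0 /= => /(_ zd) h.
  by have := cmodD (g z - g 0) (g 0); rewrite subrK; lra.
have [|d dP] := h1 0; first by rewrite cmod0; lra.
have e0 : g 0 = K1 g (r / 2) 0.
  apply: (dense_off cg0 (cder_cont dP)) => e e0; pose m := Num.min (e / 2) (r / 4).
  have m0 : 0 < m by rewrite lt_min; apply/andP; split; lra.
  have cm : cmod m%:C = m by rewrite cmodR gtr0_norm.
  exists m%:C; rewrite subr0 cm; split.
    have h : m <= e / 2 by rewrite /m ge_min lexx.
    by move: (m) h e0; clear => m h e0; lra.
  apply: h2; first by rewrite -cmod_gt0 cm.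
  have h : m <= r / 4 by rewrite /m ge_min lexx orbT.
  by rewrite cm; move: (m) h r0; clear => m h r0; lra.
exists d; rewrite -[a]addr0; apply/cder_shift; apply: cder_near dP.
exists (3 / 4 * (r / 2)); first by lra.
move=> y; rewrite subr0 => yr /=; have [->|y0] := eqVneq y 0; first by rewrite -e0.
by rewrite -h2.
Qed.

Lemma hol_sum (I : Type) (l : seq I) (F : I -> C -> C) (r : R) : (forall i, hol (F i) r) ->
  hol (fun x => \sum_(i <- l) F i x) r.
Proof.
move=> h z zr; exists (\sum_(i <- l) cd (F i) z); apply: cder_sum => i.
exact: (hol_cd (h i)).
Qed.

Lemma subr_mxE m n (A B : 'M[C]_(m, n)) i j : (A - B) i j = A i j - B i j.
Proof. by rewrite !mxE. Qed.

Lemma hol_comm n (A D : C -> 'M[C]_n) (r : R) i j :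
  (forall i j, hol (fun x => A x i j) r) -> (forall i j, hol (fun x => D x i j) r) ->
  hol (fun x => comm_mx2 (A x) (D x) i j) r.
Proof.
move=> hA hD; under eq_fun do rewrite !mxE.
by apply: holB; apply: hol_sum => k; exact: holM.
Qed.

Lemma family_comm n (L0 L1 : C -> 'rV[C]_n) (Rm : C -> C -> 'M[C]_n) e x (D : 'M[C]_n) i j :
  comm_mx2 (family_mx L0 L1 Rm e x) D i j =
  (lam (L0 e) (L1 e) x i - lam (L0 e) (L1 e) x j) * D i j +
  (x ^+ 2 - e) * comm_mx2 (Rm e x) D i j.
Proof.
rewrite /comm_mx2 /family_mx mulmxDl mulmxDr -scalemxAl -scalemxAr.
rewrite mul_diag_mx mul_mx_diag /lam /Lam !mxE; ring.
Qed.

Lemma sol_sub n r e (L0 L1 : 'rV[C]_n) Rf D D' : sol r e L0 L1 Rf D -> sol r e L0 L1 Rf D' ->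
  sol r e L0 L1 Rf (fun x => D x - D' x).
Proof.
move=> [h1 h2 h3] [h1' h2' h3'].
have cmB x : comm_mx2 (Rf x) (D x - D' x) = comm_mx2 (Rf x) (D x) - comm_mx2 (Rf x) (D' x).
  by rewrite /comm_mx2 mulmxBr mulmxBl !opprB addrACA [in RHS]addrACA [- _ + _]addrC.
have fB i j : (fun x => (D x - D' x) i j) = fun x => D x i j - D' x i j.
  by apply/funext => x; rewrite !mxE.
have cB i j x : cmod x < r ->
    cd (fun x => (D x - D' x) i j) x = cd (fun x => D x i j) x - cd (fun x => D' x i j) x.
  by move=> xr; apply: cdP; rewrite fB; apply: cderB; apply: hol_cd xr.
split=> [i j|x xr i j|x xr j].
- by rewrite fB; exact: holB.
- rewrite cB // mulrBr h2 // h2' // cmB !mxE; ring.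
- by rewrite cB // h3 // h3' // cmB !mxE.
Qed.

(** A local holomorphic section of the covering, by which functions of the sheet become functions of
    the parameter. *)
Lemma eps_log (w : C) : exists2 u : C -> C, u (eps w) = w &
  (exists d, cder u (eps w) d) /\ cnbhs (eps w) [set e | eps (u e) = e].
Proof.
have w0 := eps_neq0 w; exists (fun e => w + clog1 (e / eps w)).
  by rewrite divff // clog1_1 addr0.
have dq : cder (fun e => e / eps w) (eps w) (1 / eps w).
  rewrite (_ : (fun e => _) = fun e => (eps w)^-1 * e); last by apply/funext => e; rewrite mulrC.
  by rewrite mulrC; apply: cderZ; exact: cder_id.
split.
  exists (0 + 1 * (1 / eps w)); apply: cderD; first exact: cder_cst.
  by apply: (cder_comp dq); rewrite divff //; exact: clog1_der.
have [r r0 rP] := @clog1K R; have cq := cder_cont dq; rewrite /ccont divff // in cq.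
apply: filterS (cq r r0) => e /rP /= h.
by rewrite /eps cexpD h mulrC divfK.
Qed.
End Isolated.

(** * The projectors over the parameter sector *)

Section Proj.
Context {R : realType}.
Local Notation C := R[i].
Local Notation Re := (@complex.Re R).
Local Notation Im := (@complex.Im R).
Variables (n : nat) (L0 L1 : C -> 'rV[C]_n) (Rm : C -> C -> 'M[C]_n) (K : consts R).
Hypothesis r0 : 0 < rdisc K.
Hypothesis cov : forall w x, Sdom K w -> cmod x < rdisc K -> x ^+ 2 != eps w ->
  OmD K w x \/ OmU K w x.
Hypothesis ovl : forall w x, Sdom K w -> cmod x < rdisc K -> OmD K w x -> OmU K w x ->
  [\/ OmR K w x, OmL K w x | OmC K w x].
Hypothesis D0 : forall w, Sdom K w -> OmD K w 0.
Hypothesis opD : forall w x, Sdom K w -> cmod x < rdisc K -> OmD K w x ->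
  filter_prod (cnbhs w) (cnbhs x) [set q | Sdom K q.1 /\ OmD K q.1 q.2].
Hypothesis opU : forall w x, Sdom K w -> cmod x < rdisc K -> OmU K w x ->
  filter_prod (cnbhs w) (cnbhs x) [set q | Sdom K q.1 /\ OmU K q.1 q.2].
Hypothesis nD : forall w x, Sdom K w -> OmD K w x -> x ^+ 2 != eps w.
Hypothesis nU : forall w x, Sdom K w -> OmU K w x -> x ^+ 2 != eps w.
Hypothesis sq_small : forall w, Sdom K w -> cmod (sqrt_eps w) < rdisc K / 4.
Variable Cst : R.
Hypothesis bnd : forall w D (dat : R), Sdom K w ->
  sol (rdisc K / 4) (eps w) (L0 (eps w)) (L1 (eps w)) (Rm (eps w)) D -> 0 <= dat ->
  (forall j : 'I_n, cmod (D (sqrt_eps w) j j) <= dat) ->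
  forall x, cmod x <= rdisc K / 8 -> forall i j, cmod (D x i j) <= Cst * dat.
Hypothesis onto : forall e, e != 0 -> cmod e < rho K -> exists2 w, Sdom K w & eps w = e.
Variables FD FU HD HU : C -> C -> 'M[C]_n.
Variables CR CL : C -> 'M[C]_n.
Hypothesis holR : forall w, Sdom K w -> forall i j, hol (fun x => Rm (eps w) x i j) (rdisc K).
Hypothesis FD_diag : forall w x, Sdom K w -> OmD K w x -> exists v, FD w x = diag_mx v.
Hypothesis HP : is_H (family_mx L0 L1 Rm) K FD FU HD HU.
Hypothesis SP : unfolded_stokes K FD HD HU CR CL.

Implicit Types (w x : C).

Lemma HD_unit w x : Sdom K w -> OmD K w x -> HD w x \in unitmx /\ FD w x \in unitmx.
Proof.
move=> Sw Dx; have [_ hF _ _ _] := HP; have [h _] := hF w Sw; have [u _] := h x Dx.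
by move: u; rewrite unitmx_mul => /andP.
Qed.

Lemma HU_unit w x : Sdom K w -> OmU K w x -> HU w x \in unitmx.
Proof.
move=> Sw Dx; have [_ hF _ _ _] := HP; have [_ h] := hF w Sw; have [u _] := h x Dx.
by move: u; rewrite unitmx_mul => /andP[].
Qed.

Section Fix.
Variable ev : 'rV[C]_n.
Let E := diag_mx ev.
Hypothesis ER : forall w, Sdom K w -> comm_mx E (CR w).
Hypothesis EL : forall w, Sdom K w -> comm_mx E (CL w).

Definition cj (H : C -> C -> 'M[C]_n) w x := H w x *m E *m minv (H w x).
Local Notation PiD := (cj HD).
Local Notation PiU := (cj HU).
(** Within the disc, the default [E] is taken only at the two singular points, where it is the limit
    of both conjugates. *)
Definition Pi w x := if `[< OmD K w x >] then PiD w x else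
  if `[< OmU K w x >] then PiU w x else E.

(** On each component, S = H_D^-1 H_U is F_D C F_D^-1 with C a Stokes matrix, or the identity. [E]
    commutes with C and with the diagonal F_D, hence with S, which therefore cancels in the
    conjugation by H_U = H_D S. *)
Lemma Pi_agree w x : Sdom K w -> cmod x < rdisc K -> OmD K w x -> OmU K w x ->
  PiD w x = PiU w x.
Proof.
move=> Sw xr Dx Ux; have [HDu FDu] := HD_unit Sw Dx; have HUu := HU_unit Sw Ux.
set S := invmx (HD w x) *m HU w x.
have HUE : HU w x = HD w x *m S by rewrite mulKVmx.
have Su : S \in unitmx by rewrite unitmx_mul unitmx_inv HDu.
have [v Fv] := FD_diag Sw Dx.
have EF : comm_mx E (FD w x) by rewrite Fv; exact: diag_mx_comm.
have EFi : comm_mx E (invmx (FD w x)).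
  by rewrite /comm_mx -[RHS](mulmxK FDu) -(mulmxA (invmx _) E) EF mulKmx.
have ES : comm_mx E S.
  have [_ SR SL SC] := SP Sw.
  have [h|h|h] := ovl Sw xr Dx Ux.
  - by rewrite /S SR //; apply: comm_mxM => //; apply: comm_mxM => //; exact: ER.
  - by rewrite /S SL //; apply: comm_mxM => //; apply: comm_mxM => //; exact: EL.
  - by rewrite /S SC //; exact: comm_mx1.
rewrite /cj !minvE // {1}HUE -(mulmxA _ S) -ES mulmxA -[RHS]mulmxA; congr (_ *m _).
by rewrite /S -mulmxA mulmxV // mulmx1.
Qed.

Lemma Pi_D w x : OmD K w x -> Pi w x = PiD w x.
Proof. by rewrite /Pi; case: asboolP. Qed.

Lemma Pi_U w x : Sdom K w -> cmod x < rdisc K -> OmU K w x -> Pi w x = PiU w x.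
Proof.
by move=> Sw xr Ux; rewrite /Pi; case: asboolP => Dx; [rewrite Pi_agree | case: asboolP].
Qed.

Lemma Pi_branch w x : Sdom K w -> x ^+ 2 = eps w -> Pi w x = E.
Proof.
move=> Sw xe; rewrite /Pi; case: asboolP => [/(nD Sw)|_]; first by rewrite xe eqxx.
by case: asboolP => [/(nU Sw)|_]; first by rewrite xe eqxx.
Qed.


Lemma cj_cder (H : C -> C -> 'M[C]_n) w x : H w x \in unitmx ->
  (forall i j, differentiable (fun q : C * C => H q.1 q.2 i j) (w, x)) ->
  forall i j, (exists d, cder (fun u => cj H u x i j) w d) /\
              (exists d, cder (fun y => cj H w y i j) x d).
Proof.
move=> Hu dH i j.
have c1 : malg (fun f l => f w = l /\ exists d, cder f w d) (fun u => H u x) (H w x).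
  move=> a b; split=> //; have [d [d' h]] := diff_fder (dH a b).
  by exists d; have := fder_cder1 h.
have c2 : malg (fun f l => f x = l /\ exists d, cder f x d) (fun y => H w y) (H w x).
  move=> a b; split=> //; have [d [d' h]] := diff_fder (dH a b).
  by exists d'; have := fder_cder2 h.
have a1 := alg_cder w; have a2 := alg_cder x.
have h1 : malg (fun f l => f w = l /\ exists d, cder f w d) (fun u => cj H u x) (cj H w x).
  by apply: malg_mul => //; [apply: malg_mul => //; exact: malg_cst | exact: malg_minv].
have h2 : malg (fun f l => f x = l /\ exists d, cder f x d) (fun y => cj H w y) (cj H w x).
  by apply: malg_mul => //; [apply: malg_mul => //; exact: malg_cst | exact: malg_minv].
by split; [have [] := h1 i j | have [] := h2 i j].
Qed.

(** The limit of [H] is diagonal, so it commutes with [E] and drops out. *)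
Lemma cj_cvg (F : set_system C) {FF : Filter F} (H : C -> C -> 'M[C]_n) w v :
  diag_mx v \in unitmx -> malg (ccvg F) (fun y => H w y) (diag_mx v) ->
  malg (ccvg F) (fun y => cj H w y) E.
Proof.
move=> vu cH; have aF := @alg_ccvg _ _ F FF.
have <- : diag_mx v *m E *m minv (diag_mx v) = E by rewrite minvE // diag_mxC mulmxK.
by apply: malg_mul => //; [apply: malg_mul => //; exact: malg_cst | exact: malg_minv].
Qed.

Lemma Pi_cont w x : Sdom K w -> x ^+ 2 = eps w -> forall i j, ccont (fun y => Pi w y i j) x.
Proof.
move=> Sw xe i j; have xw : x = xL w \/ x = xR w.
  by move/eqP: xe; rewrite -sqrt_eps_sq eqf_sqr => /orP[]/eqP ->; [left|right].
have xr : cmod x < rdisc K.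
  have := sq_small Sw; case: xw => ->; rewrite /xL /xR ?cmodN => h; move: (cmod _) (rdisc K) h r0 => a b; lra.
have [v [vu hD hU]] : exists v : 'rV[C]_n, [/\ diag_mx v \in unitmx,
    HD w y @[y --> within (OmD K w) (nbhs x)] --> diag_mx v &
    HU w y @[y --> within (OmU K w) (nbhs x)] --> diag_mx v].
  have [_ _ [[v1 [l1 u1 _ _]] [v2 [l2 u2 _ _]]] _ _] := HP.
  by case: xw => ->; [exists (v1 w); have [] := l1 w Sw | exists (v2 w); have [] := l2 w Sw];
    split=> //; [exact: u1 | exact: u2].
have cD : malg (ccvg (within (OmD K w) (cnbhs x))) (fun y => PiD w y) E.
  by apply: (cj_cvg vu) => a b; exact: cvg_within_entry.
have cU : malg (ccvg (within (OmU K w) (cnbhs x))) (fun y => PiU w y) E.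
  by apply: (cj_cvg vu) => a b; exact: cvg_within_entry.
move=> e e0; rewrite /= (Pi_branch Sw xe).
have [d1 d10 P1] := cD i j e e0; have [d2 d20 P2] := cU i j e e0.
exists (Num.min (Num.min d1 d2) (rdisc K - cmod x)); first by rewrite !lt_min d10 d20 subr_gt0.
move=> y; rewrite !lt_min => /andP[/andP[y1 y2] y3].
have yr : cmod y < rdisc K.
  exact: cmod_near y3.
have [ye|yn] := eqVneq (y ^+ 2) (eps w); first by rewrite /= Pi_branch // subrr cmod0.
have [Dy|Uy] := cov Sw yr yn; first by rewrite /= Pi_D //; exact: P1.
by rewrite /= Pi_U //; exact: P2.
Qed.

Lemma Pi_local w x : Sdom K w -> cmod x < rdisc K -> x ^+ 2 != eps w ->
  exists H : C -> C -> 'M[C]_n, [/\ H w x \in unitmx,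
    forall i j, differentiable (fun q : C * C => H q.1 q.2 i j) (w, x) &
    filter_prod (cnbhs w) (cnbhs x) [set q | Pi q.1 q.2 = cj H q.1 q.2]].
Proof.
move=> Sw xr xe; have [[aD aU] _ _ _ _] := HP.
have xr' : filter_prod (cnbhs w) (cnbhs x) [set q | cmod q.2 < rdisc K].
  apply: (@cvg_snd _ _ (cnbhs w) (cnbhs x) _ [set y | cmod y < rdisc K]).
  exists (rdisc K - cmod x); first by rewrite subr_gt0.
  by move=> y /cmod_near.
have [Dx|Ux] := cov Sw xr xe.
  exists HD; split; [by have [] := HD_unit Sw Dx | exact: aD |].
  by apply: filterS (opD Sw xr Dx) => q [_ Dq]; exact: Pi_D.
exists HU; split; [exact: HU_unit Sw Ux | exact: aU |].
by apply: filterS2 xr' (opU Sw xr Ux) => q /= qr [Sq Uq]; exact: Pi_U.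
Qed.

Lemma Pi_hol w i j : Sdom K w -> hol (fun x => Pi w x i j) (rdisc K).
Proof.
move=> Sw x xr; have gen y : cmod y < rdisc K -> y ^+ 2 != eps w ->
    exists d, cder (fun x => Pi w x i j) y d.
  move=> yr ye; have [H [Hu dH HPi]] := Pi_local Sw yr ye.
  have [_ [d dP]] := cj_cder Hu dH i j; exists d; apply: cder_near dP.
  move: HPi => [[A B] /= [/cnbhs_self Aw By] AB]; apply: filterS By => z Bz /=.
  by rewrite -[cj H w z](AB (w, z)).
have [xe|xe] := eqVneq (x ^+ 2) (eps w); last exact: gen.
have x0 : x != 0.
  by apply: contraTneq (eps_neq0 w) => x0; rewrite -xe x0 expr0n eqxx.
(* A radius at most |x| excludes the other singular point, at distance 2 |x|. *)
apply: (@removable_cont _ _ x (Num.min (cmod x) (rdisc K - cmod x))).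
- by rewrite lt_min cmod_gt0 x0 subr_gt0.
- exact: Pi_cont.
move=> z; rewrite lt_min => /andP[z0 /andP[zx zr]]; apply: gen.
  exact: cmod_near zr.
rewrite -xe eqf_sqr negb_or -subr_eq0 -cmod_gt0 z0 /=; apply: contraTneq zx => ->.
rewrite -opprD cmodN -mulr2n -mulr_natl cmodM; have := cmod_ge0 x.
by rewrite -leNgt cmod2; lra.
Qed.

Lemma Pi_mder w x : Sdom K w -> cmod x < rdisc K ->
  mder (Pi w) x (\matrix_(i, j) cd (fun y => Pi w y i j) x).
Proof. by move=> Sw xr i j; rewrite mxE; exact: (hol_cd (Pi_hol i j Sw)). Qed.

(** For W = H_D F_D one has Pi W = W E; differentiate this and insert (x^2 - eps) W' = B W. *)
Lemma Pi_ode_D w x D : Sdom K w -> cmod x < rdisc K -> OmD K w x -> mder (Pi w) x D ->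
  (x ^+ 2 - eps w) *: D = comm_mx2 (family_mx L0 L1 Rm (eps w) x) (Pi w x).
Proof.
move=> Sw xr Dx dP; set B := family_mx _ _ _ _ _.
have [HDu FDu] := HD_unit Sw Dx; have [_ hF _ _ _] := HP.
have [/(_ x Dx) [Wu /solves_mder [W' dW eqW]] _] := hF w Sw.
set W := fun y => HD w y *m FD w y in Wu dW eqW.
have PW y : OmD K w y -> Pi w y *m W y = W y *m E.
  move=> Dy; have [HDu' FDu'] := HD_unit Sw Dy; have [v Fv] := FD_diag Sw Dy.
  rewrite Pi_D // /cj minvE // /W -!mulmxA mulKmx // Fv.
  by rewrite -[diag_mx v *m E]diag_mxC.
have eqd : D *m W x + Pi w x *m W' = W' *m E.
  apply: (@mder_uniq _ _ _ (fun y => Pi w y *m W y) x); first exact: mderM.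
  apply: (@mder_near _ _ _ (fun y => W y *m E)).
    have [[A1 A2] /= [/cnbhs_self Aw Ax] AB] := opD Sw xr Dx.
    by apply: filterS Ax => y Ay /=; rewrite PW //; have [] := AB (w, y).
  rewrite -[W' *m E]addr0 -[X in _ + X](mulmx0 _ (W x)).
  by apply: mderM => //; exact: mder_cst.
have {}eqd : D *m W x = W' *m E - Pi w x *m W' by rewrite -eqd addrK.
rewrite -[LHS](mulmxK Wu) -scalemxAl eqd scalerBr scalemxAl scalemxAr eqW.
rewrite -/(W x) -/B -mulmxA -(PW x Dx) mulmxA [Pi w x *m (B *m W x)]mulmxA -mulmxBl mulmxK //.
Qed.

Lemma near0_D w : Sdom K w -> exists2 d : R, 0 < d & forall z, cmod z < d ->
  cmod z < rdisc K /\ OmD K w z.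
Proof.
move=> Sw; have [||[A1 A2] /= [/cnbhs_self Aw [d d0 dP]] AB] := opD Sw (x := 0).
- by rewrite cmod0.
- exact: D0.
exists (Num.min d (rdisc K)); first by rewrite lt_min d0.
move=> z; rewrite lt_min => /andP[zd zr]; split=> //.
by have [|_] := AB (w, z); first by split=> //; apply: dP; rewrite subr0.
Qed.

(** The equations are proved near 0, inside Omega_D, where x^2 - eps can be cancelled, and extended
    by the identity theorem. The radius is halved once for the holomorphy of the derivative and once
    for the identity theorem. *)
Lemma Pi_sol w : Sdom K w ->
  sol (rdisc K / 4) (eps w) (L0 (eps w)) (L1 (eps w)) (Rm (eps w)) (Pi w).
Proof.
move=> Sw; have q4 : rdisc K / 4 <= rdisc K by move: r0; lra.
have q2 : rdisc K / 2 <= rdisc K by move: r0; lra.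
have q : rdisc K / 4 = rdisc K / 2 / 2 by field.
have hP i j := Pi_hol i j Sw.
have hc i j : hol (cd (fun x => Pi w x i j)) (rdisc K / 2) := hol_cd_hol r0 (hP i j).
have hC i j : hol (fun x => comm_mx2 (Rm (eps w) x) (Pi w x) i j) (rdisc K / 2).
  by apply: (hol_le q2); apply: hol_comm => // a b; exact: holR.
have hX : hol (fun x => x ^+ 2 - eps w) (rdisc K / 2).
  by apply: holB; [apply: holM; exact: hol_id | exact: hol_cst].
have [d d0 dP] := near0_D Sw.
have base z i j : cmod z < d -> (z ^+ 2 - eps w) * cd (fun x => Pi w x i j) z =
  (lam (L0 (eps w)) (L1 (eps w)) z i - lam (L0 (eps w)) (L1 (eps w)) z j) * Pi w z i j +
  (z ^+ 2 - eps w) * comm_mx2 (Rm (eps w) z) (Pi w z) i j.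
  move=> zd; have [zr Dz] := dP z zd.
  have := Pi_ode_D Sw zr Dz (Pi_mder Sw zr).
  by move=> h; rewrite -family_comm -h 2!mxE.
split; first by move=> i j; exact: hol_le (hP i j).
- move=> x xr i j; apply/eqP; rewrite -subr_eq0; apply/eqP.
  apply: (@identity_thm _ (fun x => (x ^+ 2 - eps w) * cd (fun x => Pi w x i j) x -
  ((lam (L0 (eps w)) (L1 (eps w)) x i - lam (L0 (eps w)) (L1 (eps w)) x j) * Pi w x i j +
   (x ^+ 2 - eps w) * comm_mx2 (Rm (eps w) x) (Pi w x) i j)) (rdisc K / 2) d) => //.
  + have hl k : hol (fun x => lam (L0 (eps w)) (L1 (eps w)) x k) (rdisc K / 2).
      by apply: holD; [exact: hol_cst | apply: holM; [exact: hol_id | exact: hol_cst]].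
    apply: holB; first exact: holM.
    apply: holD; last exact: holM.
    by apply: holM; [exact: holB | exact: hol_le (hP i j)].
  + by move=> z zd; rewrite base // subrr.
  + by rewrite -q.
- move=> x xr j; apply/eqP; rewrite -subr_eq0; apply/eqP.
  apply: (@identity_thm _ (fun x => cd (fun x => Pi w x j j) x -
    comm_mx2 (Rm (eps w) x) (Pi w x) j j) (rdisc K / 2) d) => //; last by rewrite -q.
  + exact: holB.
  + move=> z zd; have [zr Dz] := dP z zd.
    have := base z j j zd; rewrite subrr mul0r add0r => h; apply/eqP; rewrite subr_eq0; apply/eqP.
    by apply: (mulfI _ h); rewrite subr_eq0; exact: nD Dz.
Qed.

Lemma Pi_bound w x i j : Sdom K w -> cmod x <= rdisc K / 8 ->
  cmod (Pi w x i j) <= Cst * (\sum_k cmod (ev ord0 k)).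
Proof.
move=> Sw; move: x i j; move=> x i j xr.
apply: (bnd Sw (Pi_sol Sw)) => // [|k]; first by apply: sumr_ge0 => k _; exact: cmod_ge0.
rewrite Pi_branch ?sqrt_eps_sq // mxE eqxx mulr1n (bigD1 k) //= lerDl.
by apply: sumr_ge0 => l _; exact: cmod_ge0.
Qed.

Lemma Pi_sheet w w' x : Sdom K w -> Sdom K w' -> eps w = eps w' -> cmod x <= rdisc K / 8 ->
  Pi w x = Pi w' x.
Proof.
move=> Sw Sw' ee xr; apply/matrixP => i j; apply/eqP; rewrite -subr_eq0 -cmod_eq0 eq_le cmod_ge0 andbT.
have h := Pi_sol Sw'; rewrite -ee in h.
have z0 k : cmod ((Pi w (sqrt_eps w) - Pi w' (sqrt_eps w)) k k) <= 0.
  by rewrite !Pi_branch ?sqrt_eps_sq // subrr mxE cmod0.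
have := bnd Sw (sol_sub (Pi_sol Sw) h) (lexx 0) z0 xr i j.
by rewrite mulr0 subr_mxE.
Qed.

(** A sheet over [e] is chosen, irrelevantly so on the smaller disc by [Pi_sheet]; over e = 0 there
    is none, and the value is arbitrary. *)
Definition Pe (e x : C) : 'M[C]_n := Pi (xget 0 [set w | Sdom K w /\ eps w = e]) x.

Lemma PeE w x : Sdom K w -> cmod x <= rdisc K / 8 -> Pe (eps w) x = Pi w x.
Proof.
move=> Sw xr; rewrite /Pe; case: xgetP => [u _ [Su eu]|/(_ w)]; first exact: Pi_sheet.
by move=> []; split.
Qed.

Lemma Pe_bound e x i j : e != 0 -> cmod e < rho K -> cmod x <= rdisc K / 8 ->
  cmod (Pe e x i j) <= Cst * (\sum_k cmod (ev ord0 k)).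
Proof. by move=> e0 er xr; have [w Sw <-] := onto e0 er; rewrite PeE //; exact: Pi_bound. Qed.

Lemma Pe_sol e : e != 0 -> cmod e < rho K ->
  sol (rdisc K / 8) e (L0 e) (L1 e) (Rm e) (Pe e).
Proof.
move=> e0 er; have [w Sw <-] := onto e0 er; have [h1 h2 h3] := Pi_sol Sw.
have r8 : rdisc K / 8 <= rdisc K / 4 by move: r0; lra.
have pE x : cmod x < rdisc K / 8 -> Pe (eps w) x = Pi w x.
  by move=> /ltW xr; exact: PeE.
have nE x : cmod x < rdisc K / 8 -> cnbhs x [set y | Pi w y = Pe (eps w) y].
  move=> xr; exists (rdisc K / 8 - cmod x); first by rewrite subr_gt0.
  by move=> y yx /=; rewrite pE //; exact: cmod_near yx.
have cE x i j : cmod x < rdisc K / 8 ->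
    cder (fun y => Pe (eps w) y i j) x (cd (fun y => Pi w y i j) x).
  move=> xr; apply: (@cder_near _ (fun y => Pi w y i j)).
    by apply: filterS (nE x xr) => y /= ->.
  exact: (hol_cd (h1 i j) (lt_le_trans xr r8)).
split=> [i j x xr|x xr i j|x xr j].
- by eexists; exact: cE.
- by rewrite (cdP (cE x i j xr)) pE // h2 //; exact: lt_le_trans r8.
- by rewrite (cdP (cE x j j xr)) pE // h3 //; exact: lt_le_trans r8.
Qed.

Lemma Pe_branch e x : e != 0 -> cmod e < rho K -> cmod x <= rdisc K / 8 -> x ^+ 2 = e ->
  Pe e x = E.
Proof.
by move=> e0 er xr xe; have [w Sw ew] := onto e0 er; rewrite -ew PeE // Pi_branch // xe.
Qed.

Lemma Pe_cder1 e x i j : e != 0 -> cmod e < rho K -> cmod x <= rdisc K / 8 -> x ^+ 2 != e ->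
  exists d, cder (fun u => Pe u x i j) e d.
Proof.
move=> e0 er xr xe; have [w Sw ew] := onto e0 er; rewrite -ew in xe *.
have xr' : cmod x < rdisc K by move: r0 xr; lra.
have [H [Hu dH HPi]] := Pi_local Sw xr' xe; have [[d dP] _] := cj_cder Hu dH i j.
have [u uw [[d' ud] un]] := eps_log w.
exists (d * d'); apply: (@cder_near _ (fun e => cj H (u e) x i j)); last first.
  by apply: (@cder_comp _ u (fun v => cj H v x i j)) => //; rewrite uw.
have cu := cder_cont ud; rewrite /ccont uw in cu.
move: HPi => [[A1 A2] /= [[r1 r10 r1P] /cnbhs_self Ax] AB].
have [r2 r20 r2P] := Sdom_open Sw.
apply: filterS3 un (cu _ r10) (cu _ r20) => z /= zu /r1P z1 /r2P z2.
by rewrite -[in RHS]zu PeE // -[cj H (u z) x](AB (u z, x)).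
Qed.
End Fix.

Lemma cj_mul (ev ev' : 'rV[C]_n) (c : C) H w x : H w x \in unitmx ->
  diag_mx ev *m diag_mx ev' = c *: diag_mx ev ->
  cj ev H w x *m cj ev' H w x = c *: cj ev H w x.
Proof.
move=> Hu ee; rewrite /cj minvE // !mulmxA mulmxKV // -(mulmxA (H w x)) ee.
by rewrite -scalemxAr -scalemxAl.
Qed.

Lemma Pe_mul (ev ev' : 'rV[C]_n) (c : C) e x : e != 0 -> cmod e < rho K -> cmod x < rdisc K ->
  diag_mx ev *m diag_mx ev' = c *: diag_mx ev -> Pe ev e x *m Pe ev' e x = c *: Pe ev e x.
Proof.
move=> e0 er xr ee; rewrite /Pe; case: xgetP => [w _ [Sw _]|H]; last first.
  by have [w Sw we] := onto e0 er; case: (H w).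
rewrite /Pi; case: asboolP => [Dx|_]; first by apply: cj_mul => //; have [] := HD_unit Sw Dx.
by case: asboolP => // Ux; apply: cj_mul => //; exact: HU_unit Sw Ux.
Qed.

Lemma Pe_spec (ev : 'rV[C]_n) : (forall w, Sdom K w -> comm_mx (diag_mx ev) (CR w)) ->
  (forall w, Sdom K w -> comm_mx (diag_mx ev) (CL w)) ->
  [/\ forall e x i j, e != 0 -> cmod e < rho K -> cmod x <= rdisc K / 8 ->
        cmod (Pe ev e x i j) <= Cst * (\sum_k cmod (ev ord0 k)),
      forall e, e != 0 -> cmod e < rho K -> sol (rdisc K / 8) e (L0 e) (L1 e) (Rm e) (Pe ev e),
      forall e x i j, e != 0 -> cmod e < rho K -> cmod x <= rdisc K / 8 -> x ^+ 2 != e ->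
        exists d, cder (fun u => Pe ev u x i j) e d &
      forall e x, e != 0 -> cmod e < rho K -> cmod x <= rdisc K / 8 -> x ^+ 2 = e ->
        Pe ev e x = diag_mx ev].
Proof.
move=> ER EL; split=> *; [exact: Pe_bound | exact: Pe_sol | exact: Pe_cder1 | exact: Pe_branch].
Qed.
End Proj.

(** * Extension across a vanishing parameter *)

Section Osgood.
Context {R : realType}.
Local Notation C := R[i].
Implicit Types (e x z : C).

(** The arithmetic of [osgood]: h and k are the increments of x and e, and the middle term is the
    mixed one. *)
Lemma sum_sq (N h k u v w : R) : 0 <= N -> 0 <= h -> 0 <= k ->
  u <= 128 * N * h ^+ 2 -> v <= 9216 * N * k * h -> w <= 128 * N * k ^+ 2 ->
  u + v + w <= (9472 * N + 1) * (h + k) ^+ 2.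
Proof.
move=> N0 h0 k0.
have : 0 <= N * (h * k) by rewrite mulr_ge0 // mulr_ge0.
have : 0 <= N * (h ^+ 2) by rewrite mulr_ge0 // exprn_ge0.
have : 0 <= N * (k ^+ 2) by rewrite mulr_ge0 // exprn_ge0.
have : 0 <= (h + k) ^+ 2 by rewrite exprn_ge0 // addr_ge0.
have -> : (9472 * N + 1) * (h + k) ^+ 2 = 9472 * (N * h ^+ 2) + 18944 * (N * (h * k)) +
   9472 * (N * k ^+ 2) + (h + k) ^+ 2 by ring.
have -> : 128 * N * h ^+ 2 = 128 * (N * h ^+ 2) by ring.
have -> : 128 * N * k ^+ 2 = 128 * (N * k ^+ 2) by ring.
have -> : 9216 * N * k * h = 9216 * (N * (h * k)) by ring.
move: (N * (h * k)) (N * h ^+ 2) (N * k ^+ 2) ((h + k) ^+ 2) => *; lra.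
Qed.

Section Separate.
Variables (F : C -> C -> C) (a M : R).
Hypotheses (a0 : 0 < a) (FM : forall e x, cmod e < a -> cmod x < a -> cmod (F e x) <= M).
Hypothesis F1 : forall x, cmod x < a -> hol (F^~ x) a.
Hypothesis F2 : forall e, cmod e < a -> hol (F e) a.
Let s := 3 / 4 * a.
Let s0 : 0 < s. Proof. by rewrite /s; move: a0 => h; lra. Qed.
Let sa : s < a. Proof. by rewrite /s; move: a0 => h; lra. Qed.
Let M0 : 0 <= M.
Proof. by apply: le_trans (cmod_ge0 _) (FM (e := 0) (x := 0) _ _); rewrite cmod0. Qed.

(** The Lipschitz constant 288 leaves room above 32, from the derivative, plus 192 = 128 * 3 / 2,
    from the quadratic remainder with |x' - x| <= 3/2 s. *)
Lemma one_var (f : C -> C) x x' : hol f a -> (forall z, cmod z < a -> cmod (f z) <= M) ->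
  cmod x < 3 / 4 * s -> cmod x' < 3 / 4 * s ->
  cmod (f x' - f x - cd f x * (x' - x)) <= 128 * M / s ^+ 2 * cmod (x' - x) ^+ 2 /\
  cmod (f x' - f x) <= 288 * M / s * cmod (x' - x).
Proof.
move=> hf fM xs xs'; have sb : 0 < s < a by rewrite s0 sa.
have gM z : cmod z = s -> cmod (f z) <= M by move=> zs; apply: fM; rewrite zs sa.
have kE y : cmod y < 3 / 4 * s -> f y = K1 f s y.
  by move=> ys; apply: (cauchy_formula hf) => //; move: ys s0; lra.
have h1 : cmod (f x' - f x - cd f x * (x' - x)) <= 128 * M / s ^+ 2 * cmod (x' - x) ^+ 2.
  by rewrite (kE x xs) (kE x' xs') (cd_K2 hf sb xs); apply: K1_diff => //; exact: ltW.
split=> //; have h2 := cd_bound hf sb gM xs.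
have h3 : cmod (x' - x) <= 3 / 2 * s by have := cmodB x' x; lra.
have -> : f x' - f x = (f x' - f x - cd f x * (x' - x)) + cd f x * (x' - x) by ring.
rewrite (le_trans (cmodD _ _)) // cmodM.
have h4 : cmod (cd f x) * cmod (x' - x) <= 32 * M / s * cmod (x' - x).
  by rewrite ler_wpM2r ?cmod_ge0.
have h5 : 128 * M / s ^+ 2 * cmod (x' - x) ^+ 2 <= 128 * M / s ^+ 2 * (3 / 2 * s * cmod (x' - x)).
  rewrite ler_wpM2l ?expr2 ?ler_wpM2r ?cmod_ge0 //.
  by rewrite divr_ge0 ?mulr_ge0 // ltW.
have h6 : 128 * M / s ^+ 2 * (3 / 2 * s * cmod (x' - x)) = 192 * M / s * cmod (x' - x).
  by field; rewrite gt_eqF.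
have h7 : 288 * M / s * cmod (x' - x) = 32 * M / s * cmod (x' - x) + 192 * M / s * cmod (x' - x) +
   64 * M / s * cmod (x' - x) by field; rewrite gt_eqF.
have h8 : 0 <= 64 * M / s * cmod (x' - x).
  by rewrite mulr_ge0 ?cmod_ge0 // divr_ge0 ?mulr_ge0 // ltW.
move: h1 h4 h5 h6 h7 h8.
move: (cmod _) (cmod _ * cmod _) (cmod _) (128 * M / s ^+ 2 * _) (128 * M / s ^+ 2 * _) => c1 c2 c3 c4 c5.
move: (32 * M / s * _) (192 * M / s * _) (64 * M / s * _) (288 * M / s * _) => d1 d2 d3 d4.
lra.
Qed.

(** Cauchy's estimate in x for the difference F e' - F e, which is O(|e' - e|) on the circle; 9216 =
    32 * 288. *)
Lemma mixed e e' x : cmod e < 3 / 4 * s -> cmod e' < 3 / 4 * s -> cmod x < 3 / 4 * s ->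
  cmod (cd (F e') x - cd (F e) x) <= 9216 * M / s ^+ 2 * cmod (e' - e).
Proof.
move=> es es' xs; have sb : 0 < s < a by rewrite s0 sa.
have hsa : 3 / 4 * s < a by move: s0 sa => h h'; lra.
have esa := lt_trans es hsa; have esa' := lt_trans es' hsa; have xsa := lt_trans xs hsa.
have <- : cd (fun z => F e' z - F e z) x = cd (F e') x - cd (F e) x.
  by apply: cdP; apply: cderB; apply: (hol_cd (F2 _)).
have -> : 9216 * M / s ^+ 2 * cmod (e' - e) = 32 * (288 * M / s * cmod (e' - e)) / s.
  by field; rewrite gt_eqF.
apply: (@cd_bound _ _ a s _ x) => //; first by apply: holB; exact: F2.
move=> z zs; have za : cmod z < a by rewrite zs sa.
by have [] := @one_var (F^~ z) e e' (F1 za) (fun y yr => FM yr za) es es'.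
Qed.

(** Osgood's lemma for bounded functions. The increment splits into the one in x at e', the change
    of the x-derivative between e and e', and the one in e; each error is quadratic. *)
Theorem osgood e x : cmod e < a / 2 -> cmod x < a / 2 ->
  fder (fun q => F q.1 q.2) (e, x) (cd (F^~ x) e) (cd (F e) x).
Proof.
move=> ea xa; have hs : a / 2 < 3 / 4 * s by rewrite /s; move: a0 => h; lra.
have hsa : 3 / 4 * s < a by move: s0 sa; lra.
have N0 : 0 <= M / s ^+ 2 by rewrite divr_ge0 // exprn_ge0 // ltW.
pose A := 9472 * (M / s ^+ 2) + 1.
have key e' x' : cmod e' < 3 / 4 * s -> cmod x' < 3 / 4 * s ->
  cmod (F e' x' - F e x - (cd (F^~ x) e * (e' - e) + cd (F e) x * (x' - x))) <=
  A * (cmod (e' - e) + cmod (x' - x)) ^+ 2.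
  move=> es' xs'; have es := lt_trans ea hs; have xs := lt_trans xa hs.
  have xsa := lt_trans xs hsa; have esa' := lt_trans es' hsa; have esa := lt_trans es hsa.
  have [t1 _] := @one_var (F e') x x' (F2 esa') (fun z zr => FM esa' zr) xs xs'.
  have [t3 _] := @one_var (F^~ x) e e' (F1 xsa) (fun z zr => FM zr xsa) es es'.
  have t2 := mixed es es' xs.
  have -> : F e' x' - F e x - (cd (F^~ x) e * (e' - e) + cd (F e) x * (x' - x)) =
    (F e' x' - F e' x - cd (F e') x * (x' - x)) +
    (cd (F e') x - cd (F e) x) * (x' - x) + (F e' x - F e x - cd (F^~ x) e * (e' - e)) by ring.
  have t2' : cmod ((cd (F e') x - cd (F e) x) * (x' - x)) <=
     9216 * M / s ^+ 2 * cmod (e' - e) * cmod (x' - x).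
    by rewrite cmodM ler_wpM2r ?cmod_ge0.
  rewrite (le_trans (cmodD _ _)) // (le_trans (lerD (cmodD _ _) (lexx _))) //.
  have e1 (c : R) : c * M / s ^+ 2 = c * (M / s ^+ 2) by rewrite mulrA.
  by rewrite [cmod (e' - e) + _]addrC; apply: sum_sq => //; rewrite ?cmod_ge0 -?e1.
have A0 : 0 < A.
  by rewrite /A; move: (M / _) N0 => N h; lra.
move=> d d0; exists (Num.min (d / (2 * A)) (3 / 4 * s - a / 2)).
  by rewrite lt_min subr_gt0 hs divr_gt0 // mulr_gt0.
move=> [e' x'] /=; rewrite !lt_min => /andP[h1 h2] /andP[k1 k2].
apply: (le_trans (key e' x' _ _)).
- by apply: (cmod_near (x := e)); apply: lt_trans h2 _; rewrite ltrD2l ltrN2.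
- by apply: (cmod_near (x := x)); apply: lt_trans k2 _; rewrite ltrD2l ltrN2.
rewrite expr2 mulrA ler_wpM2r ?addr_ge0 ?cmod_ge0 //.
have -> : d = A * (d / (2 * A) + d / (2 * A)) by field; rewrite gt_eqF.
by rewrite ler_wpM2l ?(ltW A0) // lerD ?ltW.
Qed.
End Separate.

(** * The extension as a double Cauchy integral *)

Section Extend.
Variables (F : C -> C -> C) (p r s M : R).
Hypotheses (p0 : 0 < p) (s0 : 0 < s) (sr : s < r).
Hypothesis FM : forall e x, e != 0 -> cmod e < p -> cmod x <= s -> cmod (F e x) <= M.
Hypothesis F2 : forall e, e != 0 -> cmod e < p -> hol (F e) r.
Hypothesis F1 : forall e z, e != 0 -> cmod e < p -> cmod z = s -> exists d, cder (F^~ z) e d.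
Let a := Num.min (3 / 8 * p) (3 / 4 * s).
Let q := p / 2.
Let g z e := K1 (F^~ z) q e.
(** The inner integral removes the singularity e = 0 for each z on the circle |z| = s, and the outer
    one fills the disc. Differentiability in [e] is thus required only on that circle, as [F1] has
    it. *)
Definition ext e x := K1 (g^~ e) s x.

Let a0 : 0 < a.
Proof. by rewrite lt_min; move: p0 s0 => h1 h2; apply/andP; split; lra. Qed.
Let ap e : cmod e < a -> cmod e < 3 / 4 * q.
Proof. by rewrite lt_min /q => /andP[h _]; lra. Qed.
Let as_ x : cmod x < a -> cmod x < 3 / 4 * s.
Proof. by rewrite lt_min => /andP[_]. Qed.

Let Fq z : cmod z = s -> forall e, cmod e = q -> cmod (F e z) <= M.
Proof.
move=> zs e eq; have h := p0; apply: FM; rewrite ?zs // -?cmod_gt0 eq /q; lra.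
Qed.

Let g_prop z : cmod z = s -> hol (g z) (3 / 4 * q) /\
  (forall e, e != 0 -> cmod e < 3 / 4 * q -> F e z = g z e).
Proof.
move=> zs; have df e : 0 < cmod e < p -> exists d, cder (F^~ z) e d.
  by move=> /andP[e0 ep]; apply: F1; rewrite // -cmod_gt0.
apply: (@removable _ (F^~ z) p q).
- by rewrite /q; move: p0 => h; apply/andP; split; lra.
- exact: df.
- exists M, p; split=> // e /andP[e0 ep]; apply: FM => //; first by rewrite -cmod_gt0.
  by rewrite zs.
Qed.

Let gM e z : cmod e < 3 / 4 * q -> cmod z = s -> cmod (g z e) <= 8 * M.
Proof.
move=> eq zs; apply: K1_bound; [|exact: Fq|exact: ltW].
by rewrite /q divr_gt0.
Qed.

Lemma ext_bound e x : cmod e < a -> cmod x < a -> cmod (ext e x) <= 64 * M.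
Proof.
move=> ea xa; have -> : 64 * M = 8 * (8 * M) by ring.
apply: K1_bound => // [z zs|]; last exact/ltW/as_.
by apply: gM => //; exact: ap.
Qed.

Lemma extE e x : e != 0 -> cmod e < a -> cmod x < a -> ext e x = F e x.
Proof.
move=> e0 ea xa; have xs := as_ xa.
have ep : cmod e < p by have := ap ea; rewrite /q; move: p0 => h; lra.
rewrite [RHS](@cauchy_formula _ _ r x s) //; first last.
- by move: xs s0 => h1 h2; lra.
- exact: F2.
apply: eq_circ => [|z zs]; first exact: ltW.
by have [_ <-] := g_prop zs; rewrite // ap.
Qed.

Lemma ext_hol2 e : cmod e < a -> hol (ext e) a.
Proof.
move=> ea x xa; eexists; apply: (K1_der s0 (M := 8 * M)); last exact: as_.
by move=> z zs; apply: gM => //; exact: ap.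
Qed.

(** Differentiation under the outer mean, the remainder of the inner kernel being quadratic
    uniformly in z. *)
Lemma ext_hol1 x : cmod x < a -> hol (ext^~ x) a.
Proof.
move=> xa e ea; pose D := circ (fun z => K2 (F^~ z) q e * (z / (z - x))) s.
have q0 : 0 < q by rewrite /q divr_gt0.
have xs : cmod x < s by have := as_ xa; move: s0 => h h'; lra.
have eq := ap ea.
exists D; apply: (@cder_sq _ _ _ _ (1024 * M / q ^+ 2) (3 / 4 * q - cmod e)); first by rewrite subr_gt0.
move=> e' ee'; have eq' : cmod e' < 3 / 4 * q.
  exact: cmod_near ee'.
have bk : bcirc (fun z => z / (z - x)) s by exact: bker1.
rewrite /ext /K1 /D circ_lin3; first last.
- by apply: bcircM => //; exists (32 * M / q) => z zs; apply: K2_bound => //; [exact: Fq|exact: ltW].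
- by apply: bcircM => //; exists (8 * M) => z zs; exact: gM.
- by apply: bcircM => //; exists (8 * M) => z zs; exact: gM.
- exact: ltW.
have -> : 1024 * M / q ^+ 2 * cmod (e' - e) ^+ 2 = 2 * (128 * M / q ^+ 2 * cmod (e' - e) ^+ 2 * 4).
  by field; rewrite gt_eqF.
apply: circ_bound => [|z zs]; first exact: ltW.
have -> : g z e' * (z / (z - x)) - g z e * (z / (z - x)) - K2 (F^~ z) q e * (z / (z - x)) * (e' - e) =
  (g z e' - g z e - K2 (F^~ z) q e * (e' - e)) * (z / (z - x)) by ring.
rewrite cmodM ler_pM ?cmod_ge0 //.
  by apply: K1_diff => //; [exact: Fq | exact: ltW | exact: ltW].
rewrite cmodM zs; have h := kerV_le s0 zs (ltW (as_ xa)).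
by rewrite (le_trans (ler_wpM2l (ltW s0) h)) // mulrC divfK // gt_eqF.
Qed.

Lemma ext_fder e x : cmod e < a / 2 -> cmod x < a / 2 ->
  fder (fun q => ext q.1 q.2) (e, x) (cd (ext^~ x) e) (cd (ext e) x).
Proof.
by apply: (osgood a0 (M := 64 * M)); [exact: ext_bound | exact: ext_hol1 | exact: ext_hol2].
Qed.

(** Serves to let e tend to 0 in the differential equation, which contains the x-derivative. *)
Lemma ext_cd_cont x : cmod x < a / 2 -> ccont (fun e => cd (ext e) x) 0.
Proof.
move=> xa d d0; have hs : a / 2 < 3 / 4 * (3 / 4 * a) by move: a a0 => v v0; lra.
have hs0 : 0 < 3 / 4 * (3 / 4 * a) by rewrite !mulr_gt0.
have [L L0 LP] : exists2 L : R, 0 < L & 9216 * (64 * M) / (3 / 4 * a) ^+ 2 <= L.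
  move: (9216 * _ / _) => N; exists (Num.max 1 N); first by rewrite lt_max ltr01.
  by rewrite le_max lexx orbT.
exists (Num.min (a / 2) (d / L)); first by rewrite lt_min !divr_gt0.
move=> e; rewrite subr0 lt_min => /andP[ea ed] /=.
have := @mixed ext a (64 * M) a0 ext_bound ext_hol1 ext_hol2 0 e x _ (lt_trans ea hs) (lt_trans xa hs).
rewrite cmod0 subr0 => h; apply: (le_lt_trans (h hs0)).
move: ed; rewrite ltr_pdivlMr // => ed; apply: le_lt_trans ed.
by rewrite mulrC ler_wpM2l ?cmod_ge0.
Qed.
End Extend.
End Osgood.

(** * Block diagonalization *)

Section Blocks.
Context {R : realType}.
Local Notation C := R[i].
Variables (m : nat) (ns : 'I_m -> nat).

Section Cast.
Variables (n : nat) (e : (\sum_k ns k)%N = n).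

(** The coordinate projection onto the [k]-th block. *)
Definition bunit (k : 'I_m) : 'M[C]_n := blockdiag e (fun l => ((l == k)%:R)%:M).

Lemma blockdiagM (A B : forall k, 'M[C]_(ns k)) :
  blockdiag e A *m blockdiag e B = blockdiag e (fun k => A k *m B k).
Proof.
rewrite /blockdiag; case: _ / e => /=; rewrite !castmx_id {2}/mxdiag mul_mxdiag_mxblock.
apply: eq_mxblock => i j; case: eqP => [ij|_]; last by rewrite mulmx0.
by case: _ / ij; rewrite !conform_mx_id.
Qed.

Lemma eq_blockdiag (A B : forall k, 'M[C]_(ns k)) : (forall k, A k = B k) ->
  blockdiag e A = blockdiag e B.
Proof. by move=> AB; rewrite /blockdiag; congr castmx; exact: eq_mxdiag. Qed.

Lemma bunit_mul k l : bunit k *m bunit l = (k == l)%:R *: bunit k.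
Proof.
rewrite /bunit blockdiagM; case: eqVneq => [->|kl].
  by rewrite scale1r; apply: eq_blockdiag => i; rewrite -scalar_mxM -natrM mulnb andbb.
rewrite scale0r (@eq_blockdiag _ (fun=> 0)) => [|i].
  by rewrite /blockdiag mxdiag0 castmx_const.
rewrite -scalar_mxM -natrM mulnb; case: eqVneq => [->|_]; last by rewrite raddf0.
by rewrite (negPf kl) raddf0.
Qed.

Lemma bunit_sum : \sum_k bunit k = 1%:M.
Proof.
rewrite /bunit /blockdiag; case: _ / e => /=.
transitivity (\sum_k \mxdiag_l ((l == k)%:R%:M : 'M[C]_(ns l))).
  by apply: eq_bigr => k _; rewrite castmx_id.
rewrite -mxdiag_sum -(mxdiagZ 1); apply: eq_mxdiag => i.
by rewrite -raddf_sum -natr_sum (bigD1 i) //= eqxx big1 ?addn0 // => j /negPf; rewrite eq_sym => ->.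
Qed.

Lemma bunit_comm (A : forall k, 'M[C]_(ns k)) k : comm_mx (bunit k) (blockdiag e A).
Proof.
by rewrite /comm_mx /bunit !blockdiagM; apply: eq_blockdiag => i; exact/esym/scalar_mxC.
Qed.

Lemma bunit_diag k : exists v, bunit k = diag_mx v.
Proof.
rewrite /bunit /blockdiag; case: _ / e => /=.
exists (\mxrow_j (const_mx (j == k)%:R)); rewrite castmx_id diag_mxrow.
by apply: eq_mxdiag => j; rewrite diag_const_mx.
Qed.

Definition blk (X : 'M[C]_n) k : 'M[C]_(ns k) := submxblock (castmx (esym e, esym e) X) k k.

(** For i != j, the (i, j) blocks of E_i X and X E_i are X_ij and 0, so all off-diagonal blocks
    vanish. *)
Lemma blkK (X : 'M[C]_n) : (forall k, comm_mx (bunit k) X) -> blockdiag e (blk X) = X.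
Proof.
rewrite /bunit /blk /blockdiag; case: _ / e X => /= X h; rewrite !castmx_id.
rewrite -[RHS]submxblockK /mxdiag; apply: eq_mxblock => i j.
case: eqP => [ij|ij]; first by case: _ / ij; rewrite conform_mx_id.
have := h i; rewrite /comm_mx castmx_id -{1 2}[X]submxblockK mul_mxdiag_mxblock mul_mxblock_mxdiag.
move/eq_mxblockP => /(_ i j); rewrite eqxx mul1mx => ->.
by case: eqP => [ji|_]; [case: ij | rewrite raddf0 mulmx0].
Qed.
End Cast.

(** The conjugated projections stay diagonal, so they commute with F_D and with the limits of H_D
    and H_U. *)
Lemma perm_diag n (s : 'S_n) (v : 'rV[C]_n) :
  perm_mx s *m diag_mx v *m invmx (perm_mx s) = diag_mx (\row_j v ord0 (s j)).
Proof.
suff -> : perm_mx s *m diag_mx v = diag_mx (\row_j v ord0 (s j)) *m perm_mx s.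
  by rewrite mulmxK ?unitmx_perm.
apply/matrixP => i j; rewrite -row_permE mul_diag_mx !mxE.
by rewrite mulr_natr.
Qed.
End Blocks.

(** * The substitution built from the projectors *)

Section Assemble.
Context {R : realType}.
Local Notation C := R[i].

Lemma fder_cont (F : C * C -> C) p d d' : fder F p d d' -> forall e : R, 0 < e ->
  exists2 r : R, 0 < r & forall q, cmod (q.1 - p.1) < r -> cmod (q.2 - p.2) < r ->
    cmod (F q - F p) < e.
Proof.
move=> h e e0; have [r r0 rP] := h 1 ltr01; set A := cmod d + cmod d' + 1.
have A0 : 0 < A by rewrite ltr_wpDl // addr_ge0 // cmod_ge0.
exists (Num.min r (e / (2 * A))); first by rewrite lt_min r0 divr_gt0 // mulr_gt0.
move=> q; rewrite !lt_min => /andP[h1 h2] /andP[k1 k2].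
have := rP q h1 k1; rewrite mul1r => h3.
have -> : F q - F p = (F q - F p - (d * (q.1 - p.1) + d' * (q.2 - p.2))) +
  (d * (q.1 - p.1) + d' * (q.2 - p.2)) by ring.
rewrite (le_lt_trans (cmodD _ _)) // (le_lt_trans (lerD h3 (cmodD _ _))) // !cmodM.
have -> : e = A * (e / (2 * A) + e / (2 * A)) by field; rewrite gt_eqF.
apply: (@le_lt_trans _ _ (A * (cmod (q.1 - p.1) + cmod (q.2 - p.2)))); last first.
  by rewrite ltr_pM2l // ltrD.
rewrite /A; have := cmod_ge0 (q.1 - p.1); have := cmod_ge0 (q.2 - p.2).
have := cmod_ge0 d; have := cmod_ge0 d'.
move: (cmod d) (cmod d') (cmod (q.1 - p.1)) (cmod (q.2 - p.2)) => x y u v y0 x0 v0 u0.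
have : 0 <= x * v by rewrite mulr_ge0.
have : 0 <= y * u by rewrite mulr_ge0.
have -> : (x + y + 1) * (u + v) = x * u + x * v + y * u + y * v + (u + v) by ring.
by move: (x * u) (x * v) (y * u) (y * v) => *; lra.
Qed.

Variables (n m : nat) (E : 'I_m -> 'M[C]_n).
Hypothesis EE : forall k l, E k *m E l = (k == l)%:R *: E k.
Hypothesis sumE : \sum_k E k = 1%:M.
Variables (B : C -> C -> 'M[C]_n) (G : 'I_m -> C -> C -> 'M[C]_n) (a : R).
Hypothesis a0 : 0 < a.
Hypothesis dG : forall k i j (e x : C), cmod e < a -> cmod x < a ->
  differentiable (fun q : C * C => G k q.1 q.2 i j) (e, x).
Hypothesis dB : forall i j (e x : C), cmod e < a -> cmod x < a ->
  differentiable (fun q : C * C => B q.1 q.2 i j) (e, x).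
Hypothesis odeG : forall k (e x : C), cmod e < a -> cmod x < a ->
  exists2 D, mder (G k e) x D & (x ^+ 2 - e) *: D = comm_mx2 (B e x) (G k e x).
Hypothesis GG : forall k l (e x : C), cmod e < a -> cmod x < a ->
  G k e x *m G l e x = (k == l)%:R *: G k e x.
Hypothesis G00 : forall k, G k 0 0 = E k.

Let pick_r (F : 'I_m -> 'M[C]_n) j : \sum_k F k *m E k *m E j = F j *m E j.
Proof.
rewrite (bigD1 j) //= -mulmxA EE eqxx scale1r big1 ?addr0 // => k kj.
by rewrite -mulmxA EE (negPf kj) scale0r mulmx0.
Qed.

(* As [(x^2 - e) G_k' = [B, G_k]], one has [(x^2 - e) Q' = B Q - \sum_k G_k B E_k]:
   the substitution [y = Q v] turns [B] into [newB]. Moreover [G_j Q = Q E_j]. *)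
Definition bigQ e x := \sum_k G k e x *m E k.
Definition GBE e x := \sum_k G k e x *m B e x *m E k.
Definition newB e x := minv (bigQ e x) *m GBE e x.

Let pick_l (F : 'I_m -> 'M[C]_n) j e x : cmod e < a -> cmod x < a ->
  \sum_k G j e x *m (G k e x *m F k) = G j e x *m F j.
Proof.
move=> ea xa; rewrite (bigD1 j) //= mulmxA GG // eqxx scale1r big1 ?addr0 // => k kj.
by rewrite mulmxA GG // eq_sym (negPf kj) scale0r mul0mx.
Qed.

Lemma bigQ_comm j e x : cmod e < a -> cmod x < a ->
  G j e x *m bigQ e x = bigQ e x *m E j.
Proof. by move=> ea xa; rewrite /bigQ mulmx_sumr mulmx_suml pick_r pick_l. Qed.

Lemma newB_comm j e x : cmod e < a -> cmod x < a -> bigQ e x \in unitmx ->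
  comm_mx (E j) (newB e x).
Proof.
move=> ea xa Qu; rewrite /comm_mx /newB minvE //.
have h : E j *m invmx (bigQ e x) = invmx (bigQ e x) *m G j e x.
  by rewrite -[RHS](mulmxK Qu) -(mulmxA (invmx _) (G _ _ _)) bigQ_comm // mulKmx.
rewrite mulmxA h -!mulmxA; congr (_ *m _).
rewrite /GBE mulmx_suml pick_r mulmx_sumr.
by under eq_bigr do rewrite -mulmxA; rewrite pick_l // mulmxA.
Qed.

Lemma bigQ00 : bigQ 0 0 = 1%:M.
Proof.
rewrite /bigQ -sumE; apply: eq_bigr => k _; by rewrite G00 EE eqxx scale1r.
Qed.

Local Notation Pd p := (fun (F : C * C -> C) l => F p = l /\ differentiable F p).

Lemma bigQ_diff e x : cmod e < a -> cmod x < a ->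
  malg (Pd (e, x)) (fun q => bigQ q.1 q.2) (bigQ e x).
Proof.
move=> ea xa; have aP := alg_diff (e, x).
apply: (malg_sum aP) => k; apply: (malg_mul aP); last exact: (malg_cst aP).
by move=> i j; split; [exact: erefl | exact: dG].
Qed.

Lemma newB_diff e x : cmod e < a -> cmod x < a -> bigQ e x \in unitmx ->
  malg (Pd (e, x)) (fun q => newB q.1 q.2) (newB e x).
Proof.
move=> ea xa Qu; have aP := alg_diff (e, x).
apply: (malg_mul aP); first by apply: (malg_minv aP) => //; exact: bigQ_diff.
apply: (malg_sum aP) => k; apply: (malg_mul aP); last exact: (malg_cst aP).
by apply: (malg_mul aP) => i j; (split; first exact: erefl); [exact: dG | exact: dB].
Qed.

Lemma bigQ_unit : exists2 b : R, 0 < b <= a & forall e x, cmod e < b -> cmod x < b ->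
  bigQ e x \in unitmx.
Proof.
have aP := alg_diff ((0, 0) : C * C).
have [_ /diff_fder [d [d' /fder_cont h]]] :
    Pd (0, 0) (fun q => \det (bigQ q.1 q.2)) (\det (bigQ 0 0)).
  by apply: (alg_det aP); apply: bigQ_diff; rewrite cmod0.
have [r r0 rP] := h 1 ltr01.
exists (Num.min r a); first by rewrite lt_min r0 a0 ge_min lexx orbT.
move=> e x; rewrite !lt_min => /andP[er ea] /andP[xr xa].
rewrite unitmxE unitfE; apply/negP => /eqP De.
have := rP (e, x); rewrite /= !subr0 bigQ00 det1 De => /(_ er xr).
by rewrite sub0r cmodN cmod1 ltxx.
Qed.

Lemma bigQ_ode e x : cmod e < a -> cmod x < a -> bigQ e x \in unitmx ->
  exists2 D, mder (bigQ e) x D &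
    (x ^+ 2 - e) *: D = B e x *m bigQ e x - bigQ e x *m newB e x.
Proof.
move=> ea xa Qu; pose D k := xget 0 [set D | mder (G k e) x D /\
   (x ^+ 2 - e) *: D = comm_mx2 (B e x) (G k e x)].
have DP k : mder (G k e) x (D k) /\ (x ^+ 2 - e) *: D k = comm_mx2 (B e x) (G k e x).
  rewrite /D; case: xgetP => // H; exfalso.
  by have [D' h1 h2] := odeG k ea xa; apply: (H D').
exists (\sum_k D k *m E k).
  apply: mder_sum => k; rewrite -[D k *m E k]addr0 -[X in _ + X](mulmx0 _ (G k e x)).
  by apply: mderM; [have [] := DP k | exact: mder_cst].
rewrite /newB minvE // mulKVmx // /bigQ /GBE mulmx_sumr -sumrB scaler_sumr.
apply: eq_bigr => k _; rewrite scalemxAl; have [_ ->] := DP k.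
by rewrite /comm_mx2 mulmxBl !mulmxA.
Qed.
End Assemble.

Section Transform.
Context {R : realType}.
Local Notation C := R[i].
Variable n : nat.

(** By [step], the residuals of the two systems correspond under [T]. For the direct implication, v
    is first seen to be differentiable, as T^-1 (T v). *)
Lemma transform_solves (B B' : C -> C -> 'M[C]_n) (T : C -> 'M[C]_n) e x T' :
  cnbhs x [set y | T y \in unitmx] -> mder T x T' ->
  (x ^+ 2 - e) *: T' = B e x *m T x - T x *m B' e x ->
  forall v : C -> 'cV[C]_n,
  solves_at B e (fun y => T y *m v y) x <-> solves_at B' e v x.
Proof.
move=> Tu dT eqT v; have Tux := cnbhs_self Tu; rewrite /= in Tux.
have step V : mder v x V -> (x ^+ 2 - e) *: (T' *m v x + T x *m V) =
    B e x *m (T x *m v x) + T x *m ((x ^+ 2 - e) *: V - B' e x *m v x).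
  move=> _; rewrite scalerDr !scalemxAl eqT mulmxBl mulmxBr -!scalemxAl -scalemxAr.
  by rewrite !mulmxA -!addrA [- _ + _]addrC.
split=> /solves_mder [D dD eqD]; apply/solves_mder; last first.
  exists (T' *m v x + T x *m D); first exact: mderM.
  by rewrite step // eqD subrr mulmx0 addr0.
have c2 : malg (fun f l => f x = l /\ exists d, cder f x d) T (T x).
  by move=> i j; split=> //; exists (T' i j).
have [V dV] : exists V, mder v x V.
  have h i j : exists d, cder (fun y => v y i j) x d.
    have dv : malg (fun f l => f x = l /\ exists d, cder f x d)
       (fun y => minv (T y) *m (T y *m v y)) (minv (T x) *m (T x *m v x)).
      apply: (malg_mul (alg_cder x)); first exact: (malg_minv (alg_cder x)).
      by move=> a b; split=> //; exists (D a b).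
    have [_ [d dP]] := dv i j; exists d; apply: cder_near dP.
    by apply: filterS Tu => y /= yu; rewrite minvE // mulKmx.
  exists (\matrix_(i, j) cd (fun y => v y i j) x) => i j; rewrite mxE.
  by have [d dP] := h i j; rewrite (cdP dP).
exists V => //; have eqV := step V dV.
have DE : D = T' *m v x + T x *m V by apply: mder_uniq dD _; exact: mderM.
move: eqD; rewrite DE eqV -[RHS]addr0 => /addrI h.
apply/eqP; rewrite -subr_eq0; apply/eqP.
by rewrite -[LHS](mulKmx Tux) h mulmx0.
Qed.
End Transform.

Lemma comm_mx_conj {F : fieldType} n (P U X : 'M[F]_n) : P \in unitmx ->
  comm_mx (P *m U *m invmx P) X -> comm_mx U (invmx P *m X *m P).
Proof.
move=> Pu h; have conjM (Y Z : 'M[F]_n) :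
    invmx P *m Y *m P *m (invmx P *m Z *m P) = invmx P *m (Y *m Z) *m P.
  by rewrite !mulmxA mulmxK.
have UE : U = invmx P *m (P *m U *m invmx P) *m P by rewrite -!mulmxA mulVmx // mulmx1 mulKmx.
by rewrite /comm_mx UE !conjM h.
Qed.

Section Conclude.
Context {R : realType}.
Local Notation C := R[i].
Variables (n m : nat) (ns : 'I_m -> nat) (en : (\sum_k ns k)%N = n) (s : 'S_n).
Let P0 : 'M[C]_n := perm_mx s.
Definition cunit k : 'M[C]_n := perm_mx s *m bunit en k *m invmx (perm_mx s).

Lemma cunit_mul k l : cunit k *m cunit l = (k == l)%:R *: cunit k.
Proof.
have P0u : perm_mx s \in unitmx := unitmx_perm C s.
rewrite /cunit -!mulmxA (mulmxA (invmx _)) mulVmx // mul1mx (mulmxA (bunit en k)) bunit_mul.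
by rewrite -scalemxAl -scalemxAr.
Qed.

Lemma cunit_sum : \sum_k cunit k = 1%:M.
Proof.
by rewrite /cunit -mulmx_suml -mulmx_sumr bunit_sum mulmx1 mulmxV // unitmx_perm.
Qed.

(** The position does not depend on the matrix, so the blocks inherit differentiability. *)
Lemma blk_entry k i j : exists i' j', forall X : 'M[C]_n, blk en X k i j = X i' j'.
Proof.
eexists; eexists => X; rewrite /blk /submxblock /submxcol /submxrow !mxE castmxE; reflexivity.
Qed.

Lemma decompose (B : C -> C -> 'M[C]_n) (G : 'I_m -> C -> C -> 'M[C]_n) (a : R) : 0 < a ->
  (forall k i j (e x : C), cmod e < a -> cmod x < a ->
    differentiable (fun q : C * C => G k q.1 q.2 i j) (e, x)) ->
  (forall i j (e x : C), cmod e < a -> cmod x < a ->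
    differentiable (fun q : C * C => B q.1 q.2 i j) (e, x)) ->
  (forall k (e x : C), cmod e < a -> cmod x < a ->
    exists2 D, mder (G k e) x D & (x ^+ 2 - e) *: D = comm_mx2 (B e x) (G k e x)) ->
  (forall k l (e x : C), cmod e < a -> cmod x < a ->
    G k e x *m G l e x = (k == l)%:R *: G k e x) ->
  (forall k, G k 0 0 = cunit k) ->
  exists (Q : C -> C -> 'M[C]_n) (Bk : forall k, C -> C -> 'M[C]_(ns k)),
    [/\ analytic_germ2 Q, Q 0 0 \in unitmx, forall k, analytic_germ2 (Bk k) &
      transforms B (fun eps x => blockdiag en (fun k => Bk k eps x))
        (fun eps x => P0 *m Q eps x)].
Proof.
move=> a0 dG dB odeG GG G00; have P0u : P0 \in unitmx := unitmx_perm C s.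
have [b /andP[b0 ba] bu] := bigQ_unit cunit_mul cunit_sum a0 dG G00.
(* Since Q P0 = P0 (P0^-1 Q P0), conjugation moves the permutation to the left and turns the
   conjugated projections back into the block projections. *)
pose cjP (X : 'M[C]_n) := invmx P0 *m X *m P0.
exists (fun e x => cjP (bigQ cunit G e x)), (fun k e x => blk en (cjP (newB cunit B G e x)) k).
have near_b (Z : C * C -> Prop) : (forall e x, cmod e < b -> cmod x < b -> Z (e, x)) ->
    \forall p \near ((0, 0) : C * C), Z p.
  move=> h; apply/near0CC; exists b => // q; rewrite !subr0 => h1 h2.
  by rewrite [q]surjective_pairing; exact: h.
have cj_diff e x (F : C -> C -> 'M[C]_n) :
  malg (fun (F : C * C -> C) l => F (e, x) = l /\ differentiable F (e, x))
     (fun q => F q.1 q.2) (F e x) ->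
  malg (fun (F : C * C -> C) l => F (e, x) = l /\ differentiable F (e, x))
     (fun q => cjP (F q.1 q.2)) (cjP (F e x)).
  have aP := alg_diff (e, x).
  by move=> h; apply: (malg_mul aP); [apply: (malg_mul aP) => //|]; exact: (malg_cst aP).
split.
- move=> i j; apply: near_b => e x eb xb.
  have ea := lt_le_trans eb ba; have xa := lt_le_trans xb ba.
  by have [] := cj_diff e x _ (bigQ_diff cunit dG ea xa) i j.
- by rewrite /cjP (bigQ00 cunit_mul cunit_sum G00) mulmx1 mulVmx // unitmx1.
- move=> k i j; have [i' [j' ij]] := blk_entry i j; apply: near_b => e x eb xb.
  have ea := lt_le_trans eb ba; have xa := lt_le_trans xb ba.
  have [_] := cj_diff e x _ (newB_diff (E := cunit) dG dB ea xa (bu e x eb xb)) i' j'.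
  by under eq_fun do rewrite -ij.
apply: near_b => e x eb xb /=; have ea := lt_le_trans eb ba; have xa := lt_le_trans xb ba.
have Qu := bu e x eb xb.
have PQ y : P0 *m cjP (bigQ cunit G e y) = bigQ cunit G e y *m P0.
  by rewrite /cjP !mulmxA mulmxV // mul1mx.
have [D dD eqD] := bigQ_ode (E := cunit) odeG ea xa Qu.
apply: (@transform_solves _ _ _ _ _ _ _ (D *m P0)).
- exists (b - cmod x); first by rewrite subr_gt0.
  move=> y yx /=; rewrite PQ unitmx_mul P0u andbT; apply: bu => //.
  exact: cmod_near yx.
- move=> i j; under eq_fun do rewrite PQ; move: i j.
  rewrite -/(mder _ _ _) -[D *m P0]addr0 -[X in _ + X](mulmx0 _ (bigQ cunit G e x)).
  by apply: mderM => //; exact: mder_cst.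
rewrite PQ scalemxAl eqD blkK => [|k].
  by rewrite mulmxBl /cjP !mulmxA mulmxK // -!mulmxA.
have h := newB_comm cunit_mul B GG k ea xa Qu.
exact: comm_mx_conj h.
Qed.

End Conclude.

(** * The projectors at all parameters, and the theorem *)

Section ExtMx.
Context {R : realType}.
Local Notation C := R[i].
Implicit Types (e x z : C).

Lemma diff_fst (f : C -> C) e x d : cder f e d ->
  differentiable (fun q : C * C => f q.1) (e, x).
Proof.
move=> /cderP h; apply: (@fder_diff _ _ _ d 0) => u u0; have [r r0 rP] := h u u0.
exists r => // q q1 _ /=; rewrite mul0r addr0 (le_trans (rP _ q1)) //.
by rewrite ler_wpM2l ?lerDl ?cmod_ge0 // ltW.
Qed.

Lemma diff_snd e x : differentiable (fun q : C * C => q.2) (e, x).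
Proof.
apply: (@fder_diff _ _ _ 0 1) => u u0; exists 1 => // q _ _ /=.
by rewrite mul0r add0r mul1r subrr cmod0 mulr_ge0 ?addr_ge0 ?cmod_ge0 // ltW.
Qed.

Lemma diff_ccvg1 (f : C -> C -> C) e x : differentiable (fun q : C * C => f q.1 q.2) (e, x) ->
  ccvg (cnbhs e) (fun u => f u x) (f e x).
Proof. by move=> /diff_fder [d [d' /fder_cder1 /cder_cont]]. Qed.

Lemma mul_extend n (X Y : C -> 'M[C]_n) c (d : R) : 0 < d ->
  malg (ccvg (cnbhs (0 : C))) X (X 0) -> malg (ccvg (cnbhs (0 : C))) Y (Y 0) ->
  (forall u, u != 0 -> cmod u < d -> X u *m Y u = c *: X u) -> X 0 *m Y 0 = c *: X 0.
Proof.
move=> d0 cX cY h; have aP := @alg_ccvg R C (cnbhs 0) (cnbhs_filter 0).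
apply/matrixP => i j; rewrite [RHS]mxE.
apply: (@dense_off _ (fun u => (X u *m Y u) i j) (fun u => c * X u i j)) => [||e e0].
- exact: (malg_mul aP cX cY i j).
- by apply: ccvgM; [exact: ccvg_cst | exact: cX].
have y0 : 0 < Num.min (e / 2) (d / 2) by rewrite lt_min !divr_gt0.
exists (Num.min (e / 2) (d / 2))%:C; rewrite subr0 cmodR gtr0_norm //; split.
  by rewrite gt_min; apply/orP; left; lra.
rewrite h ?mxE //; first by rewrite -cmod_gt0 cmodR gtr0_norm.
by rewrite cmodR gtr0_norm // gt_min; apply/orP; right; lra.
Qed.

Variables (n : nat) (L0 L1 : C -> 'rV[C]_n) (Rm : C -> C -> 'M[C]_n).
Variable b : R.
Hypothesis b0 : 0 < b.
Hypothesis dL0 : forall e i, cmod e < b -> exists d, cder (fun e => L0 e ord0 i) e d.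
Hypothesis dL1 : forall e i, cmod e < b -> exists d, cder (fun e => L1 e ord0 i) e d.
Hypothesis dR : forall i j e x, cmod e < b -> cmod x < b ->
  differentiable (fun q : C * C => Rm q.1 q.2 i j) (e, x).
Local Notation B := (family_mx L0 L1 Rm).

Lemma family_diff i j e x : cmod e < b -> cmod x < b ->
  differentiable (fun q : C * C => B q.1 q.2 i j) (e, x).
Proof.
move=> eb xb; have [Pc Pa Pm _] := alg_diff (e, x).
have P1 f d : cder f e d -> f e = f e /\ differentiable (fun q : C * C => f q.1) (e, x).
  by move=> fd; split; [exact: erefl | exact: diff_fst fd].
have P2 : x = x /\ differentiable (fun q : C * C => q.2) (e, x) by split; [exact: erefl | exact: diff_snd].
have PR : Rm e x i j = Rm e x i j /\ differentiable (fun q : C * C => Rm q.1 q.2 i j) (e, x).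
  by split; [exact: erefl | exact: dR].
have [d0 h0] := dL0 i eb; have [d1 h1] := dL1 i eb.
have PL := Pa _ _ _ _ (P1 _ _ h0) (Pm _ _ _ _ P2 (P1 _ _ h1)).
have PX := Pa _ _ _ _ (Pm _ _ _ _ P2 P2) (P1 _ _ (cderN (cder_id e))).
have [_] := Pa _ _ _ _ (Pm _ _ _ _ PL (Pc (i == j)%:R)) (Pm _ _ _ _ PX PR).
by under eq_fun do rewrite -expr2 mulr_natr; under [X in _ -> differentiable X _]eq_fun do
  rewrite /family_mx /Lam !mxE.
Qed.

Variables (P : C -> C -> 'M[C]_n) (E : 'M[C]_n) (p r M : R).
Hypotheses (p0 : 0 < p) (r0 : 0 < r) (pr : p <= (r / 2) ^+ 2).
Hypothesis PM : forall e x i j, e != 0 -> cmod e < p -> cmod x <= r -> cmod (P e x i j) <= M.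
Hypothesis Psol : forall e, e != 0 -> cmod e < p -> sol r e (L0 e) (L1 e) (Rm e) (P e).
Hypothesis P1 : forall e x i j, e != 0 -> cmod e < p -> cmod x <= r -> x ^+ 2 != e ->
  exists d, cder (fun u => P u x i j) e d.
Hypothesis Pbr : forall e x, e != 0 -> cmod e < p -> cmod x <= r -> x ^+ 2 = e -> P e x = E.

Let s := r / 2.
Let a := Num.min (3 / 8 * p) (3 / 4 * s).
Definition extmx e x : 'M[C]_n := \matrix_(i, j) ext (fun e x => P e x i j) p (r / 2) e x.

Let s0 : 0 < s. Proof. by rewrite /s divr_gt0. Qed.
Let sr : s < r. Proof. by rewrite /s; move: r0 => h; lra. Qed.
Let a0 : 0 < a.
Proof. by rewrite lt_min; move: p0 s0 => h1 h2; apply/andP; split; lra. Qed.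

Let FM i j e x : e != 0 -> cmod e < p -> cmod x <= s -> cmod (P e x i j) <= M.
Proof. by move=> e0 ep xs; apply: PM => //; exact: le_trans (ltW sr). Qed.
Let F2 i j e : e != 0 -> cmod e < p -> hol (fun x => P e x i j) r.
Proof. by move=> e0 ep; have [h _ _] := Psol e0 ep; exact: h. Qed.
(** On the circle |z| = r / 2 one has |z^2| >= p > |e| by [pr], so it contains no singular point. *)
Let F1 i j e z : e != 0 -> cmod e < p -> cmod z = s -> exists d, cder (fun e => P e z i j) e d.
Proof.
move=> e0 ep zs; apply: P1 => //; first by rewrite zs ltW.
apply: contraTneq ep => <-; rewrite -leNgt expr2 cmodM zs -expr2; exact: pr.
Qed.

Lemma extmx_diff i j e x : cmod e < a / 2 -> cmod x < a / 2 ->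
  differentiable (fun q : C * C => extmx q.1 q.2 i j) (e, x).
Proof.
move=> ea xa; under eq_fun do rewrite mxE.
exact: fder_diff (ext_fder p0 s0 (@FM i j) ea xa).
Qed.

Lemma extmxE e x : e != 0 -> cmod e < a -> cmod x < a -> extmx e x = P e x.
Proof.
move=> e0 ea xa; apply/matrixP => i j; rewrite mxE.
exact: (extE p0 s0 sr (@FM i j) (@F2 i j) (@F1 i j)).
Qed.

(** Along the curve x = y, e = y^2 of singular points the value is [E]; let y tend to 0. *)
Lemma extmx00 : extmx 0 0 = E.
Proof.
have ha : 0 < a / 2 by rewrite divr_gt0.
apply/matrixP => i j; apply/eqP; rewrite -subr_eq0 -cmod_eq0 eq_le cmod_ge0 andbT.
apply/ler_addgt0Pr => u u0; rewrite add0r.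
have [||d [d' /fder_cont h]] := diff_fder (@extmx_diff i j 0 0 _ _); rewrite ?cmod0 //.
have [q q0 qP] := h u u0; pose y := Num.min (Num.min (q / 2) (a / 4)) 2^-1.
have y0 : 0 < y.
  have a4 : 0 < a / 4 by rewrite divr_gt0.
  by rewrite !lt_min a4 invr_gt0 ltr0n !andbT divr_gt0.
have yq : y <= q / 2 by rewrite /y !ge_min lexx.
have ya : y <= a / 4 by rewrite /y !ge_min lexx orbT.
have y1 : y <= 2^-1 by rewrite /y !ge_min lexx orbT.
have cy : cmod y%:C = y by rewrite cmodR gtr0_norm.
have cy2 : cmod (y%:C ^+ 2) < y by rewrite cmodX cy expr2; nra.
have yn : y%:C ^+ 2 != 0 :> C by rewrite expf_neq0 // -cmod_gt0 cy.
have := qP (y%:C ^+ 2, y%:C); rewrite /= !subr0 cy => /(_ _ _) /ltW.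
have ap : a <= 3 / 8 * p by rewrite /a ge_min lexx.
have as_ : a <= 3 / 4 * s by rewrite /a ge_min lexx orbT.
rewrite extmxE ?cy //; first last.
- lra.
- lra.
rewrite Pbr ?cy //; first by rewrite cmodBC; apply; lra.
- lra.
- by move: sr s0 => h1 h2; lra.
Qed.

(** For e != 0 this is the equation of [P]. Both sides are continuous in e at 0, the left one by
    [ext_cd_cont]. *)
Lemma extmx_ode e x : cmod e < Num.min (a / 2) b -> cmod x < Num.min (a / 2) b ->
  exists2 D, mder (extmx e) x D & (x ^+ 2 - e) *: D = comm_mx2 (B e x) (extmx e x).
Proof.
rewrite !lt_min => /andP[ea eb] /andP[xa xb].
have [ha a2] : a / 2 < a /\ 0 < a / 2 by move: a0 => h; split; lra.
have hx e' i j : cmod e' < a -> hol (fun x => extmx e' x i j) a.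
  move=> e'a; under eq_fun do rewrite mxE.
  exact: (ext_hol2 p0 s0 (@FM i j)).
exists (\matrix_(i, j) cd (fun x => extmx e x i j) x).
  by move=> i j; rewrite mxE; apply: hol_cd (lt_trans xa ha); apply: hx; exact: lt_trans ha.
apply/matrixP => i j; rewrite 2!mxE.
pose lhs u := (x ^+ 2 - u) * cd (fun x => extmx u x i j) x.
pose rhs u := comm_mx2 (B u x) (extmx u x) i j.
have ap : a <= 3 / 8 * p by rewrite /a ge_min lexx.
have as_ : a <= 3 / 4 * s by rewrite /a ge_min lexx orbT.
have off u : u != 0 -> cmod u < a -> lhs u = rhs u.
  move=> u0 ua; have up : cmod u < p by move: p0 => h; lra.
  have xr : cmod x < r by move: sr s0 => h1 h2; lra.
  have [_ h _] := Psol u0 up; have := h x xr i j; rewrite -family_comm => {}h.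
  rewrite /rhs extmxE //; last exact: lt_trans ha.
  rewrite -h /lhs; congr (_ * _); apply: cdP; apply: (@cder_near _ (fun x => P u x i j)).
    exists (a / 2 - cmod x); first by rewrite subr_gt0.
    move=> y yx /=; rewrite extmxE //.
    exact: lt_trans (cmod_near yx) ha.
  exact: (hol_cd (F2 i j u0 up)).
have [e0|e0] := eqVneq e 0; last exact: off (lt_trans ea ha).
rewrite e0 -/(lhs 0) -/(rhs 0); apply: dense_off => [||u u0].
- have eF u : (fun x => extmx u x i j) = ext (fun e x => P e x i j) p (r / 2) u.
    by apply/funext => y; rewrite mxE.
  rewrite /lhs; under eq_fun do rewrite eF.
  apply: ccvgM; first by apply: ccvgB; [exact: ccvg_cst | exact: ccvg_id].
  exact: (ext_cd_cont p0 s0 (@FM i j) xa).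
- have aP := @alg_ccvg R C (cnbhs 0) (cnbhs_filter 0).
  have cB : malg (ccvg (cnbhs (0 : C))) (fun u => B u x) (B 0 x).
    by move=> k l; apply: (diff_ccvg1 (f := fun u x => B u x k l)); apply: family_diff; rewrite ?cmod0.
  have cP : malg (ccvg (cnbhs (0 : C))) (fun u => extmx u x) (extmx 0 x).
    by move=> k l; apply: (diff_ccvg1 (f := fun u x => extmx u x k l)); apply: extmx_diff; rewrite ?cmod0.
  rewrite /ccont /rhs /comm_mx2; under eq_fun do rewrite subr_mxE; rewrite subr_mxE.
  by apply: ccvgB; [exact: (malg_mul aP cB cP i j) | exact: (malg_mul aP cP cB i j)].
- pose y := Num.min (u / 2) (a / 2); have y0 : 0 < y by rewrite lt_min a2 divr_gt0.
  exists y%:C; rewrite subr0 cmodR gtr0_norm //; split.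
    by have : y <= u / 2 by [rewrite /y ge_min lexx]; lra.
  apply: off; first by rewrite -cmod_gt0 cmodR gtr0_norm.
  by rewrite cmodR gtr0_norm //; have : y <= a / 2 by [rewrite /y ge_min lexx orbT]; lra.
Qed.
End ExtMx.

(** * Uniform constants of a prenormal family *)

Section Prenormal.
Context {R : realType}.
Local Notation C := R[i].
Local Notation Re := (@complex.Re R).
Implicit Types (e x : C).

Lemma theta0_le n (L0 L1 : C -> 'rV[C]_n) : theta0 L0 L1 <= pi / 2.
Proof.
have p2 : 0 <= pi / 2 :> R by rewrite divr_ge0 // pi_ge0.
rewrite /theta0; set A := [set _ | _]; have [[th Ath]|nA] := pselect (A !=set0).
  by apply: ge_sup; [exists th | move=> u [/andP[_ /ltW]]].
(* The supremum of the empty set is 0 by convention. *)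
rewrite sup_out // => -[]; by [].
Qed.

Lemma comm_mx_conjV n (P U X : 'M[C]_n) : P \in unitmx ->
  comm_mx U (invmx P *m X *m P) -> comm_mx (P *m U *m invmx P) X.
Proof.
move=> Pu h; have P'u : invmx P \in unitmx by rewrite unitmx_inv.
have := @comm_mx_conj _ _ (invmx P) (P *m U *m invmx P) (invmx P *m X *m P) P'u.
have UE : invmx P *m (P *m U *m invmx P) *m P = U by rewrite -!mulmxA mulVmx // mulmx1 mulKmx.
have XE : P *m (invmx P *m X *m P) *m invmx P = X by rewrite -!mulmxA mulmxV // mulmx1 mulKVmx.
by rewrite invmxK UE XE; apply.
Qed.

Lemma fin_max (I : finType) (Q : I -> R -> Prop) :
  (forall i M M', M <= M' -> Q i M -> Q i M') -> (forall i, exists M, Q i M) ->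
  exists2 M, 0 < M & forall i, Q i M.
Proof.
move=> mono /choice [f fP]; exists (1 + \sum_i `|f i|).
  by rewrite ltr_pwDl // sumr_ge0.
move=> i; apply: mono (fP i); rewrite (bigD1 i) //= (le_trans (ler_norm _)) //.
have := sumr_ge0 (P := fun j => j != i) (index_enum I) (fun j _ => normr_ge0 (f j)).
by move: (\sum_(_ | _) _) (`|_|) => u v; lra.
Qed.

Lemma diff_near_bound (f : C -> C) : (exists d, cder f 0 d) ->
  exists M : R, \forall e \near (0 : C), cmod (f e) <= M.
Proof.
move=> [d /cder_cont /(_ 1 ltr01) [r r0 rP]]; exists (cmod (f 0) + 1); apply/near0C.
exists r => // e /rP /= h; have := cmodD (f e - f 0) (f 0); rewrite subrK.
by move: (cmod (f e)) (cmod (f 0)) (cmod _) h => a b c; lra.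
Qed.

Lemma prenormal_radius n (L0 L1 : C -> 'rV[C]_n) Rm : prenormal L0 L1 Rm ->
  exists b1 b c : R, [/\ 0 < b1, 0 <= b, 0 < c &
    forall e, cmod e < b1 ->
    [/\ forall i, (exists d, cder (fun e => L0 e ord0 i) e d) /\
                  (exists d, cder (fun e => L1 e ord0 i) e d),
        forall i, cmod (L0 e ord0 i) <= b /\ cmod (L1 e ord0 i) <= b,
        forall i j, i != j -> c <= cmod (L0 e ord0 i - L0 e ord0 j) &
        forall x, cmod x < b1 -> forall i j, cmod (Rm e x i j) <= b /\
          differentiable (fun q : C * C => Rm q.1 q.2 i j) (e, x)]].
Proof.
move=> [/near0C [r1 r10 d0] /near0C [r2 r20 d1] dR gap].
have dL0 e i : cmod e < r1 -> exists d, cder (fun e => L0 e ord0 i) e d.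
  by move=> er; eexists; apply: derivable_cder; apply: d0; rewrite subr0.
have dL1 e i : cmod e < r2 -> exists d, cder (fun e => L1 e ord0 i) e d.
  by move=> er; eexists; apply: derivable_cder; apply: d1; rewrite subr0.
pose Q1 (i : 'I_n) (M : R) := \forall e \near (0 : C),
  cmod (L0 e ord0 i) <= M /\ cmod (L1 e ord0 i) <= M.
pose Q2 (ij : 'I_n * 'I_n) (M : R) := \forall p \near ((0, 0) : C * C),
  cmod (Rm p.1 p.2 ij.1 ij.2) <= M.
(* [M] is the inverse of a gap, so that enlarging it weakens the condition, as [fin_max]
   requires. *)
pose Q3 (ij : 'I_n * 'I_n) (M : R) := \forall e \near (0 : C),
  ij.1 != ij.2 -> 1 <= M * cmod (L0 e ord0 ij.1 - L0 e ord0 ij.2).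
have [M1 M10 H1] : exists2 M, 0 < M & forall i, Q1 i M.
  apply: fin_max => [i M M' MM|i].
    by apply: filterS => e [h1 h2]; split; exact: le_trans MM.
  have [|M HM] := diff_near_bound (f := fun e => L0 e ord0 i); first by apply: dL0; rewrite cmod0.
  have [|M' HM'] := diff_near_bound (f := fun e => L1 e ord0 i); first by apply: dL1; rewrite cmod0.
  exists (Num.max M M'); apply: filterS2 HM HM' => e h1 h2.
  by split; rewrite le_max ?h1 ?h2 ?orbT.
have [M2 M20 H2] : exists2 M, 0 < M & forall ij, Q2 ij M.
  apply: fin_max => [ij M M' MM|[i j]].
    by apply: filterS => p h; exact: le_trans MM.
  have /near0CC [r r0 /(_ (0, 0))] := dR i j; rewrite !subr0 cmod0 => /(_ r0 r0).
  move=> /diff_fder [d [d' /fder_cont h]]; have [q q0 qP] := h 1 ltr01.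
  exists (cmod (Rm 0 0 i j) + 1); apply/near0CC; exists q => // p p1 p2.
  have := qP p p1 p2; have := cmodD (Rm p.1 p.2 i j - Rm 0 0 i j) (Rm 0 0 i j); rewrite subrK /=.
  by move: (cmod _) (cmod _) (cmod _) => u v w; lra.
have gap0 (i j : 'I_n) : i != j -> L0 0 ord0 i - L0 0 ord0 j != 0.
  move=> ij; apply/eqP => h; have LE k : Lam L0 L1 0 0 ord0 k = L0 0 ord0 k.
    by rewrite /Lam !mxE mul0r addr0.
  have [lt|lt|eq] := ltngtP i j.
  - by have := gap i j lt; rewrite !LE h ltxx.
  - by have := gap j i lt; rewrite !LE -opprB h oppr0 ltxx.
  - by move/eqP: ij; apply; exact: val_inj.
have [M3 M30 H3] : exists2 M, 0 < M & forall ij, Q3 ij M.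
  apply: fin_max => [ij M M' MM|[i j]].
    apply: filterS => e h /h; move=> h1; apply: (le_trans h1).
    by rewrite ler_wpM2r ?cmod_ge0.
  have [->|ij] := eqVneq i j; first by exists 0; apply/near0C; exists 1 => // e _; rewrite eqxx.
  have [|d dP] := dL0 0 i; first by rewrite cmod0.
  have [|d' dP'] := dL0 0 j; first by rewrite cmod0.
  have [r r0 rP] := ccvg_neq0 (gap0 i j ij) (cder_cont (cderB dP dP')).
  have g0 : 0 < cmod (L0 0 ord0 i - L0 0 ord0 j) by rewrite cmod_gt0 gap0.
  exists (2 / cmod (L0 0 ord0 i - L0 0 ord0 j)); apply/near0C; exists r => // e /rP /= h _.
  by rewrite mulrAC ler_pdivlMr //; move: h; clear; lra.
pose Z (q : C * C) :=
  [/\ forall i, cmod (L0 q.1 ord0 i) <= M1 /\ cmod (L1 q.1 ord0 i) <= M1,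
      forall ij : 'I_n * 'I_n, ij.1 != ij.2 -> 1 <= M3 * cmod (L0 q.1 ord0 ij.1 - L0 q.1 ord0 ij.2),
      forall ij : 'I_n * 'I_n, cmod (Rm q.1 q.2 ij.1 ij.2) <= M2 &
      forall ij : 'I_n * 'I_n, differentiable (fun q : C * C => Rm q.1 q.2 ij.1 ij.2) q].
have [r r0 rP] : exists2 r : R, 0 < r & forall q : C * C, cmod (q.1 - 0) < r ->
    cmod (q.2 - 0) < r -> Z q.
  have H4 (ij : 'I_n * 'I_n) : \forall p \near ((0, 0) : C * C),
    differentiable (fun q : C * C => Rm q.1 q.2 ij.1 ij.2) p by exact: dR.
  have [a1 a10 A1] := (near0C _ _).1 (filter_forall _ H1).
  have [a2 a20 A2] := (near0CC (fun p => forall ij : 'I_n * 'I_n, cmod (Rm p.1 p.2 ij.1 ij.2) <= M2)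
    (0, 0)).1 (filter_forall _ H2).
  have [a3 a30 A3] := (near0C _ _).1 (filter_forall _ H3).
  have [a4 a40 A4] := (near0CC (fun p => forall ij : 'I_n * 'I_n,
    differentiable (fun q : C * C => Rm q.1 q.2 ij.1 ij.2) p) (0, 0)).1 (filter_forall _ H4).
  exists (Num.min (Num.min a1 a2) (Num.min a3 a4)); first by rewrite !lt_min a10 a20 a30.
  move=> p; rewrite !lt_min => /andP[/andP[p1 p2] /andP[p3 p4]] /andP[/andP[_ q2] /andP[_ q4]].
  by split; [exact: A1 | exact: A3 | exact: A2 | exact: A4].
exists (Num.min (Num.min r1 r2) r), (M1 + M2), M3^-1; split.
- by rewrite !lt_min r10 r20.
- by rewrite addr_ge0 // ltW.
- by rewrite invr_gt0.
move=> e; rewrite !lt_min => /andP[/andP[e1 e2] er].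
have e00 : cmod (0 - 0 : C) < r by rewrite subr0 cmod0.
have [h1 h3 _ _] := rP (e, 0) (etrans (congr1 (fun z => cmod z < r) (subr0 e)) er) e00.
split=> [i|i|i j ij|x].
- by split; [exact: dL0 | exact: dL1].
- by have [g1 g2] := h1 i; split; [move: g1 | move: g2] => /= g; apply: (le_trans g); rewrite lerDl ltW.
- by have := h3 (i, j) ij; rewrite /= -ler_pdivrMl // mulr1.
rewrite !lt_min => /andP[_ xr] i j.
have [] := rP (e, x) (etrans (congr1 (fun z => cmod z < r) (subr0 e)) er)
  (etrans (congr1 (fun z => cmod z < r) (subr0 x)) xr).
move=> _ _ /(_ (i, j)) h2 /(_ (i, j)) h4; split=> //.
by apply: (le_trans h2); rewrite lerDr ltW.
Qed.
End Prenormal.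

Section Main.
Context {R : realType}.
Local Notation C := R[i].
Local Notation Re := (@complex.Re R).
Local Notation Im := (@complex.Im R).

Lemma FD_diagonal n (L0 L1 : C -> 'rV[C]_n) K FD w x : is_FD L0 L1 K FD -> Sdom K w ->
  OmD K w x -> exists v, FD w x = diag_mx v.
Proof. by move=> [l [_ _ _ h]] Sw [t Gt <-]; rewrite h //; eexists. Qed.
End Main.

Theorem theorem4p57 (R : realType) (n : nat) (hn : (2 <= n)%N)
    (L0 L1 : R[i] -> 'rV[R[i]]_n) (Rm : R[i] -> R[i] -> 'M[R[i]]_n)
    (hB : prenormal L0 L1 Rm)
    (gamma : R) (hgamma : 0 < gamma)
    (hgamma0 : gamma * (1 + 2 * gamma / pi) < theta0 L0 L1) :
  exists2 r0 : R, 0 < r0 & forall r : R, 0 < r < r0 ->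
  forall delta h kappa : R,
    0 < delta -> 0 < h < r^-1 -> 0 < kappa < 2^-1 ->
  exists2 c1 : R, 0 < c1 & forall cz : R, 0 < cz < c1 ->
  exists2 rho0 : R, 0 < rho0 & forall rho : R, 0 < rho < rho0 ->
  let K := Consts gamma rho r delta cz h kappa in
  no_ray L0 L1 K -> spectral_gap L0 L1 K ->
  forall FD FU HD HU : R[i] -> R[i] -> 'M[R[i]]_n,
  forall CR CL : R[i] -> 'M[R[i]]_n,
    is_FD L0 L1 K FD -> is_FU K FD FU ->
    is_H (family_mx L0 L1 Rm) K FD FU HD HU ->
    unfolded_stokes K FD HD HU CR CL ->
  forall (m : nat) (ns : 'I_m -> nat) (hns : forall k, (0 < ns k)%N)
         (e : (\sum_k ns k)%N = n) (s : {perm 'I_n}),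
  let P0 : 'M[R[i]]_n := perm_mx s in
    (forall w, Sdom K w ->
      [/\ exists bR : forall k, 'M[R[i]]_(ns k),
            invmx P0 *m CR w *m P0 = blockdiag e bR,
          exists bL : forall k, 'M[R[i]]_(ns k),
            invmx P0 *m CL w *m P0 = blockdiag e bL,
          is_trig_mx (invmx P0 *m CR w *m P0)^T &
          is_trig_mx (invmx P0 *m CL w *m P0)]) ->
  exists (Q : R[i] -> R[i] -> 'M[R[i]]_n)
         (Bk : forall k, R[i] -> R[i] -> 'M[R[i]]_(ns k)),
    [/\ analytic_germ2 Q, Q 0 0 \in unitmx,
        forall k, analytic_germ2 (Bk k) &
        transforms (family_mx L0 L1 Rm)
          (fun eps x => blockdiag e (fun k => Bk k eps x))
          (fun eps x => P0 *m Q eps x)].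
Proof.
have gam1 : gamma * (1 + 2 * gamma / pi) < pi / 2 := lt_le_trans hgamma0 (theta0_le L0 L1).
have [b1 [b [c [b10 b0 c00 HB]]]] := prenormal_radius hB.
exists b1 => // r /andP[r0 rb] delta h kappa _ /andP[h0 hr] /andP[k0 k1].
have gc0 : 0 < gap_cos gamma.
  by have := @gap_cos_gt0 _ (Consts gamma 1 r delta 1 h kappa); apply.
have gp0 : 0 < pi * gap_cos gamma / 8 by rewrite divr_gt0 // mulr_gt0 // pi_gt0.
(* The budget pi gap_cos / 4 of [small] is shared equally between [c0] and h |sqrt(eps)|. *)
exists (pi * gap_cos gamma / 8) => // cz /andP[cz0 czc].
have r40 : 0 < r / 4 by rewrite divr_gt0.
(* The estimate is used at radius r / 4, where [Pi_sol] provides the equations. *)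
have [Cst [rhoA [Cst0 rhoA0 AP]]] := @apriori _ n _ _ _ b0 c00 r40.
have [da da0 DA] : exists2 d : R, 0 < d & forall w, cmod (sqrt_eps w) < d ->
  forall t, complex.Re t = 0 -> `|complex.Im t| < h -> Zt w t != 1 -> r <= cmod (xt w t).
  apply: (@axis_bound _ (Consts gamma 1 r delta 1 h kappa) h0 r0) => /=.
  by move: hr; rewrite -[h < _](ltr_pM2r r0) mulVf // gt_eqF.
(* A bound for |sqrt(eps)|: the terms serve the a priori estimate, [small], the exclusion of the
   imaginary axis, and the circle of radius r / 16 on which the parameter is extended. *)
pose q := Num.min (Num.min rhoA (pi * gap_cos gamma / 8 / h)) (Num.min da (r / 16)).
have q0 : 0 < q by rewrite !lt_min rhoA0 da0 (divr_gt0 gp0 h0) divr_gt0.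
exists (Num.min b1 (q ^+ 2)); first by rewrite lt_min b10 exprn_gt0.
move=> rho /andP[rho0]; rewrite lt_min => /andP[rhob rhoq] K _ _ FD FU HD HU CR CL hFD _ hH hS.
move=> m ns _ en s P0 hblock.
have P0u : P0 \in unitmx := unitmx_perm _ s.
have sqe w : Sdom K w -> cmod (sqrt_eps w) < q.
  move=> [+ _]; rewrite -sqrt_eps_sq cmodX => /= hw; have := lt_trans hw rhoq.
  by rewrite ltr_sqr // nnegrE ?cmod_ge0 // ltW.
have sqA w : Sdom K w -> cmod (sqrt_eps w) <= rhoA.
  by move=> /sqe; rewrite !lt_min => /andP[/andP[/ltW]].
have small w : Sdom K w -> hgt K * cmod (sqrt_eps w) + c0 K <= pi * gap_cos (gam K) / 4.
  move=> /sqe; rewrite !lt_min ltr_pdivlMr // => /andP[/andP[_ hw] _] /=.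
  move: hw; rewrite mulrC; move: czc; move: (h * _) (pi * _) => u v; lra.
have axis w t : Sdom K w -> complex.Re t = 0 -> `|complex.Im t| < hgt K -> Zt w t != 1 ->
    rdisc K <= cmod (xt w t).
  by move=> /sqe; rewrite !lt_min => /andP[_ /andP[h1 _]]; exact: DA.
have sq_small w : Sdom K w -> cmod (sqrt_eps w) < rdisc K / 4.
  by move=> /sqe; rewrite !lt_min => /andP[_ /andP[_ h1]] /=; move: h1 r0; clear; lra.
have eb1 w : Sdom K w -> cmod (eps w) < b1 by move=> [h1 _]; exact: lt_trans h1 rhob.
have bnd w D (dat : R) : Sdom K w ->
  sol (rdisc K / 4) (eps w) (L0 (eps w)) (L1 (eps w)) (Rm (eps w)) D -> 0 <= dat ->
  (forall j : 'I_n, cmod (D (sqrt_eps w) j j) <= dat) ->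
  forall x, cmod x <= rdisc K / 8 -> forall i j, cmod (D x i j) <= Cst * dat.
  move=> Sw; rewrite -[X in sol _ X]sqrt_eps_sq => hsol dat0 hdat x xr.
  apply: (AP (sqrt_eps w) (L0 (eps w)) (L1 (eps w)) (Rm (eps w))) => //; first exact: sqA.
    have [_ hl hg hR] := HB _ (eb1 w Sw); split=> //.
    - by move=> i; have [] := hl i.
    - by move=> i; have [] := hl i.
    - move=> y yr i j; have yb : cmod y < b1.
        by apply: lt_trans yr (lt_trans _ rb); rewrite ltr_pdivrMr // ltr_pMr // ltr1n.
      by have [] := hR y yb i j.
  by move: xr; rewrite /= (_ : r / 8 = r / 4 / 2) //; field.
have holR w : Sdom K w -> forall i j, hol (fun x => Rm (eps w) x i j) (rdisc K).
  move=> Sw i j x xr; have [_ _ _ hR] := HB _ (eb1 w Sw).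
  have [_ /diff_fder [d [d' hd]]] := hR x (lt_trans xr rb) i j.
  by exists d'; have := fder_cder2 hd.
have [ev evE] : exists ev : 'I_m -> 'rV[R[i]]_n, forall k, cunit en s k = diag_mx (ev k).
  have : forall k, exists v : 'rV[R[i]]_n, cunit en s k = diag_mx v.
    by move=> k; have [v vE] := bunit_diag (R := R) en k; eexists; rewrite /cunit vE perm_diag.
  by move=> /choice [f fP]; exists f.
have comm k w : Sdom K w -> comm_mx (diag_mx (ev k)) (CR w) /\ comm_mx (diag_mx (ev k)) (CL w).
  move=> Sw; have [[bR hR] [bL hL] _ _] := hblock w Sw; rewrite -evE /cunit.
  by split; apply: comm_mx_conjV => //; rewrite ?hR ?hL; exact: bunit_comm.
have cov w x : Sdom K w -> cmod x < rdisc K -> x ^+ 2 != eps w -> OmD K w x \/ OmU K w x.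
  exact: (@cover_disc _ K hgamma gam1 h0 k0).
have ovl w x : Sdom K w -> cmod x < rdisc K -> OmD K w x -> OmU K w x ->
    [\/ OmR K w x, OmL K w x | OmC K w x].
  by move=> Sw xr; apply: (@overlap _ K hgamma gam1 cz0 h0 k1 small) => // t; exact: axis.
have zD := @zero_OmD _ K hgamma gam1 cz0 h0 k0 r0 small.
have opD := @OmD_open _ K hgamma gam1 cz0 h0 k1 small.
have opU := @OmU_open _ K hgamma gam1 cz0 h0 k1 small.
have nD := @OmD_sq _ K hgamma gam1 cz0 h0 k1 small.
have nU := @OmU_sq _ K hgamma gam1 cz0 h0 k1 small.
have FDd w x : Sdom K w -> OmD K w x -> exists v, FD w x = diag_mx v.
  by move=> Sw; exact: FD_diagonal hFD Sw.
have onto := @Sdom_onto _ K hgamma.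
have spec k := Pe_spec (K := K) r0 cov ovl zD opD opU nD nU sq_small bnd onto holR FDd hH hS
  (fun w Sw => (comm k w Sw).1) (fun w Sw => (comm k w Sw).2).
have rho_r : rho <= (r / 8 / 2) ^+ 2.
  have q16 : q <= r / 16 by rewrite /q !ge_min lexx !orbT.
  rewrite (_ : r / 8 / 2 = r / 16); last by field.
  by apply: (le_trans (ltW rhoq)); rewrite ler_sqr // nnegrE ltW // divr_gt0.
(* Half the radius of the double Cauchy integral, as in [osgood], and within the domain of the
   coefficients. *)
pose a := Num.min (Num.min (3 / 8 * rho) (3 / 4 * (r / 8 / 2)) / 2) b1.
have r8 : 0 < r / 8 by rewrite divr_gt0.
have a0 : 0 < a.
  by rewrite lt_min b10 andbT divr_gt0 // lt_min !mulr_gt0 ?divr_gt0.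
have dL0 u i : cmod u < b1 -> exists d, cder (fun e => L0 e ord0 i) u d.
  by move=> /HB [h' _ _ _]; have [] := h' i.
have dL1 u i : cmod u < b1 -> exists d, cder (fun e => L1 e ord0 i) u d.
  by move=> /HB [h' _ _ _]; have [] := h' i.
have dR i j u x : cmod u < b1 -> cmod x < b1 ->
    differentiable (fun q : R[i] * R[i] => Rm q.1 q.2 i j) (u, x).
  by move=> /HB [_ _ _ h'] /h' /(_ i j) [].
pose Pk k := Pe K HD HU (ev k).
apply: (@decompose R n m ns en s (family_mx L0 L1 Rm) (fun k => extmx (Pk k) rho (r / 8)) a a0).
- move=> k i j u x; rewrite !lt_min => /andP[ua _] /andP[xa _].
  have [h1 h2 h3 h4] := spec k.
  exact: (extmx_diff rho0 r8 h1).
- move=> i j u x; rewrite !lt_min => /andP[_ ub] /andP[_ xb].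
  exact: (family_diff dL0 dL1 dR).
- move=> k u x ua xa; have [h1' h2 h3 h4] := spec k.
  exact: (extmx_ode b10 dL0 dL1 dR rho0 r8 rho_r h1' h2 h3).
- move=> k l u x; rewrite !lt_min => /andP[ua _] /andP[xa _].
  have a2 k' u' : cmod u' < Num.min (3 / 8 * rho) (3 / 4 * (r / 8 / 2)) / 2 ->
      malg (ccvg (cnbhs u')) (fun v => extmx (Pk k') rho (r / 8) v x) (extmx (Pk k') rho (r / 8) u' x).
    move=> ua' i j; have [h1 h2 h3 h4] := spec k'.
    apply: (diff_ccvg1 (f := fun v x => extmx (Pk k') rho (r / 8) v x i j)).
    exact: (extmx_diff rho0 r8 h1).
  have hm : Num.min (3 / 8 * rho) (3 / 4 * (r / 8 / 2)) / 2 < Num.min (3 / 8 * rho) (3 / 4 * (r / 8 / 2)).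
    have : 0 < Num.min (3 / 8 * rho) (3 / 4 * (r / 8 / 2)) by rewrite lt_min !mulr_gt0 ?divr_gt0.
    by move=> v0; rewrite ltr_pdivrMr // ltr_pMr // ltr1n.
  have off v : v != 0 -> cmod v < Num.min (3 / 8 * rho) (3 / 4 * (r / 8 / 2)) / 2 ->
      extmx (Pk k) rho (r / 8) v x *m extmx (Pk l) rho (r / 8) v x =
      (k == l)%:R *: extmx (Pk k) rho (r / 8) v x.
    move=> v0 va; have [h1 h2 h3 h4] := spec k; have [g1 g2 g3 g4] := spec l.
    have va' := lt_trans va hm; have xa' := lt_trans xa hm.
    rewrite (extmxE rho0 r8 rho_r h1 h2 h3) // (extmxE rho0 r8 rho_r g1 g2 g3) //.
    apply: (Pe_mul onto hH) => //.
    - by move: va'; rewrite lt_min => /andP[va' _]; apply: (lt_le_trans va'); rewrite ler_piMl ?(ltW rho0) // ler_pdivrMr // mul1r ler_nat.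
    - by move: xa'; rewrite lt_min => /andP[_ xa']; apply: (lt_le_trans xa') => /=; move: r0; clear => r0; lra.
    - by rewrite -!evE cunit_mul.
  (* At u = 0 the relation between the projectors follows by continuity in the parameter. *)
  have [u0|u0] := eqVneq u 0; last exact: off.
  rewrite u0 in ua *; apply: (@mul_extend _ _ (fun v => extmx (Pk k) rho (r / 8) v x)
    (fun v => extmx (Pk l) rho (r / 8) v x) _ (Num.min (3 / 8 * rho) (3 / 4 * (r / 8 / 2)) / 2)).
  - by rewrite divr_gt0 // lt_min !mulr_gt0 ?divr_gt0.
  - exact: a2.
  - exact: a2.
  - exact: off.
- move=> k; have [h1 h2 h3 h4] := spec k.
  rewrite evE; exact: (extmx00 rho0 r8 rho_r h1 h2 h3 h4).
Qed.
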